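(* Let $n\ge1$. Let $a_{1,1},\dots,a_{1,n}$ be real valued slow scale regular generalised functions of $t\in\mathbb R$ only, and let $a_0\in\mathcal G(\mathbb R^{n+1})$ be slow scale regular, compactly supported in $x$ and of slow scale logarithmic type. Let $u\in\mathcal G(\mathbb R^{n+1})$ be the unique solution of the Cauchy problem $$D_tu=\sum_{j=1}^na_{1,j}(t)D_ju+a_0(t,x)u,\qquad u(0,\cdot)=u_0\in\mathcal G_c(\mathbb R^n).$$ If there exists a choice of representatives $(a_{1,j,\varepsilon})_\varepsilon$ of $a_{1,j}$ such that $\Lambda_{j,\varepsilon}(t)=-\int_0^ta_{1,j,\varepsilon}(z)\,dz$, $j=1,\dots,n$, depends continuously on $\varepsilon$ and $$\lim_{\varepsilon\to0}\Lambda_{j,\varepsilon}(t)=\Lambda_j(t)\qquad\text{for all }t\in\mathbb R,\ j=1,\dots,n,$$ then $$\mathrm{WF}_{\mathcal G^\infty}u(t,\cdot)=\chi_t^{-1}(\mathrm{WF}_{\mathcal G^\infty}u_0),\qquad\text{where}\qquad\chi_t^{-1}(y,\eta)=(y_1+\Lambda_1(t),\dots,y_n+\Lambda_n(t),\eta).$$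
   Context: $D_t=-i\partial_t$, $D_j=-i\partial_{x_j}$. Nets are indexed by $\varepsilon\in(0,1]$ and $O(\cdot)$ refers to $\varepsilon\to0$. $\mathcal G(\mathbb R^d)$ is the Colombeau algebra: nets $(u_\varepsilon)$ in $C^\infty(\mathbb R^d)$ such that for all compact $K$ and all $\alpha$ there is $N$ with $\sup_K|\partial^\alpha u_\varepsilon|=O(\varepsilon^{-N})$, modulo nets with $\sup_K|\partial^\alpha u_\varepsilon|=O(\varepsilon^q)$ for all $K,\alpha,q$. $\mathcal G_c(\mathbb R^n)$ is the subalgebra of compactly supported elements. Operations are performed on representatives and equations are equalities in $\mathcal G$. A slow scale net is a net $(\mu_\varepsilon)$ in $\mathbb C$ with $|\mu_\varepsilon|^q=O(\varepsilon^{-1})$ for all $q\ge0$. An element $u\in\mathcal G(\mathbb R^d)$ is: real valued if it has a representative of real valued functions; of slow scale logarithmic type if it has a representative such that for every compact $K$ there is a slow scale net $(\mu_\varepsilon)$ with $\sup_K|u_\varepsilon|=O(\log\mu_\varepsilon)$; slow scale regular if it has a representative such that for every compact $K$ and every $\alpha$ there is a slow scale net $(\mu_\varepsilon)$ with $\sup_K|\partial^\alpha u_\varepsilon|=O(\mu_\varepsilon)$. A generalised function of $(t,x)$ is compactly supported in $x$ if its support is contained in $\mathbb R\times K$ for some compact $K\subset\mathbb R^n$. The representatives $a_{1,j,\varepsilon}$ are taken real valued. Wave front set: for $v\in\mathcal G(\mathbb R^n)$, $(x_0,\xi_0)\in T^*(\mathbb R^n)\setminus0$ is not in $\mathrm{WF}_{\mathcal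 G^\infty}v$ iff there are a representative $(v_\varepsilon)$ of $v$, $\varphi\in C_c^\infty(\mathbb R^n)$ with $\varphi(x_0)=1$, a conic neighbourhood $\Gamma$ of $\xi_0$ and $N\in\mathbb N$ such that for all $l\in\mathbb R$, $\sup_{\xi\in\Gamma}\langle\xi\rangle^l|\widehat{\varphi v_\varepsilon}(\xi)|=O(\varepsilon^{-N})$. *)

(* Defs.v *)
From HB Require Import structures.
From mathcomp Require Import all_boot all_order all_algebra.
From mathcomp Require Import generic_quotient ring_quotient complex.
From mathcomp Require Import ring lra.
From mathcomp Require Import all_classical all_reals all_analysis.

Set Implicit Arguments.
Unset Strict Implicit.
Unset Printing Implicit Defensive.

Import Order.TTheory GRing.Theory Num.Theory.
Import numFieldNormedType.Exports.
Import Normc.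

Local Open Scope classical_set_scope.
Local Open Scope ring_scope.
Local Open Scope quotient_scope.

Section Smooth.
Variable R : realType.

Definition basis_vec d (j : 'I_d) : 'rV[R]_d := delta_mx ord0 j.

(* R[i] is not a normed R-space in the library, so differentiation of
   complex-valued functions is done on real and imaginary parts. *)
Definition cpartial d (j : 'I_d) (f : 'rV[R]_d -> R[i]) : 'rV[R]_d -> R[i] :=
  fun x => ('D_(basis_vec j) (fun y => complex.Re (f y)) x
            +i* 'D_(basis_vec j) (fun y => complex.Im (f y)) x)%C.

(* Iterated partial derivatives are indexed by sequences of coordinates instead
   of multi-indices: on C^oo functions the order of the entries is immaterial,
   so that both families of derivatives coincide. *)
Definition cpartials d (s : seq 'I_d) (f : 'rV[R]_d -> R[i]) :
  'rV[R]_d -> R[i] := foldr (@cpartial d) f s.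

Definition C1_at d (f : 'rV[R]_d -> R[i]) (x : 'rV[R]_d) : Prop :=
  [/\ {for x, continuous (fun y => complex.Re (f y))},
      {for x, continuous (fun y => complex.Im (f y))},
      forall j, derivable (fun y => complex.Re (f y)) x (basis_vec j) &
      forall j, derivable (fun y => complex.Im (f y)) x (basis_vec j)].

Definition smooth d (f : 'rV[R]_d -> R[i]) : Prop :=
  forall (s : seq 'I_d) x, C1_at (cpartials s f) x.

Definition smooth_upto d n (f : 'rV[R]_d -> R[i]) : Prop :=
  forall (s : seq 'I_d) x, (size s <= n)%N -> C1_at (cpartials s f) x.

Lemma smooth_uptoP d (f : 'rV[R]_d -> R[i]) :
  smooth f <-> forall n, smooth_upto n f.
Proof.
split=> [fs n s x _|fs s x]; first exact: fs.
exact: (fs (size s)).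
Qed.

Lemma smooth_uptoW d m n (f : 'rV[R]_d -> R[i]) : (m <= n)%N ->
  smooth_upto n f -> smooth_upto m f.
Proof. by move=> mn fs s x sm; apply: fs; exact: leq_trans mn. Qed.

Lemma cpartials_rcons d (s : seq 'I_d) j f :
  cpartials (rcons s j) f = cpartials s (cpartial j f).
Proof. by rewrite /cpartials foldr_rcons. Qed.

Lemma smooth_upto_partial d n j (f : 'rV[R]_d -> R[i]) :
  smooth_upto n.+1 f -> smooth_upto n (cpartial j f).
Proof.
by move=> fs s x sn; rewrite -cpartials_rcons; apply: fs; rewrite size_rcons.
Qed.

Lemma smooth_partial d j (f : 'rV[R]_d -> R[i]) :
  smooth f -> smooth (cpartial j f).
Proof. by move=> fs s x; rewrite -cpartials_rcons; exact: fs. Qed.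

Local Notation Refun f := (fun y => complex.Re (f y)).
Local Notation Imfun f := (fun y => complex.Im (f y)).

Lemma RefunD d (f g : 'rV[R]_d -> R[i]) : Refun (f + g) = Refun f + Refun g.
Proof.
by apply/funext => y; rewrite /GRing.add/=; case: (f y); case: (g y).
Qed.

Lemma ImfunD d (f g : 'rV[R]_d -> R[i]) : Imfun (f + g) = Imfun f + Imfun g.
Proof.
by apply/funext => y; rewrite /GRing.add/=; case: (f y); case: (g y).
Qed.

Lemma RefunM d (f g : 'rV[R]_d -> R[i]) :
  Refun (f * g) = Refun f * Refun g - Imfun f * Imfun g.
Proof.
apply/funext => y; rewrite -[RHS]/(complex.Re (f y) * complex.Re (g y) -
  complex.Im (f y) * complex.Im (g y)) -[(f * g) y]/(f y * g y).
by case: (f y) => a b; case: (g y).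
Qed.

Lemma ImfunM d (f g : 'rV[R]_d -> R[i]) :
  Imfun (f * g) = Refun f * Imfun g + Imfun f * Refun g.
Proof.
apply/funext => y; rewrite -[RHS]/(complex.Re (f y) * complex.Im (g y) +
  complex.Im (f y) * complex.Re (g y)) -[(f * g) y]/(f y * g y).
by case: (f y) => a b; case: (g y).
Qed.

Lemma C1_atD d (f g : 'rV[R]_d -> R[i]) x :
  C1_at f x -> C1_at g x -> C1_at (f + g) x.
Proof.
move=> [f1 f2 f3 f4] [g1 g2 g3 g4]; split; rewrite ?RefunD ?ImfunD.
- exact: continuousD.
- exact: continuousD.
- by move=> j; exact: derivableD.
- by move=> j; exact: derivableD.
Qed.

Lemma cpartialD d j (f g : 'rV[R]_d -> R[i]) x :
  C1_at f x -> C1_at g x ->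
  cpartial j (f + g) x = cpartial j f x + cpartial j g x.
Proof.
move=> [f1 f2 f3 f4] [g1 g2 g3 g4].
by rewrite /cpartial RefunD ImfunD !deriveD.
Qed.

Lemma C1_atM d (f g : 'rV[R]_d -> R[i]) x :
  C1_at f x -> C1_at g x -> C1_at (f * g) x.
Proof.
move=> [f1 f2 f3 f4] [g1 g2 g3 g4]; split; rewrite ?RefunM ?ImfunM.
- by apply: continuousB; exact: continuousM.
- by apply: continuousD; exact: continuousM.
- by move=> j; apply: derivableB; exact: derivableM.
- by move=> j; apply: derivableD; exact: derivableM.
Qed.

Lemma cpartialM d j (f g : 'rV[R]_d -> R[i]) x :
  C1_at f x -> C1_at g x ->
  cpartial j (f * g) x = cpartial j f x * g x + f x * cpartial j g x.
Proof.
move=> [f1 f2 f3 f4] [g1 g2 g3 g4].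
rewrite /cpartial RefunM ImfunM deriveB ?deriveD; try exact: derivableM.
rewrite !deriveM//.
move: ('D__ (Refun f) x) ('D__ (Imfun f) x) => f' f''.
move: ('D__ (Refun g) x) ('D__ (Imfun g) x) => g' g''.
case: (f x) => a b; case: (g x) => c e /=; apply/eqP.
rewrite eq_complex /= -![_ *: _]/(_ * _).
by apply/andP; split; apply/eqP; ring.
Qed.

Lemma cpartials_D d n s (f g : 'rV[R]_d -> R[i]) : (size s <= n.+1)%N ->
  smooth_upto n f -> smooth_upto n g ->
  cpartials s (f + g) = cpartials s f + cpartials s g.
Proof.
move=> + fs gs; elim: s => [//|j s IHs] /= sn; rewrite IHs; last exact: ltnW.
by apply/funext => x; rewrite cpartialD//; [exact: fs|exact: gs].
Qed.

Lemma cpartialsD d s (f g : 'rV[R]_d -> R[i]) : smooth f -> smooth g ->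
  cpartials s (f + g) = cpartials s f + cpartials s g.
Proof.
move=> fs gs; apply: (@cpartials_D _ (size s)); first exact: leqnSn.
- by move=> ? ? _; exact: fs.
- by move=> ? ? _; exact: gs.
Qed.

Lemma smooth_uptoD d n (f g : 'rV[R]_d -> R[i]) :
  smooth_upto n f -> smooth_upto n g -> smooth_upto n (f + g).
Proof.
move=> fs gs s x sn; rewrite (@cpartials_D _ n)//; last exact: leqW.
by apply: C1_atD; [exact: fs|exact: gs].
Qed.

Lemma smoothD d (f g : 'rV[R]_d -> R[i]) :
  smooth f -> smooth g -> smooth (f + g).
Proof.
move=> /smooth_uptoP fs /smooth_uptoP gs; apply/smooth_uptoP => n.
exact: smooth_uptoD.
Qed.

Lemma cpartialM_upto d n j (f g : 'rV[R]_d -> R[i]) :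
  smooth_upto n f -> smooth_upto n g ->
  cpartial j (f * g) = cpartial j f * g + f * cpartial j g.
Proof.
move=> fs gs; apply/funext => x; rewrite cpartialM//.
- exact: (fs [::]).
- exact: (gs [::]).
Qed.

Lemma smooth_uptoM d n (f g : 'rV[R]_d -> R[i]) :
  smooth_upto n f -> smooth_upto n g -> smooth_upto n (f * g).
Proof.
elim: n f g => [|n IHn] f g fs gs s x.
  rewrite leqn0 => /nilP ->; apply: C1_atM; first exact: (fs [::]).
  exact: (gs [::]).
case/lastP: s => [_|s j].
  by apply: C1_atM; [exact: (fs [::])|exact: (gs [::])].
rewrite size_rcons ltnS => sn.
rewrite cpartials_rcons (cpartialM_upto _ fs gs).
apply: (@smooth_uptoD _ n) => //; apply: IHn.
- exact: smooth_upto_partial.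
- exact: smooth_uptoW gs.
- exact: smooth_uptoW fs.
- exact: smooth_upto_partial.
Qed.

Lemma smoothM d (f g : 'rV[R]_d -> R[i]) :
  smooth f -> smooth g -> smooth (f * g).
Proof.
move=> /smooth_uptoP fs /smooth_uptoP gs; apply/smooth_uptoP => n.
exact: smooth_uptoM.
Qed.

Lemma cpartialsM_rcons d s j (f g : 'rV[R]_d -> R[i]) : smooth f -> smooth g ->
  cpartials (rcons s j) (f * g) =
  cpartials s (cpartial j f * g) + cpartials s (f * cpartial j g).
Proof.
move=> fs gs; have [fs' gs'] := (smooth_partial j fs, smooth_partial j gs).
rewrite cpartials_rcons (@cpartialM_upto _ 0).
- by apply: cpartialsD; exact: smoothM.
- exact: (smooth_uptoP _).1.
- exact: (smooth_uptoP _).1.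
Qed.

Lemma cpartial_cst d j (c : R[i]) :
  cpartial j (cst c : 'rV[R]_d -> R[i]) = cst 0.
Proof. by apply/funext => x; rewrite /cpartial !derive_cst. Qed.

Lemma cpartials_cst d s (c : R[i]) :
  cpartials s (cst c : 'rV[R]_d -> R[i]) = cst (if nilp s then c else 0).
Proof.
elim: s => [//|j s IHs] /=; rewrite IHs cpartial_cst.
by [].
Qed.

Lemma smooth_cst d (c : R[i]) : smooth (cst c : 'rV[R]_d -> R[i]).
Proof.
move=> s x; rewrite cpartials_cst; split.
- exact: cst_continuous.
- exact: cst_continuous.
- by move=> j; exact: derivable_cst.
- by move=> j; exact: derivable_cst.
Qed.

End Smooth.

Section Rates.
Variable R : realType.

(* f = O(g) as e -> 0, uniformly on K. The constant has to be positive: the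
   rate g may be a logarithm, hence negative. *)
Definition bigO_on T (K : set T) (f : R -> T -> R) (g : R -> R) : Prop :=
  exists2 C : R, 0 < C &
    \forall e \near 0^'+, forall x, K x -> f e x <= C * g e.

Lemma near0_itv : \forall e \near (0 : R)^'+, 0 < e <= 1.
Proof.
near=> e; apply/andP; split; near: e.
- exact: nbhs_right_gt.
- exact: nbhs_right_le.
Unshelve. all: by end_near. Qed.

Lemma bigO_onW T (K : set T) f (g h : R -> R) :
  (forall e, 0 < e <= 1 -> g e <= h e) -> bigO_on K f g -> bigO_on K f h.
Proof.
move=> gh [C C0 fC]; exists C => //; near=> e => x Kx.
apply: (@le_trans _ _ (C * g e)); first by move: x Kx; near: e.
by rewrite ler_pM2l// gh//; near: e; exact: near0_itv.
Unshelve. all: by end_near. Qed.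

Lemma bigO_onD T (K : set T) f f1 f2 (g : R -> R) :
  (forall e x, 0 < e <= 1 -> f e x <= f1 e x + f2 e x) ->
  bigO_on K f1 g -> bigO_on K f2 g -> bigO_on K f g.
Proof.
move=> ff [C1 C10 fC1] [C2 C20 fC2]; exists (C1 + C2); first exact: addr_gt0.
near=> e => x Kx; apply: (@le_trans _ _ (f1 e x + f2 e x)).
  by apply: ff; near: e; exact: near0_itv.
by rewrite mulrDl lerD//; move: x Kx; near: e.
Unshelve. all: by end_near. Qed.

Lemma bigO_onM T (K : set T) f f1 f2 (g g1 g2 : R -> R) :
  (forall e x, 0 < e <= 1 -> f e x <= f1 e x * f2 e x) ->
  (forall e x, 0 <= f1 e x) -> (forall e x, 0 <= f2 e x) ->
  (forall e, 0 < e <= 1 -> g1 e * g2 e <= g e) ->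
  bigO_on K f1 g1 -> bigO_on K f2 g2 -> bigO_on K f g.
Proof.
move=> ff f10 f20 gg [C1 C10 fC1] [C2 C20 fC2].
exists (C1 * C2); first exact: mulr_gt0.
near=> e => x Kx; have e01 : 0 < e <= 1 by near: e; exact: near0_itv.
apply: (le_trans (ff e x e01)).
apply: (@le_trans _ _ ((C1 * g1 e) * (C2 * g2 e))).
  by apply: ler_pM => //; move: x Kx; near: e.
by rewrite mulrACA ler_pM2l ?gg// mulr_gt0.
Unshelve. all: by end_near. Qed.

Lemma expr_le_mono (e : R) m n : 0 < e <= 1 -> (m <= n)%N -> e ^+ n <= e ^+ m.
Proof.
by move=> /andP[e0 e1] mn; rewrite ler_wiXn2l// ltW.
Qed.

Lemma exprV_le_mono (e : R) m n : 0 < e <= 1 -> (m <= n)%N -> e ^- m <= e ^- n.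
Proof.
move=> e01 mn; rewrite lef_pV2 ?expr_le_mono//.
all: by rewrite posrE exprn_gt0//; case/andP: e01.
Qed.

Lemma normc_ge0 (z : R[i]) : 0 <= normc z.
Proof. by case: z => a b; rewrite sqrtr_ge0. Qed.

End Rates.

Section Colombeau.
Variable R : realType.

(* Nets of functions are indexed by the type R; only the values for
   0 < e <= 1 matter in what follows. *)
Definition moderate_bound d (u : R -> 'rV[R]_d -> R[i]) : Prop :=
  forall K : set 'rV[R]_d, compact K -> forall s : seq 'I_d, exists N : nat,
    bigO_on K (fun e x => normc (cpartials s (u e) x)) (fun e => e ^- N).

Definition negligible_bound d (u : R -> 'rV[R]_d -> R[i]) : Prop :=
  forall K : set 'rV[R]_d, compact K -> forall (s : seq 'I_d) (q : nat),
    bigO_on K (fun e x => normc (cpartials s (u e) x)) (fun e => e ^+ q).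

Definition smooth_net d (u : R -> 'rV[R]_d -> R[i]) : Prop :=
  forall e, 0 < e <= 1 -> smooth (u e).

Definition moderate d : {pred R -> 'rV[R]_d -> R[i]} :=
  fun u => `[< smooth_net u /\ moderate_bound u >].

Arguments moderate : clear implicits.

Lemma moderateP d (u : R -> 'rV[R]_d -> R[i]) :
  reflect (smooth_net u /\ moderate_bound u) (u \in moderate d).
Proof. exact: asboolP. Qed.

Definition partial_net d j (u : R -> 'rV[R]_d -> R[i]) : R -> 'rV[R]_d -> R[i] :=
  fun e => cpartial j (u e).

Lemma moderate_partial d j u :
  u \in moderate d -> partial_net j u \in moderate d.
Proof.
move=> /moderateP[us um]; apply/moderateP; split.
  by move=> e /us; exact: smooth_partial.
move=> K Kc s; have [N uN] := um K Kc (rcons s j); exists N.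
by case: uN => C C0 uC; exists C => //; under eq_near do rewrite -cpartials_rcons.
Qed.

Lemma boundD d K s (u v : R -> 'rV[R]_d -> R[i]) g :
  smooth_net u -> smooth_net v ->
  bigO_on K (fun e x => normc (cpartials s (u e) x)) g ->
  bigO_on K (fun e x => normc (cpartials s (v e) x)) g ->
  bigO_on K (fun e x => normc (cpartials s ((u + v) e) x)) g.
Proof.
move=> us vs; apply: bigO_onD => e x e01.
rewrite -[(u + v) e]/(u e + v e) cpartialsD; [|exact: us|exact: vs].
exact: le_normcD.
Qed.

Lemma moderate_cst d (c : R[i]) : cst (cst c) \in moderate d.
Proof.
apply/moderateP; split; first by move=> e _; exact: smooth_cst.
move=> K _ s; exists 0%N; exists (normc c + 1).
  by rewrite ltr_wpDl// normc_ge0.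
near=> e => x _; rewrite expr0 invr1 mulr1 cpartials_cst /=.
case: ifP => _; first by rewrite lerDl.
by rewrite normc0 addr_ge0// normc_ge0.
Unshelve. all: by end_near. Qed.

Lemma moderateD d u v : u \in moderate d -> v \in moderate d ->
  u + v \in moderate d.
Proof.
move=> /moderateP[us um] /moderateP[vs vm]; apply/moderateP; split.
  by move=> e e01; apply: smoothD; [exact: us|exact: vs].
move=> K Kc s; have [[M uM] [N vN]] := (um K Kc s, vm K Kc s).
exists (maxn M N); apply: boundD => //.
- by apply: bigO_onW uM => e e01; rewrite exprV_le_mono// leq_maxl.
- by apply: bigO_onW vN => e e01; rewrite exprV_le_mono// leq_maxr.
Qed.

Lemma smooth_netM d (u v : R -> 'rV[R]_d -> R[i]) :
  smooth_net u -> smooth_net v -> smooth_net (u * v).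
Proof. by move=> us vs e e01; apply: smoothM; [exact: us|exact: vs]. Qed.

Lemma boundM_rcons d K s j (u v : R -> 'rV[R]_d -> R[i]) g :
  smooth_net u -> smooth_net v ->
  bigO_on K (fun e x => normc (cpartials s ((partial_net j u * v) e) x)) g ->
  bigO_on K (fun e x => normc (cpartials s ((u * partial_net j v) e) x)) g ->
  bigO_on K (fun e x => normc (cpartials (rcons s j) ((u * v) e) x)) g.
Proof.
move=> us vs; apply: bigO_onD => e x e01.
rewrite -[(u * v) e]/(u e * v e) cpartialsM_rcons; [|exact: us|exact: vs].
exact: le_normcD.
Qed.

Lemma moderateM d u v : u \in moderate d -> v \in moderate d ->
  u * v \in moderate d.
Proof.
move=> um vm; apply/moderateP; split.
  by apply: smooth_netM; [case/moderateP: um|case/moderateP: vm].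
move=> K Kc s; elim/last_ind: s u v um vm => [|s j IHs] u v um vm.
  have [[_ um'] [_ vm']] := (moderateP _ um, moderateP _ vm).
  have [[M uM] [N vN]] := (um' K Kc [::], vm' K Kc [::]).
  exists (M + N)%N; apply: bigO_onM uM vN => //=.
  - by move=> e x _; rewrite -normcM.
  - by move=> e x; exact: normc_ge0.
  - by move=> e x; exact: normc_ge0.
  - by move=> e _; rewrite exprD invfM.
have [M uM] := IHs _ _ (moderate_partial j um) vm.
have [N vN] := IHs _ _ um (moderate_partial j vm).
exists (maxn M N); apply: boundM_rcons.
- by case/moderateP: um.
- by case/moderateP: vm.
- by apply: bigO_onW uM => e e01; rewrite exprV_le_mono// leq_maxl.
- by apply: bigO_onW vN => e e01; rewrite exprV_le_mono// leq_maxr.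
Qed.

Lemma moderate_subring d : subring_closed (moderate d).
Proof.
split; first exact: moderate_cst.
  move=> u v um vm; rewrite -mulN1r; apply: moderateD => //.
  apply: moderateM => //.
  suff -> : - 1 = cst (cst (- 1)) :> (R -> 'rV[R]_d -> R[i]).
    exact: moderate_cst.
  by [].
by move=> u v; exact: moderateM.
Qed.

HB.instance Definition _ d :=
  GRing.isSubringClosed.Build _ (moderate d) (@moderate_subring d).

(* The algebra E_M of moderate nets, *)
Record mnet d := MNet {
  mnet_val :> R -> 'rV[R]_d -> R[i] ;
  mnetP : mnet_val \in moderate d }.

HB.instance Definition _ d := [isSub for @mnet_val d].
HB.instance Definition _ d := [Choice of mnet d by <:].
HB.instance Definition _ d := [SubChoice_isSubComNzRing of mnet d by <:].

(* its ideal N of negligible nets, *)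
Definition negligible d : {pred mnet d} := fun u => `[< negligible_bound u >].

Arguments negligible : clear implicits.

Lemma negligibleP d (u : mnet d) :
  reflect (negligible_bound u) (u \in negligible d).
Proof. exact: asboolP. Qed.

Lemma mnet_smooth d (u : mnet d) : smooth_net u.
Proof. by case/moderateP: (mnetP u). Qed.

Lemma mnet_valD d (u v : mnet d) :
  mnet_val (u + v) = mnet_val u + mnet_val v.
Proof. by []. Qed.

Lemma mnet_valN d (u : mnet d) : mnet_val (- u) = - mnet_val u.
Proof. by []. Qed.

Lemma mnet_valM d (u v : mnet d) :
  mnet_val (u * v) = mnet_val u * mnet_val v.
Proof. by []. Qed.

Lemma negligible_partial d j (u : R -> 'rV[R]_d -> R[i]) :
  negligible_bound u -> negligible_bound (partial_net j u).
Proof.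
move=> un K Kc s q; have [C C0 uC] := un K Kc (rcons s j) q.
by exists C => //; under eq_near do rewrite -cpartials_rcons.
Qed.

Lemma smooth_net_partial d j (u : R -> 'rV[R]_d -> R[i]) :
  smooth_net u -> smooth_net (partial_net j u).
Proof. by move=> us e /us; exact: smooth_partial. Qed.

Lemma negligible_boundM d (a u : R -> 'rV[R]_d -> R[i]) :
  a \in moderate d -> smooth_net u ->
  negligible_bound u -> negligible_bound (a * u).
Proof.
move=> am us un K Kc s q.
elim/last_ind: s a u am us un q => [|s j IHs] a u am us un q.
  have [_ /(_ K Kc [::])[M aM]] := moderateP _ am.
  apply: bigO_onM aM (un K Kc [::] (M + q)%N) => /=.
  - by move=> e x _; rewrite -normcM.
  - by move=> e x; exact: normc_ge0.
  - by move=> e x; exact: normc_ge0.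
  - move=> e /andP[e0 _]; rewrite exprD mulKf// expf_neq0//.
    by rewrite gt_eqF.
have as_ : smooth_net a by case/moderateP: am.
apply: (boundM_rcons as_ us).
- by apply: (IHs _ _ _ us un); exact: moderate_partial.
- apply: (IHs _ _ am); first exact: smooth_net_partial.
  exact: negligible_partial.
Qed.

Lemma negligible_boundD d (u v : R -> 'rV[R]_d -> R[i]) :
  smooth_net u -> smooth_net v ->
  negligible_bound u -> negligible_bound v -> negligible_bound (u + v).
Proof.
move=> us vs un vn K Kc s q.
exact: (boundD us vs (un K Kc s q) (vn K Kc s q)).
Qed.

Lemma negligible_ideal d : idealr_closed (negligible d).
Proof.
split.
- apply/negligibleP => K _ s q; exists 1 => //; near=> e => x _.
  rewrite mul1r -[X in cpartials s X]/(cst 0) cpartials_cst /= if_same normc0.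
  by rewrite exprn_ge0// ltW//; near: e; exact: nbhs_right_gt.
- have c0 : compact [set 0 : 'rV[R]_d] by exact: compact_set1.
  apply/negP => /negligibleP /(_ _ c0 [::] 1%N).
  move=> [C C0 hC].
  have C10 : 0 < (C + 1)^-1 by rewrite invr_gt0 addr_gt0.
  have : \forall e \near (0 : R)^'+, False.
    near=> e.
    have : normc (1 : R[i]) <= C * e ^+ 1.
      have : forall x, [set 0] x -> normc (cpartials [::] ((1 : mnet d) e) x)
        <= C * e ^+ 1 by near: e.
      by move=> /(_ 0 erefl).
    have eC : e < (C + 1)^-1 by near: e; exact: nbhs_right_lt.
    rewrite normc1 expr1 leNgt => /negP; apply.
    have e0 : 0 < e by near: e; exact: nbhs_right_gt.
    have : e * (C + 1) < 1 by rewrite -ltr_pdivlMr ?addr_gt0// mul1r.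
    rewrite mulrDr mulr1 [e * C]mulrC; clear -e0; lra.
  by move=> /filter_ex [].
- move=> a u v /negligibleP un /negligibleP vn; apply/negligibleP.
  rewrite mnet_valD mnet_valM; apply: negligible_boundD vn.
  + exact: smooth_netM (@mnet_smooth _ a) (@mnet_smooth _ u).
  + exact: mnet_smooth.
  + exact: negligible_boundM (mnetP a) (@mnet_smooth _ u) un.
Unshelve. all: by end_near. Qed.

HB.instance Definition _ d :=
  isIdealr.Build _ (negligible d) (@negligible_ideal d).

(* and the Colombeau algebra G = E_M / N. *)
Definition colombeau d : Type := Quotient.quot (negligible d).
HB.instance Definition _ d := GRing.ComNzRing.on (colombeau d).
HB.instance Definition _ d := EqQuotient.on (colombeau d).

End Colombeau.

Arguments moderate R d : clear implicits.
Arguments negligible R d : clear implicits.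

Section Operations.
Variable R : realType.

Definition gclass d (v : mnet R d) : colombeau R d := \pi_(colombeau R d) v.

Lemma gclassP d (v w : mnet R d) :
  gclass v = gclass w <-> negligible_bound (v - w).
Proof.
have -> : (gclass v = gclass w) <-> (v - w \in negligible R d).
  rewrite (Quotient.idealrBE (negligible R d)); split=> [e|/eqP e].
    by apply/eqP; exact: e.
  exact: e.
by split=> [/negligibleP|?]; last exact/negligibleP.
Qed.

Definition mpartial d j (u : mnet R d) : mnet R d :=
  MNet (moderate_partial j (mnetP u)).

Definition mcst d (c : R[i]) : mnet R d := MNet (moderate_cst d c).

(* R^(n+1) = R_t x R^n_x, the time variable being the coordinate ord0 *)
Definition spacetime n (t : R) (x : 'rV[R]_n) : 'rV[R]_n.+1 :=
  \row_i oapp (x ord0) t (unlift ord0 i).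

Definition slice_net n t (u : R -> 'rV[R]_n.+1 -> R[i]) : R -> 'rV[R]_n -> R[i] :=
  fun e x => u e (spacetime t x).

Definition pull_net n (a : R -> 'rV[R]_1 -> R[i]) : R -> 'rV[R]_n.+1 -> R[i] :=
  fun e z => a e (const_mx (z ord0 ord0)).

Lemma rV_continuous (T : topologicalType) n (f : T -> 'rV[R]_n) :
  (forall i, continuous (fun x => f x ord0 i)) -> continuous f.
Proof.
move=> fc x A [P fP PA].
have : \forall y \near x, forall i, P ord0 i (f y ord0 i).
  by apply: filter_forall => i; apply: (fc i x); exact: fP.
apply: filterS => y Py; apply: PA => i j.
by rewrite (ord1 i); exact: Py.
Qed.

Lemma spacetime_continuous n t : continuous (@spacetime n t).
Proof.
apply: rV_continuous => i.
have -> : (fun x => spacetime t x ord0 i) =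
  (fun x : 'rV[R]_n => oapp (x ord0) t (unlift ord0 i)).
  by apply/funext => x; rewrite mxE.
case: unliftP => [j _|_] /=; first exact: coord_continuous.
exact: cst_continuous.
Qed.

Lemma pull_continuous n : continuous
  (fun z : 'rV[R]_n.+1 => const_mx (z ord0 ord0) : 'rV[R]_1).
Proof.
apply: rV_continuous => i.
have -> : (fun z : 'rV[R]_n.+1 => (const_mx (z ord0 ord0) : 'rV_1) ord0 i) =
  (fun z => z ord0 ord0) by apply/funext => z; rewrite mxE.
exact: coord_continuous.
Qed.

Lemma spacetime_shift n t (x : 'rV[R]_n) h j :
  spacetime t (h *: basis_vec R j + x) =
  h *: basis_vec R (lift ord0 j) + spacetime t x.
Proof.
apply/rowP => i; rewrite !mxE; case: unliftP => [k ->|->] /=.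
  by rewrite !mxE (inj_eq lift_inj).
by rewrite mulr0 add0r.
Qed.

Lemma pull_shift n (z : 'rV[R]_n.+1) h j :
  const_mx ((h *: basis_vec R j + z) ord0 ord0) =
  h *: (if j == ord0 then basis_vec R ord0 else 0) + const_mx (z ord0 ord0)
    :> 'rV[R]_1.
Proof.
apply/rowP => i; rewrite !mxE !eqxx (eq_sym ord0 j) /= (ord1 i).
by case: (j == ord0); rewrite !mxE /= ?eqxx.
Qed.

Lemma C1_at_slice n t (f : 'rV[R]_n.+1 -> R[i]) x :
  C1_at f (spacetime t x) -> C1_at (f \o spacetime t) x.
Proof.
move=> [f1 f2 f3 f4]; split.
- exact: (continuous_comp (@spacetime_continuous n t x) f1).
- exact: (continuous_comp (@spacetime_continuous n t x) f2).
- move=> j; move: (f3 (lift ord0 j)); rewrite /derivable.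
  by under eq_fun do rewrite /= -spacetime_shift.
- move=> j; move: (f4 (lift ord0 j)); rewrite /derivable.
  by under eq_fun do rewrite /= -spacetime_shift.
Qed.

Lemma derive_slice n t (g : 'rV[R]_n.+1 -> R) x j :
  'D_(basis_vec R j) (fun y => g (spacetime t y)) x =
  'D_(basis_vec R (lift ord0 j)) g (spacetime t x).
Proof. by rewrite /derive; under eq_fun do rewrite /= spacetime_shift. Qed.

Lemma cpartial_slice n t j (f : 'rV[R]_n.+1 -> R[i]) :
  cpartial j (f \o spacetime t) = cpartial (lift ord0 j) f \o spacetime t.
Proof.
apply/funext => x; rewrite /cpartial /=.
by rewrite (derive_slice t (fun z => complex.Re (f z)))
  (derive_slice t (fun z => complex.Im (f z))).
Qed.

Lemma cpartials_slice n t s (f : 'rV[R]_n.+1 -> R[i]) :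
  cpartials s (f \o spacetime t) =
  cpartials (map (lift ord0) s) f \o @spacetime n t.
Proof. by elim: s => [//|j s IHs] /=; rewrite IHs cpartial_slice. Qed.

Lemma C1_at_pull n (f : 'rV[R]_1 -> R[i]) (z : 'rV[R]_n.+1) :
  C1_at f (const_mx (z ord0 ord0)) ->
  C1_at (fun z : 'rV[R]_n.+1 => f (const_mx (z ord0 ord0))) z.
Proof.
move=> [f1 f2 f3 f4]; split.
- exact: (continuous_comp (@pull_continuous n z) f1).
- exact: (continuous_comp (@pull_continuous n z) f2).
- move=> j; rewrite /derivable; under eq_fun do rewrite /= pull_shift.
  case: (j == ord0); first exact: f3.
  by under eq_fun do rewrite scaler0 add0r subrr scaler0; exact: is_cvg_cst.
- move=> j; rewrite /derivable; under eq_fun do rewrite /= pull_shift.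
  case: (j == ord0); first exact: f4.
  by under eq_fun do rewrite scaler0 add0r subrr scaler0; exact: is_cvg_cst.
Qed.

Lemma derive_pull n (g : 'rV[R]_1 -> R) (z : 'rV[R]_n.+1) j :
  'D_(basis_vec R j) (fun z : 'rV[R]_n.+1 => g (const_mx (z ord0 ord0))) z =
  if j == ord0 then 'D_(basis_vec R ord0) g (const_mx (z ord0 ord0)) else 0.
Proof.
rewrite /derive; under eq_fun do rewrite /= pull_shift.
case: (j == ord0) => //.
under eq_fun do rewrite scaler0 add0r subrr scaler0.
exact: lim_cst.
Qed.

Lemma cpartial_pull n j (f : 'rV[R]_1 -> R[i]) :
  cpartial j (fun z : 'rV[R]_n.+1 => f (const_mx (z ord0 ord0))) =
  if j == ord0 then fun z => cpartial ord0 f (const_mx (z ord0 ord0))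
  else cst 0.
Proof.
apply/funext => z; rewrite /cpartial.
rewrite (derive_pull (fun z => complex.Re (f z)))
  (derive_pull (fun z => complex.Im (f z))).
by case: (j == ord0).
Qed.

Lemma cpartials_pull n (s : seq 'I_n.+1) (f : 'rV[R]_1 -> R[i]) :
  cpartials s (fun z : 'rV[R]_n.+1 => f (const_mx (z ord0 ord0))) =
  if all (pred1 ord0) s then
    fun z => cpartials (nseq (size s) ord0) f (const_mx (z ord0 ord0))
  else cst 0.
Proof.
elim: s => [//|j s IHs] /=; rewrite IHs.
case: (all _ s); last by rewrite cpartial_cst andbF.
by rewrite cpartial_pull andbT.
Qed.

Lemma moderate_slice n t u :
  u \in moderate R n.+1 -> slice_net t u \in moderate R n.
Proof.
move=> /moderateP[us um]; apply/moderateP; split.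
  move=> e e01 s x; rewrite -[slice_net t u e]/(u e \o spacetime t).
  by rewrite cpartials_slice; apply: C1_at_slice; exact: us.
move=> K Kc s.
have Kc' : compact (@spacetime n t @` K).
  apply: continuous_compact => //; apply: continuous_subspaceT.
  exact: spacetime_continuous.
have [N [C C0 uC]] := um _ Kc' (map (lift ord0) s); exists N, C => //.
apply: filterS uC => e uC x Kx.
rewrite -[slice_net t u e]/(u e \o spacetime t) cpartials_slice.
by apply: uC; exists x.
Qed.

Lemma moderate_pull n a :
  a \in moderate R 1 -> pull_net a \in moderate R n.+1.
Proof.
move=> /moderateP[us um]; apply/moderateP; split.
  move=> e e01 s x; rewrite /pull_net cpartials_pull; case: ifP => _.
    by apply: C1_at_pull; exact: us.
  exact: (@smooth_cst _ _ 0 [::]).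
move=> K Kc s.
have Kc' : compact ((fun z : 'rV[R]_n.+1 =>
    const_mx (z ord0 ord0) : 'rV[R]_1) @` K).
  apply: continuous_compact => //; apply: continuous_subspaceT.
  exact: pull_continuous.
have [N [C C0 uC]] := um _ Kc' (nseq (size s) ord0); exists N, C => //.
near=> e => x Kx.
have e0 : 0 < e by near: e; exact: nbhs_right_gt.
rewrite /pull_net cpartials_pull; case: ifP => _.
  apply: (near uC e) => //; by exists x.
by rewrite normc0 mulr_ge0 ?(ltW C0)// invr_ge0 exprn_ge0// ltW.
Unshelve. all: by end_near. Qed.

Definition mslice n t (u : mnet R n.+1) : mnet R n :=
  MNet (moderate_slice t (mnetP u)).

Definition mpull n (a : mnet R 1) : mnet R n.+1 :=
  MNet (moderate_pull n (mnetP a)).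

(* Operations on G, performed on representatives; the lemmas g*E below state
   that the choice of the representative is immaterial. *)
Definition gcst d (c : R[i]) : colombeau R d := gclass (mcst d c).

Definition gpartial d (j : 'I_d) (u : colombeau R d) : colombeau R d :=
  gclass (mpartial j (repr u)).

Definition grestr n t (u : colombeau R n.+1) : colombeau R n :=
  gclass (mslice t (repr u)).

(* the function (t, x) |-> a(t), for a generalised function a of t only *)
Definition gpull n (a : colombeau R 1) : colombeau R n.+1 :=
  gclass (mpull n (repr a)).

Lemma repr_gclass d (v : mnet R d) :
  negligible_bound (repr (gclass v) - v : mnet R d).
Proof. by apply/gclassP; rewrite /gclass reprK. Qed.

Lemma gpartialE d j (v : mnet R d) :
  gpartial j (gclass v) = gclass (mpartial j v).
Proof.
apply/gclassP; have := negligible_partial j (repr_gclass v).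
move=> un K Kc s q; have [C C0 hC] := un K Kc s q; exists C => //.
near=> e => x Kx.
have e01 : 0 < e <= 1 by near: e; exact: near0_itv.
have -> : (mpartial j (repr (gclass v)) - mpartial j v : mnet R d) e =
          partial_net j (repr (gclass v) - v : mnet R d) e.
  rewrite /partial_net; set w := (repr (gclass v) - v : mnet R d).
  have -> : mnet_val (mpartial j (repr (gclass v)) - mpartial j v) e =
    cpartial j (repr (gclass v) e) - cpartial j (v e) by [].
  have -> : repr (gclass v) e = w e + v e.
    apply/funext => y.
    by rewrite -[RHS]/(repr (gclass v) e y - v e y + v e y) subrK.
  apply/funext => y.
  have wy := @mnet_smooth _ _ w e e01 [::] y.
  have vy := @mnet_smooth _ _ v e e01 [::] y.
  rewrite -[LHS]/(cpartial j (w e + v e) y - cpartial j (v e) y).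
  by rewrite (cpartialD j wy vy) addrK.
by apply: (near hC e).
Unshelve. all: by end_near. Qed.

Lemma grestrE n t (v : mnet R n.+1) :
  grestr t (gclass v) = gclass (mslice t v).
Proof.
apply/gclassP => K Kc s q.
have Kc' : compact (@spacetime n t @` K).
  apply: continuous_compact => //; apply: continuous_subspaceT.
  exact: spacetime_continuous.
have [C C0 uC] := repr_gclass v Kc' (map (lift ord0) s) q.
exists C => //; apply: filterS uC => e uC x Kx.
have -> : (mslice t (repr (gclass v)) - mslice t v : mnet R n) e =
  (repr (gclass v) - v : mnet R n.+1) e \o spacetime t by [].
by rewrite cpartials_slice; apply: uC; exists x.
Qed.

Lemma gpullE n (v : mnet R 1) : gpull n (gclass v) = gclass (mpull n v).
Proof.
apply/gclassP => K Kc s q.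
have Kc' : compact ((fun z : 'rV[R]_n.+1 =>
    const_mx (z ord0 ord0) : 'rV[R]_1) @` K).
  apply: continuous_compact => //; apply: continuous_subspaceT.
  exact: pull_continuous.
have [C C0 uC] := repr_gclass v Kc' (nseq (size s) ord0) q.
exists C => //; near=> e => x Kx.
have e0 : 0 < e by near: e; exact: nbhs_right_gt.
have -> : (mpull n (repr (gclass v)) - mpull n v : mnet R n.+1) e =
  (fun z => (repr (gclass v) - v : mnet R 1) e (const_mx (z ord0 ord0))) by [].
rewrite cpartials_pull; case: ifP => _.
  by apply: (near uC e) => //; exists x.
by rewrite normc0 mulr_ge0 ?(ltW C0)// exprn_ge0// ltW.
Unshelve. all: by end_near. Qed.

(* D_j = - i d/dx_j *)
Definition gD d (j : 'I_d) (u : colombeau R d) : colombeau R d :=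
  gcst d (0 -i* 1)%C * gpartial j u.

Definition cauchy_solution n (a1 : 'I_n -> colombeau R 1)
    (a0 : colombeau R n.+1) (u0 : colombeau R n) (u : colombeau R n.+1) : Prop :=
  gD ord0 u = \sum_(j < n) gpull n (a1 j) * gD (lift ord0 j) u + a0 * u /\
  grestr 0 u = u0.

End Operations.

Section Properties.
Variable R : realType.

Definition slow_scale (mu : R -> R[i]) : Prop :=
  forall q : R, 0 <= q ->
    exists2 C : R, 0 < C & \forall e \near 0^'+, normc (mu e) `^ q <= C * e^-1.

Definition real_net d (v : mnet R d) : Prop :=
  forall e x, 0 < e <= 1 -> complex.Im (v e x) = 0.

Definition real_valued d (u : colombeau R d) : Prop :=
  exists2 v : mnet R d, gclass v = u & real_net v.

Definition slow_scale_regular d (u : colombeau R d) : Prop :=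
  exists2 v : mnet R d, gclass v = u &
    forall K : set 'rV[R]_d, compact K -> forall s : seq 'I_d,
    exists2 mu, slow_scale mu &
      bigO_on K (fun e x => normc (cpartials s (v e) x)) (fun e => normc (mu e)).

(* As the constants in bigO_on are positive, the estimate forces |mu_e| >= 1
   wherever it is not void; with |log |mu_e|| as a rate instead, nets mu_e
   tending to 0 would make this condition much weaker. *)
Definition slow_scale_log d (u : colombeau R d) : Prop :=
  exists2 v : mnet R d, gclass v = u &
    forall K : set 'rV[R]_d, compact K ->
    exists2 mu, slow_scale mu &
      bigO_on K (fun e x => normc (v e x)) (fun e => ln (normc (mu e))).

(* the restriction of u to the open set V is 0 in G(V) *)
Definition vanishes_on d (u : colombeau R d) (V : set 'rV[R]_d) : Prop :=
  exists2 v : mnet R d, gclass v = u &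
    forall K : set 'rV[R]_d, compact K -> K `<=` V ->
    forall (s : seq 'I_d) (q : nat),
      bigO_on K (fun e x => normc (cpartials s (v e) x)) (fun e => e ^+ q).

Definition gsupp d (u : colombeau R d) : set 'rV[R]_d :=
  ~` \bigcup_(V in [set V | open V /\ vanishes_on u V]) V.

Definition compactly_supported d (u : colombeau R d) : Prop :=
  exists2 K : set 'rV[R]_d, compact K & gsupp u `<=` K.

Definition compactly_supported_in_x n (u : colombeau R n.+1) : Prop :=
  exists2 K : set 'rV[R]_n, compact K &
    gsupp u `<=` [set z | exists t x, K x /\ z = spacetime t x].

(* int_0^t f, with the usual sign convention for t < 0 *)
Definition integral_from0 (f : R -> R) (t : R) : R :=
  if 0 <= t then \int[lebesgue_measure]_(z in `[0, t]) f z
  else - \int[lebesgue_measure]_(z in `[t, 0]) f z.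

(* The net Lambda_e(t); for a real valued net a, Re a = a. *)
Definition Lambda_net (a : mnet R 1) (e t : R) : R :=
  - integral_from0 (fun z => complex.Re (a e (const_mx z))) t.

(* The Lebesgue integral over R^d as an iterated integral; it is applied below
   to continuous compactly supported functions only. *)
Fixpoint integral_rV d : ('rV[R]_d -> R) -> R :=
  match d with
  | 0 => fun f => f 0
  | d'.+1 => fun f => \int[lebesgue_measure]_t
               integral_rV (fun x : 'rV[R]_d' => f (spacetime t x))
  end.

Definition dot d (x y : 'rV[R]_d) : R := \sum_j x ord0 j * y ord0 j.

Definition japanese d (xi : 'rV[R]_d) : R := Num.sqrt (1 + dot xi xi).

Definition fourier d (f : 'rV[R]_d -> R[i]) (xi : 'rV[R]_d) : R[i] :=
  let g x := (cos (dot x xi) -i* sin (dot x xi))%C * f x in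
  (integral_rV (fun x => complex.Re (g x))
   +i* integral_rV (fun x => complex.Im (g x)))%C.

Definition test_function d (phi : 'rV[R]_d -> R[i]) : Prop :=
  smooth phi /\
  exists2 K : set 'rV[R]_d, compact K & forall x, ~ K x -> phi x = 0.

Definition conic d (Gamma : set 'rV[R]_d) : Prop :=
  forall (lambda : R) xi, 0 < lambda -> Gamma xi -> Gamma (lambda *: xi).

Definition micro_regular d (v : colombeau R d) (x0 xi0 : 'rV[R]_d) : Prop :=
  exists w : mnet R d, exists phi : 'rV[R]_d -> R[i],
  exists Gamma : set 'rV[R]_d, exists N : nat,
  [/\ gclass w = v, test_function phi /\ phi x0 = 1,
      conic Gamma /\ nbhs xi0 Gamma &
      forall l : R,
        bigO_on Gamma
          (fun e xi => japanese xi `^ l * normc (fourier (phi * w e) xi))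
          (fun e => e ^- N)].

(* T^*(R^d) \ 0 is the set of pairs (x, xi) with xi != 0. *)
Definition WF d (v : colombeau R d) : set ('rV[R]_d * 'rV[R]_d) :=
  [set p | p.2 != 0 /\ ~ micro_regular v p.1 p.2].

Definition chi_inv n (Lambda : 'I_n -> R -> R) (t : R)
    (p : 'rV[R]_n * 'rV[R]_n) : 'rV[R]_n * 'rV[R]_n :=
  (\row_j (p.1 ord0 j + Lambda j t), p.2).

End Properties.

(* Main.v *)
(* Along the characteristics x - Lambda_e(t) = y the Cauchy problem is an ordinary
   differential equation, and it is solved by
     u_e(t, x) = u_{0,e}(y) E_e(t, y),  E_e(t, y) = exp (i int_0^t a_{0,e}(s, y + Lambda_e(s)) ds);
   by uniqueness this net represents u. As a_0 is slow scale regular and of slow scale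
   logarithmic type, E_e(t, .) and its inverse are O(1/e) together with all their
   derivatives, and multiplication by such a net does not enlarge the wave front set: on
   a compact set it is a limit of trigonometric polynomials with rapidly decreasing
   coefficients, so that the Fourier transform of a product is a sum of translates of the
   transform of one factor. Translation by Lambda_e(t) -> Lambda(t) moves the wave front
   set by Lambda(t). Both steps are invertible. *)
Require Import Defs.
From mathcomp Require Import all_boot all_order all_algebra complex.
From mathcomp Require Import ring lra.
From mathcomp Require Import all_classical all_reals all_analysis.

Set Implicit Arguments.
Unset Strict Implicit.
Unset Printing Implicit Defensive.

Import Order.TTheory GRing.Theory Num.Theory.
Import numFieldNormedType.Exports.
Import Normc.
Local Open Scope classical_set_scope.
Local Open Scope ring_scope.

(** Microlocal regularity demands one exponent [N] for all powers of [xi], so a multiplier has to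
    lose the same power of [e] in all its derivatives. Slow scale nets are O(1/e) to every order,
    which is where the slow scale assumptions enter; the logarithmic type keeps the exponential of a
    primitive of a_0 within that class. The shifts [Lambda_e] converge only pointwise in t and need
    not be uniformly bounded on compact time intervals, so bounds on compact sets do not survive the
    change of coordinates. Bounds on strips |t| <= T do, since a shear keeps t, and they are
    available because representatives of a_0 and u_0 can be cut off in x. The trigonometric
    approximation comes from interpolation on a finite grid, with coefficient bounds independent of
    the mesh: the Fourier argument then involves only finite sums and integrals of continuous
    compactly supported functions, which reduce to primitives of one real variable. For the
    translation, the obstacle is that the cut-off in the definition of the wave front set must not
    depend on [e]. *)

Local Notation Re := complex.Re.
Local Notation Im := complex.Im.

(** * Primitives in one variable *)

Section Calculus.
Variable R : realType.
Local Notation mu := (@lebesgue_measure R).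

Lemma continuous_integrable (f : R -> R) a b : continuous f ->
  mu.-integrable `[a, b] (EFin \o f).
Proof.
move=> cf; apply: continuous_compact_integrable; first exact: segment_compact.
exact: continuous_subspaceT.
Qed.

Lemma Rintegral_itv_oc (f : R -> R) a b : continuous f ->
  \int[mu]_(z in `]a, b]) f z = \int[mu]_(z in `[a, b]) f z.
Proof.
move=> cf; apply: Rintegral_itv_obnd_cbnd.
by apply: integrableS (continuous_integrable a b cf) => //; exact: subset_itv_oc_cc.
Qed.

(** A base point [u] to the left of both 0 and [t] merges the two sign cases into one difference, to
    which the fundamental theorem of calculus with fixed left end applies. *)
Lemma integral_from0E (f : R -> R) u t : continuous f -> u < 0 -> u < t ->
  integral_from0 f t =
  \int[mu]_(z in `[u, t]) f z - \int[mu]_(z in `[u, 0]) f z.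
Proof.
move=> cf u0 ut; have fI a b := continuous_integrable a b cf.
rewrite /integral_from0; case: ifPn => [t0|]; last rewrite -ltNge => t0.
  by rewrite (@Rintegral_itvB _ f (BLeft u) (BRight t) 0) ?bnd_simp ?Rintegral_itv_oc ?(ltW u0).
rewrite -opprB; congr (- _).
by rewrite (@Rintegral_itvB _ f (BLeft u) (BRight 0) t) ?bnd_simp ?Rintegral_itv_oc ?(ltW ut) ?(ltW t0).
Qed.

Lemma is_derive_integral_from0 (f : R -> R) (t : R) : continuous f ->
  is_derive t 1 (integral_from0 f) (f t).
Proof.
move=> cf; pose u := Num.min t 0 - 1.
have u0 : u < 0 by rewrite /u ltrBlDr add0r gt_min ltr01 orbT.
have ut : u < t by rewrite /u ltrBlDr gt_min ltrDl ltr01.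
pose F x := \int[mu]_(z in `[u, x]) f z.
have t1 : t < t + 1 by rewrite ltrDl.
have [dF F'] := @continuous_FTC1_closed R f u t (t + 1) t1
  (continuous_integrable _ _ cf) ut (cf t).
have dF1 : is_derive t 1 F (f t) by apply: (DeriveDef dF); rewrite -derive1E.
have H : is_derive t 1 (F - cst (\int[mu]_(z in `[u, 0]) f z)) (f t).
  have := is_deriveB dF1 (is_derive_cst (\int[mu]_(z in `[u, 0]) f z) t 1).
  by rewrite subr0.
apply: near_eq_is_derive H; near=> s.
by rewrite (integral_from0E cf u0)//; near: s; exact: lt_nbhsr.
Unshelve. all: by end_near. Qed.

Lemma integral_from0_0 (f : R -> R) : integral_from0 f 0 = 0.
Proof. by rewrite /integral_from0 lexx set_itv1 Rintegral_set1. Qed.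

Lemma derive_le_lipschitz (F f : R -> R) (a b C : R) : a <= b ->
  (forall s : R, a <= s <= b -> is_derive s 1 F (f s)) ->
  (forall s : R, a <= s <= b -> `|f s| <= C) -> `|F b - F a| <= C * (b - a).
Proof.
move=> ab dF fC; have [||c cab ->] := @MVT_segment _ F f _ _ ab.
- by move=> x; rewrite in_itv/= => /andP[ax xb]; apply: dF; rewrite !ltW.
- apply: derivable_within_continuous => x; rewrite in_itv/= => xab.
  by case: (dF x xab).
- move: cab; rewrite in_itv/= => cab.
  by rewrite normrM (ger0_norm (_ : 0 <= b - a)) ?subr_ge0// ler_wpM2r ?subr_ge0// fC.
Qed.

(** Mean value inequality based at 0. The assumptions live on the symmetric interval, so that later
    uses need not distinguish the sign of [t]. *)
Lemma derive_le_norm (F f : R -> R) (t C : R) :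
  (forall s : R, `|s| <= `|t| -> is_derive s 1 F (f s)) ->
  (forall s : R, `|s| <= `|t| -> `|f s| <= C) -> `|F t - F 0| <= C * `|t|.
Proof.
move=> dF fC; have [t0|t0] := leP 0 t.
  have -> : C * `|t| = C * (t - 0) by rewrite subr0 ger0_norm.
  apply: derive_le_lipschitz t0 _ _ => s /andP[s0 st]; [apply: dF|apply: fC].
    by rewrite !ger0_norm ?(le_trans s0 st).
  by rewrite !ger0_norm ?(le_trans s0 st).
have -> : C * `|t| = C * (0 - t) by rewrite sub0r ltr0_norm.
rewrite distrC.
apply: derive_le_lipschitz (ltW t0) _ _ => s /andP[s0 st]; [apply: dF|apply: fC].
  by rewrite !ler0_norm ?lerN2// ?(le_trans s0 st)// ltW.
by rewrite !ler0_norm ?lerN2// ?(le_trans s0 st)// ltW.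
Qed.

Lemma integral_from0_le (f : R -> R) (C t : R) : continuous f ->
  (forall s : R, `|s| <= `|t| -> `|f s| <= C) -> `|integral_from0 f t| <= C * `|t|.
Proof.
move=> cf fC; rewrite -[integral_from0 f t]subr0 -(integral_from0_0 f).
by apply: derive_le_norm fC => s _; exact: is_derive_integral_from0.
Qed.

(** The difference of two primitives is Lipschitz with constant 0. Linearity of [integral_from0] is
    read off from this. *)
Lemma integral_from0_unique (f F : R -> R) (t : R) : continuous f ->
  (forall s : R, is_derive s 1 F (f s)) -> F 0 = 0 -> integral_from0 f t = F t.
Proof.
move=> cf dF F0; pose G := integral_from0 f - F.
have : `|G t - G 0| <= 0 * `|t|.
  apply: (@derive_le_norm G (fun s => f s - f s)) => s _; last by rewrite subrr normr0.
  by apply: is_deriveB; exact: is_derive_integral_from0.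
rewrite mul0r normr_le0 subr_eq0 => /eqP.
rewrite /G -![(_ - _ : _ -> _) _]/(_ - _) integral_from0_0 F0 subr0.
by move/eqP; rewrite subr_eq0 => /eqP.
Qed.

Lemma integral_from0B (f g : R -> R) (t : R) : continuous f -> continuous g ->
  integral_from0 (fun s => f s - g s) t = integral_from0 f t - integral_from0 g t.
Proof.
move=> cf cg; apply: (@integral_from0_unique _ (integral_from0 f - integral_from0 g)) => [s|s|].
- by apply: continuousB; [exact: cf|exact: cg].
- by apply: is_deriveB; exact: is_derive_integral_from0.
- by rewrite -[LHS]/(_ - _) !integral_from0_0 subr0.
Qed.

Lemma integral_from0D (f g : R -> R) (t : R) : continuous f -> continuous g ->
  integral_from0 (fun s => f s + g s) t = integral_from0 f t + integral_from0 g t.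
Proof.
move=> cf cg; apply: (@integral_from0_unique _ (integral_from0 f + integral_from0 g)) => [s|s|].
- by apply: continuousD; [exact: cf|exact: cg].
- by apply: is_deriveD; exact: is_derive_integral_from0.
- by rewrite -[LHS]/(_ + _) !integral_from0_0 addr0.
Qed.

Lemma integral_from0Z (f : R -> R) (c t : R) : continuous f ->
  integral_from0 (fun s => c * f s) t = c * integral_from0 f t.
Proof.
move=> cf; apply: (@integral_from0_unique _ (c *: integral_from0 f)) => [s|s|].
- by apply: continuousM; [exact: cst_continuous|exact: cf].
- by apply: is_deriveZ; exact: is_derive_integral_from0.
- by rewrite -[LHS]/(c * _) integral_from0_0 mulr0.
Qed.

Lemma RintegralT_compact (f : R -> R) (M : R) : continuous f -> 0 <= M ->
  (forall x : R, M < `|x| -> f x = 0) ->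
  \int[mu]_x f x = integral_from0 f M - integral_from0 f (- M).
Proof.
move=> cf M0 fM; have fI a b := continuous_integrable a b cf.
have -> : f = f \_ `[- M, M].
  apply/funext => x; rewrite patchE; case: ifPn => // /negP xM; apply: fM.
  by rewrite ltNge; apply/negP; rewrite ler_norml => xM'; apply: xM; rewrite inE.
rewrite -Rintegral_mkcond.
have -> : f \_ `[- M, M] = f.
  apply/funext => x; rewrite patchE; case: ifPn => // /negP xM; apply/esym/fM.
  by rewrite ltNge; apply/negP; rewrite ler_norml => xM'; apply: xM; rewrite inE.
pose u := - M - 1.
have uM : u < - M by rewrite /u ltrBlDr ltrDl.
have u0 : u < 0 by rewrite (lt_le_trans uM)// oppr_le0.
have MM : - M <= M by rewrite (le_trans _ M0)// oppr_le0.
rewrite !(integral_from0E cf u0)//; last exact: lt_le_trans uM MM.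
rewrite opprB addrA subrK.
by rewrite (@Rintegral_itvB _ f (BLeft u) (BRight M) (- M)) ?bnd_simp ?Rintegral_itv_oc// ltW.
Qed.

(** Primitives are constant off the support, so the primitive and the end points beyond [-M, M] are
    arbitrary; this freedom gives translation invariance below. *)
Lemma RintegralT_primitive (f F : R -> R) (M a b : R) : continuous f -> 0 <= M ->
  (forall x : R, M < `|x| -> f x = 0) -> (forall x : R, is_derive x 1 F (f x)) ->
  M <= b -> a <= - M -> \int[mu]_x f x = F b - F a.
Proof.
move=> cf M0 fM dF Mb aM.
have cF (g G : R -> R) (c e : R) : (forall x : R, is_derive x 1 G (g x)) -> c <= e ->
    (forall x : R, c < x < e -> g x = 0) -> G e = G c.
  move=> dG; rewrite le_eqVlt => /predU1P[->//|ce] g0; apply/eqP; rewrite -subr_eq0.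
  have [|y + ->] := @MVT _ G g _ _ ce.
  - by apply: derivable_within_continuous => x _; case: (dG x).
  - by rewrite in_itv/= => /g0 ->; rewrite mul0r.
rewrite (RintegralT_compact cf M0)//.
have MM : - M <= M by rewrite (le_trans _ M0)// oppr_le0.
(* [F] and the standard primitive differ by a function of zero derivative, hence have the same
   increment over [-M, M]. *)
have := cF (fun x => f x - f x) (F - integral_from0 f) (- M) M.
rewrite -![(_ - _ : _ -> _) _]/(_ - _) => H.
have -> : F b = F M.
  apply: (cF f) => // x /andP[Mx _]; apply: fM.
  by rewrite (lt_le_trans Mx)// ler_norm.
have -> : F a = F (- M).
  apply/esym/(cF f) => // x /andP[_ xM]; apply: fM.
  by rewrite -normrN (@lt_le_trans _ _ (- x)) ?ler_norm// ltrNr.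
have {H} : F M - integral_from0 f M = F (- M) - integral_from0 f (- M).
  apply: H => // [x|x _]; last by rewrite subrr.
  by apply: is_deriveB; exact: is_derive_integral_from0.
lra.
Qed.

(** A primitive of the translate is the translate of the primitive. The radius [N] = M + |c| is
    large enough for the supports of [f] and of its translate. *)
Lemma RintegralT_translation (f : R -> R) (M c : R) : continuous f -> 0 <= M ->
  (forall x : R, M < `|x| -> f x = 0) ->
  \int[mu]_x f (x - c) = \int[mu]_x f x.
Proof.
move=> cf M0 fM; pose N := M + `|c|.
have N0 : 0 <= N by rewrite addr_ge0.
have cN : - c <= `|c| by rewrite -normrN ler_norm.
have cN' : c <= `|c| by exact: ler_norm.
have -> : \int[mu]_x f x = integral_from0 f (N - c) - integral_from0 f (- N - c).
  apply: (RintegralT_primitive cf M0 fM); rewrite /N; try lra.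
  by move=> x; exact: is_derive_integral_from0.
apply: (@RintegralT_primitive _ (fun x => integral_from0 f (x - c)) N) => //.
- move=> x; apply: (@continuous_comp _ _ _ (fun x => x - c) f); last exact: cf.
  by apply: continuousB; [exact: id|exact: cst_continuous].
- move=> x Nx; apply: fM; rewrite /N -ltrBrDr in Nx.
  by apply: lt_le_trans Nx _; exact: lerB_dist.
- move=> x; have H := is_derive_integral_from0 (x - c) cf.
  have /= := @is_derive1_comp _ (integral_from0 f) (shift (- c)) x _ _ H (is_derive_shift x 1 (- c)).
  by rewrite mulr1.
Qed.

Lemma eq_ler (x y : R) : x = y -> x <= y.
Proof. by move=> ->. Qed.

End Calculus.

(** * Iterated integrals of compactly supported functions *)

Section IntegralRV.
Variable R : realType.
Local Notation mu := (@lebesgue_measure R).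

(** The norm of row vectors is the maximum norm; [0 <= C] takes care of d = 0. *)
Lemma rV_norm_leP d (x : 'rV[R]_d) (C : R) : 0 <= C ->
  reflect (forall j, `|x ord0 j| <= C) (`|x| <= C).
Proof.
move=> C0; apply: (iffP idP) => [xC j|xC].
  apply: le_trans xC; rewrite [leRHS]/Num.Def.normr/= mx_normrE.
  by apply: (@le_bigmax _ _ _ 0 (fun i => `|x i.1 i.2|) (ord0, j)).
rewrite [leLHS]/Num.Def.normr/= mx_normrE; apply: bigmax_le => // -[i j] _ /=.
by rewrite (ord1 i).
Qed.

Lemma coord_le_norm d (x : 'rV[R]_d) j : `|x ord0 j| <= `|x|.
Proof. exact: (rV_norm_leP x (normr_ge0 x) (lexx _)). Qed.

Lemma spacetime0 d t (x : 'rV[R]_d) : spacetime t x ord0 ord0 = t.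
Proof. by rewrite mxE unlift_none. Qed.

Lemma spacetime_lift d t (x : 'rV[R]_d) j : spacetime t x ord0 (lift ord0 j) = x ord0 j.
Proof. by rewrite mxE liftK. Qed.

Lemma time_le_norm d t (x : 'rV[R]_d) : `|t| <= `|spacetime t x|.
Proof. by rewrite -{1}(spacetime0 t x) coord_le_norm. Qed.

Lemma space_le_norm d t (x : 'rV[R]_d) : `|x| <= `|spacetime t x|.
Proof. by apply/rV_norm_leP => // j; rewrite -(spacetime_lift t) coord_le_norm. Qed.

Lemma spacetime_eq d (z : 'rV[R]_d.+1) :
  z = spacetime (z ord0 ord0) (\row_j z ord0 (lift ord0 j)).
Proof.
apply/rowP => i; case: (unliftP ord0 i) => [j ->|->].
  by rewrite spacetime_lift mxE.
by rewrite spacetime0.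
Qed.

Lemma spacetimeB d t (x : 'rV[R]_d) (c : 'rV[R]_d.+1) : spacetime t x - c =
  spacetime (t - c ord0 ord0) (x - \row_j c ord0 (lift ord0 j)).
Proof.
apply/rowP => i; case: (unliftP ord0 i) => [j ->|->].
  by rewrite !mxE !liftK /= !mxE.
by rewrite !mxE !unlift_none.
Qed.

Lemma spacetime_time_continuous d (x : 'rV[R]_d) : continuous (fun t => spacetime t x).
Proof.
apply: rV_continuous => i; case: (unliftP ord0 i) => [j ->|->].
  by under eq_fun do rewrite spacetime_lift; exact: cst_continuous.
by under eq_fun do rewrite spacetime0; exact: id.
Qed.

(* Tube lemma, in the form of uniform continuity in a parameter. *)
Lemma unif_continuous_param (T U : topologicalType) (f : T -> U -> R) (K : set U)
    (t : T) (e : R) : compact K ->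
  (forall x, K x -> {for (t, x), continuous (fun p : T * U => f p.1 p.2)}) ->
  0 < e -> \forall s \near t, forall x, K x -> `|f s x - f t x| < e.
Proof.
move=> /compact_near_coveringP cK cf e0.
apply: (cK T (nbhs t) (fun s x => `|f s x - f t x| < e)) => x Kx.
have e20 : 0 < e / 2 by rewrite divr_gt0.
have /= H := cf x Kx; move/cvgrPdist_lt: H => /(_ _ e20) /= [[A B]] /= [nA nB] AB.
exists (B, A) => /=; first by split.
move=> [x' s] /= [Bx As].
have h1 := AB (s, x') (conj As Bx); have h2 := AB (t, x') (conj (nbhs_singleton nA) Bx).
rewrite /= in h1 h2.
rewrite [e]splitr -[f s x'](subrK (f t x)) -addrA (le_lt_trans (ler_normD _ _))//.
by rewrite ltrD// distrC.
Qed.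

(** The radius is part of the predicate because the bounds on integrals involve the volume
    [(2 * M) ^+ d] of the enclosing cube. *)
Definition Cc d (M : R) (f : 'rV[R]_d -> R) : Prop :=
  continuous f /\ forall x, M < `|x| -> f x = 0.

Lemma CcD d M (f g : 'rV[R]_d -> R) : Cc M f -> Cc M g -> Cc M (fun x => f x + g x).
Proof.
move=> [cf f0] [cg g0]; split=> [x|x Mx]; last by rewrite f0// g0// addr0.
by apply: continuousD; [exact: cf|exact: cg].
Qed.

Lemma CcZ d M c (f : 'rV[R]_d -> R) : Cc M f -> Cc M (fun x => c * f x).
Proof.
move=> [cf f0]; split=> [x|x Mx]; last by rewrite f0// mulr0.
by apply: continuousM; [exact: cst_continuous|exact: cf].
Qed.

Lemma Cc_slice d M t (f : 'rV[R]_d.+1 -> R) : Cc M f ->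
  Cc M (fun x => f (spacetime t x)).
Proof.
move=> [cf f0]; split=> [x|x Mx].
  exact: (continuous_comp (@spacetime_continuous _ _ t x) (cf _)).
by apply: f0; apply: lt_le_trans Mx (space_le_norm _ _).
Qed.

Lemma compact_ball d (M : R) : compact [set x : 'rV[R]_d | `|x| <= M].
Proof.
apply: bounded_closed_compact.
  exists M; split=> [|y My]; first exact: num_real.
  by move=> x /= xM; exact: le_trans xM (ltW My).
apply: (@preimage_closed _ _ (fun x : 'rV[R]_d => `|x|) [set y | y <= M]).
  by move=> x _; exact: norm_continuous.
exact: closed_le.
Qed.

(** These are proved together by induction on the dimension: the bound and the linearity in
    dimension d make the inner integral continuous in t, and this continuity lets the outer integral
    be computed by a primitive. *)
Definition Cc_integral_props d (M : R) : Prop :=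
  [/\ forall (f : 'rV[R]_d -> R) (C : R), Cc M f -> (forall x, `|f x| <= C) ->
        `|integral_rV f| <= (2 * M) ^+ d * C,
      forall f g : 'rV[R]_d -> R, Cc M f -> Cc M g ->
        integral_rV (fun x => f x + g x) = integral_rV f + integral_rV g &
      forall c (f : 'rV[R]_d -> R), Cc M f ->
        integral_rV (fun x => c * f x) = c * integral_rV f].

Lemma Cc_slice_integral d (M : R) (f : 'rV[R]_d.+1 -> R) :
  0 <= M -> Cc_integral_props d M -> Cc M f ->
  let g (t : R) := integral_rV (fun x : 'rV[R]_d => f (spacetime t x)) in
  continuous g /\ forall t : R, M < `|t| -> g t = 0.
Proof.
move=> M0 [Hb HD HZ] fc g.
have HB (k h : 'rV[R]_d -> R) : Cc M k -> Cc M h ->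
    integral_rV (fun x => k x - h x) = integral_rV k - integral_rV h.
  move=> kc hc; have := HD k (fun x => -1 * h x) kc (CcZ (-1) hc).
  by rewrite HZ// mulN1r => <-; congr integral_rV; apply/funext => x; rewrite mulN1r.
split=> t; last first.
  move=> Mt; apply/eqP; rewrite -normr_le0 -[leRHS](mulr0 ((2 * M) ^+ d)).
  apply: Hb (Cc_slice t fc) _ => x; rewrite fc.2 ?normr0//.
  exact: lt_le_trans Mt (time_le_norm _ _).
apply/cvgrPdist_le => e e0.
(* The volume of the cube; the [+ 1] keeps it positive when M = 0. *)
pose D := (2 * M) ^+ d + 1.
have D0 : 0 < D by rewrite ltr_wpDl// exprn_ge0// mulr_ge0.
have eD0 : 0 < e / D by rewrite divr_gt0.
have : \forall s \near t, forall x, [set x : 'rV[R]_d | `|x| <= M] x ->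
    `|f (spacetime s x) - f (spacetime t x)| < e / D.
  apply: unif_continuous_param eD0; first exact: compact_ball.
  move=> x _; apply: (@continuous_comp _ _ _ (fun p : R * 'rV[R]_d => spacetime p.1 p.2) f).
    move: (t, x); apply: rV_continuous => i; case: (unliftP ord0 i) => [j ->|->].
      under eq_fun do rewrite spacetime_lift.
      move=> p; apply: (@continuous_comp _ _ _ snd (fun x : 'rV[R]_d => x ord0 j)).
        exact: cvg_snd.
      exact: coord_continuous.
    by under eq_fun do rewrite spacetime0; move=> p; exact: cvg_fst.
  exact: fc.1.
apply: filterS => s H.
rewrite -HB; [|exact: Cc_slice|exact: Cc_slice].
apply: (@le_trans _ _ ((2 * M) ^+ d * (e / D))).
  apply: Hb.
    have := CcD (Cc_slice t fc) (CcZ (-1) (Cc_slice s fc)).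
    by congr Cc; apply/funext => x; rewrite mulN1r.
  move=> x; have [xM|Mx] := leP `|x| M; first by rewrite distrC ltW// H.
  rewrite !fc.2 ?subrr ?normr0 ?(ltW eD0)//.
    exact: lt_le_trans Mx (space_le_norm _ _).
  exact: lt_le_trans Mx (space_le_norm _ _).
rewrite mulrCA ger_pMr// ler_pdivrMr// mul1r /D lerDl//.
Qed.

Lemma integral_rV_props d (M : R) : 0 <= M -> Cc_integral_props d M.
Proof.
move=> M0; elim: d => [|d IHd].
  by split=> //= f C _ fC; rewrite mul1r.
have [Hb HD HZ] := IHd.
pose g (f : 'rV[R]_d.+1 -> R) (t : R) := integral_rV (fun x : 'rV[R]_d => f (spacetime t x)).
have gc f : Cc M f -> continuous (g f) by move=> /(Cc_slice_integral M0 IHd)[].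
have gE f : Cc M f -> integral_rV f = integral_from0 (g f) M - integral_from0 (g f) (- M).
  by move=> fc; rewrite -(RintegralT_compact (gc f fc) M0) // => x Mx; by have [_] := Cc_slice_integral M0 IHd fc; apply.
split.
- move=> f C fc fC; rewrite gE//.
  have gb t : `|g f t| <= (2 * M) ^+ d * C by apply: Hb => //; exact: Cc_slice.
  rewrite (le_trans (ler_normB _ _))//.
  apply: (@le_trans _ _ ((2 * M) ^+ d * C * `|M| + (2 * M) ^+ d * C * `|- M|)).
    by apply: lerD; apply: integral_from0_le => //; exact: gc.
  by rewrite normrN ger0_norm// exprS; apply: eq_ler; ring.
- move=> f h fc hc; rewrite !gE//; last exact: CcD.
  have -> : g (fun x => f x + h x) = fun t => g f t + g h t.
    by apply/funext => t; rewrite /g HD//; exact: Cc_slice.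
  rewrite !integral_from0D; try exact: gc.
  ring.
- move=> c f fc; rewrite !gE//; last exact: CcZ.
  have -> : g (fun x => c * f x) = fun t => c * g f t.
    by apply/funext => t; rewrite /g HZ//; exact: Cc_slice.
  rewrite !integral_from0Z; try exact: gc.
  ring.
Qed.

Lemma le_integral_rV d (M C : R) (f : 'rV[R]_d -> R) : 0 <= M -> Cc M f ->
  (forall x, `|f x| <= C) -> `|integral_rV f| <= (2 * M) ^+ d * C.
Proof. by move=> M0; case: (integral_rV_props d M0) => + _ _; apply. Qed.

Lemma integral_rVD d (M : R) (f g : 'rV[R]_d -> R) : 0 <= M -> Cc M f -> Cc M g ->
  integral_rV (fun x => f x + g x) = integral_rV f + integral_rV g.
Proof. by move=> M0; case: (integral_rV_props d M0) => _ + _; apply. Qed.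

Lemma integral_rVZ d (M c : R) (f : 'rV[R]_d -> R) : 0 <= M -> Cc M f ->
  integral_rV (fun x => c * f x) = c * integral_rV f.
Proof. by move=> M0; case: (integral_rV_props d M0) => _ _; apply. Qed.

Lemma integral_rV_translation d (M : R) (f : 'rV[R]_d -> R) c : 0 <= M -> Cc M f ->
  integral_rV (fun x => f (x - c)) = integral_rV f.
Proof.
move=> M0; elim: d f c => [|d IHd] f c fc /=; first by congr f; apply/rowP => -[].
have [gc g0] := Cc_slice_integral M0 (integral_rV_props d M0) fc.
rewrite -[RHS](RintegralT_translation (c ord0 ord0) gc M0 g0).
congr Rintegral; apply/funext => t.
rewrite -(IHd _ (\row_j c ord0 (lift ord0 j)) (Cc_slice _ fc)).
by congr integral_rV; apply/funext => x; rewrite spacetimeB.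
Qed.

End IntegralRV.

(** * Integrals of complex valued functions and the Fourier kernel *)

Section ComplexIntegral.
Variable R : realType.

Lemma ReD (x y : R[i]) : Re (x + y) = Re x + Re y. Proof. by case: x y => [? ?] []. Qed.
Lemma ImD (x y : R[i]) : Im (x + y) = Im x + Im y. Proof. by case: x y => [? ?] []. Qed.
Lemma ReM (x y : R[i]) : Re (x * y) = Re x * Re y - Im x * Im y.
Proof. by case: x y => [? ?] []. Qed.
Lemma ImM (x y : R[i]) : Im (x * y) = Re x * Im y + Im x * Re y.
Proof. by case: x y => [? ?] []. Qed.

Lemma complexP (x y : R[i]) : Re x = Re y -> Im x = Im y -> x = y.
Proof. by case: x y => [? ?] [? ?] /= -> ->. Qed.

Lemma normc_ge_Re (x : R[i]) : `|Re x| <= normc x.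
Proof. by case: x => a b /=; rewrite -sqrtr_sqr ler_sqrt ?lerDl ?addr_ge0 ?sqr_ge0. Qed.

Lemma normc_ge_Im (x : R[i]) : `|Im x| <= normc x.
Proof. by case: x => a b /=; rewrite -sqrtr_sqr ler_sqrt ?lerDr ?addr_ge0 ?sqr_ge0. Qed.

Lemma normc_le (x : R[i]) : normc x <= `|Re x| + `|Im x|.
Proof.
case: x => a b /=; rewrite -[leRHS]ger0_norm ?addr_ge0// -sqrtr_sqr ler_sqrt ?sqr_ge0//.
by rewrite sqrrD !real_normK ?num_real// addrAC lerDl mulrn_wge0// mulr_ge0.
Qed.

Definition Ccc d (M : R) (f : 'rV[R]_d -> R[i]) : Prop :=
  [/\ continuous (fun x => Re (f x)), continuous (fun x => Im (f x)) &
      forall x, M < `|x| -> f x = 0].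

Lemma CccRe d M (f : 'rV[R]_d -> R[i]) : Ccc M f -> Cc M (fun x => Re (f x)).
Proof. by move=> [c1 c2 f0]; split=> // x /f0 ->. Qed.

Lemma CccIm d M (f : 'rV[R]_d -> R[i]) : Ccc M f -> Cc M (fun x => Im (f x)).
Proof. by move=> [c1 c2 f0]; split=> // x /f0 ->. Qed.

Lemma CccD d M (f g : 'rV[R]_d -> R[i]) : Ccc M f -> Ccc M g ->
  Ccc M (fun x => f x + g x).
Proof.
move=> [f1 f2 f0] [g1 g2 g0]; split; last by move=> x Mx; rewrite f0// g0// addr0.
  rewrite -[X in continuous X]/(fun x => Re ((f + g) x)) RefunD => x.
  by apply: continuousD; [exact: f1|exact: g1].
rewrite -[X in continuous X]/(fun x => Im ((f + g) x)) ImfunD => x.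
by apply: continuousD; [exact: f2|exact: g2].
Qed.

Lemma CccM d M (h f : 'rV[R]_d -> R[i]) : continuous (fun x => Re (h x)) ->
  continuous (fun x => Im (h x)) -> Ccc M f -> Ccc M (fun x => h x * f x).
Proof.
move=> h1 h2 [f1 f2 f0]; split; last by move=> x Mx; rewrite f0// mulr0.
  rewrite -[X in continuous X]/(fun x => Re ((h * f) x)) RefunM => x.
  by apply: continuousB; apply: continuousM; [exact: h1|exact: f1|exact: h2|exact: f2].
rewrite -[X in continuous X]/(fun x => Im ((h * f) x)) ImfunM => x.
by apply: continuousD; apply: continuousM; [exact: h1|exact: f2|exact: h2|exact: f1].
Qed.

Lemma CccZ d M c (f : 'rV[R]_d -> R[i]) : Ccc M f -> Ccc M (fun x => c * f x).
Proof. by apply: CccM => x; exact: cst_continuous. Qed.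

Definition cint d (f : 'rV[R]_d -> R[i]) : R[i] :=
  (integral_rV (fun x => Re (f x)) +i* integral_rV (fun x => Im (f x)))%C.

Lemma cintD d (M : R) (f g : 'rV[R]_d -> R[i]) : 0 <= M -> Ccc M f -> Ccc M g ->
  cint (fun x => f x + g x) = cint f + cint g.
Proof.
move=> M0 fc gc; apply: complexP; rewrite ?ReD ?ImD /=.
  rewrite -(integral_rVD M0 (CccRe fc) (CccRe gc)).
  by congr integral_rV; apply/funext => x; rewrite ReD.
rewrite -(integral_rVD M0 (CccIm fc) (CccIm gc)).
by congr integral_rV; apply/funext => x; rewrite ImD.
Qed.

Lemma cintZ d (M : R) c (f : 'rV[R]_d -> R[i]) : 0 <= M -> Ccc M f ->
  cint (fun x => c * f x) = c * cint f.
Proof.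
move=> M0 fc; have [fr fi] := (CccRe fc, CccIm fc).
apply: complexP; rewrite ?ReM ?ImM /=.
  rewrite -!(integral_rVZ _ M0)// -mulN1r -(integral_rVZ _ M0)//; last exact: CcZ.
  rewrite -(integral_rVD M0)//; [|exact: CcZ|by do 2 apply: CcZ].
  by congr integral_rV; apply/funext => x; rewrite ReM mulN1r.
rewrite -!(integral_rVZ _ M0)//.
rewrite -(integral_rVD M0)//; [|exact: CcZ|exact: CcZ].
by congr integral_rV; apply/funext => x; rewrite ImM.
Qed.

Lemma cint0 d : cint (fun _ : 'rV[R]_d => 0 : R[i]) = 0.
Proof.
have c0 : Ccc 0 (fun _ : 'rV[R]_d => 0 : R[i]) by split=> // x; exact: cst_continuous.
by have := cintZ 0 (lexx 0) c0; rewrite !mul0r.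
Qed.

Lemma cint_sum d (M : R) (I : Type) (r : seq I) (f : I -> 'rV[R]_d -> R[i]) :
  0 <= M -> (forall i, Ccc M (f i)) ->
  Ccc M (fun x => \sum_(i <- r) f i x) /\
  cint (fun x => \sum_(i <- r) f i x) = \sum_(i <- r) cint (f i).
Proof.
move=> M0 fc; elim: r => [|i r [IH1 IH2]].
  rewrite big_nil; under eq_fun do rewrite big_nil; split; last exact: cint0.
  by split=> // x; exact: cst_continuous.
rewrite big_cons -IH2 -(cintD M0)//; under eq_fun do rewrite big_cons.
by split=> //; exact: CccD.
Qed.

(** Real and imaginary parts are estimated separately, which costs the factor 2. *)
Lemma normc_cint d (M C : R) (f : 'rV[R]_d -> R[i]) : 0 <= M -> Ccc M f ->
  (forall x, normc (f x) <= C) -> normc (cint f) <= 2 * ((2 * M) ^+ d * C).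
Proof.
move=> M0 fc fC; rewrite (le_trans (normc_le _))// mulr2n mulrDl mul1r lerD//=.
  apply: le_integral_rV (CccRe fc) _ => // x; exact: le_trans (normc_ge_Re _) _.
apply: le_integral_rV (CccIm fc) _ => // x; exact: le_trans (normc_ge_Im _) _.
Qed.

Lemma cint_translation d (M : R) (f : 'rV[R]_d -> R[i]) c : 0 <= M -> Ccc M f ->
  cint (fun x => f (x - c)) = cint f.
Proof.
move=> M0 fc; rewrite /cint.
rewrite (@integral_rV_translation _ _ _ (fun x => Re (f x)) c M0 (CccRe fc)).
by rewrite (@integral_rV_translation _ _ _ (fun x => Im (f x)) c M0 (CccIm fc)).
Qed.

Definition cis (theta : R) : R[i] := (cos theta +i* sin theta)%C.

Lemma cisD a b : cis (a + b) = cis a * cis b.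
Proof. by apply: complexP; rewrite ?ReM ?ImM /= ?cosD ?sinD// addrC. Qed.

Lemma cis0 : cis 0 = 1.
Proof. by rewrite /cis cos0 sin0. Qed.

Lemma cisN a : cis (- a) = (cos a -i* sin a)%C.
Proof. by rewrite /cis cosN sinN. Qed.

Lemma normc_cis a : normc (cis a) = 1.
Proof. by rewrite /cis /= cos2Dsin2 sqrtr1. Qed.

Lemma dotB d (x y z : 'rV[R]_d) : dot (x - y) z = dot x z - dot y z.
Proof. by rewrite /dot -sumrB; apply: eq_bigr => j _; rewrite !mxE mulrBl. Qed.

Lemma dotBr d (x y z : 'rV[R]_d) : dot z (x - y) = dot z x - dot z y.
Proof. by rewrite /dot -sumrB; apply: eq_bigr => j _; rewrite !mxE mulrBr. Qed.

Lemma dotN d (x y : 'rV[R]_d) : dot x (- y) = - dot x y.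
Proof. by rewrite /dot -sumrN; apply: eq_bigr => j _; rewrite !mxE mulrN. Qed.

Lemma dot_continuous d (y : 'rV[R]_d) : continuous (fun x => dot x y).
Proof.
apply: continuous_big => [|j _].
  exact: add_continuous.
by move=> x; apply: continuousM; [exact: coord_continuous|exact: cst_continuous].
Qed.

Lemma cis_dot_continuous d (y : 'rV[R]_d) :
  continuous (fun x => Re (cis (dot x y))) /\ continuous (fun x => Im (cis (dot x y))).
Proof.
split=> x; apply: (@continuous_comp _ _ _ (fun x => dot x y)).
- exact: dot_continuous.
- exact: continuous_cos.
- exact: dot_continuous.
- exact: continuous_sin.
Qed.

Lemma cisN_dot_continuous d (y : 'rV[R]_d) :
  continuous (fun x => Re (cis (- dot x y))) /\ continuous (fun x => Im (cis (- dot x y))).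
Proof.
by have := cis_dot_continuous (- y); under eq_fun do rewrite dotN;
  under [X in _ /\ continuous X]eq_fun do rewrite dotN.
Qed.

Lemma fourierE d (f : 'rV[R]_d -> R[i]) xi :
  fourier f xi = cint (fun x => cis (- dot x xi) * f x).
Proof. have E : (fun x => cis (- dot x xi) * f x) =
  (fun x => (cos (dot x xi) -i* sin (dot x xi))%C * f x).
  by apply/funext => x; rewrite cisN.
by rewrite E. Qed.

End ComplexIntegral.

(** * Translations and finite differences *)

Section SmoothCalculus.
Variable R : realType.

Lemma is_derive_line d (g : 'rV[R]_d -> R) (v x : 'rV[R]_d) (t : R) :
  derivable g (t *: v + x) v ->
  is_derive t 1 (fun t => g (t *: v + x)) ('D_v g (t *: v + x)).
Proof.
have E : (fun h : R => h^-1 *: (((fun t => g (t *: v + x)) \o shift t) (h *: (1 : R))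
    - g (t *: v + x))) =
    (fun h : R => h^-1 *: ((g \o shift (t *: v + x)) (h *: v) - g (t *: v + x))).
  apply/funext => h /=; congr (_ *: (g _ - _)).
  by rewrite addrA -scalerDl [h *: 1]mulr1.
move=> dg; split; first by rewrite /derivable E.
by rewrite /derive E.
Qed.

Lemma C1_at_translation d (f : 'rV[R]_d -> R[i]) c x :
  C1_at f (x + c) -> C1_at (fun y => f (y + c)) x.
Proof.
have tc : {for x, continuous (fun y : 'rV[R]_d => y + c)}.
  by apply: continuousD; [exact: id|exact: cst_continuous].
move=> [f1 f2 f3 f4]; split.
- exact: (continuous_comp tc f1).
- exact: (continuous_comp tc f2).
- move=> j; move: (f3 j); rewrite /derivable.
  by under eq_fun do rewrite /= addrA.
- move=> j; move: (f4 j); rewrite /derivable.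
  by under eq_fun do rewrite /= addrA.
Qed.

Lemma derive_translation d (g : 'rV[R]_d -> R) v c x :
  'D_v (fun y => g (y + c)) x = 'D_v g (x + c).
Proof. by rewrite /derive; under eq_fun do rewrite /= -addrA. Qed.

Lemma cpartial_translation d j (f : 'rV[R]_d -> R[i]) c :
  cpartial j (fun y => f (y + c)) = fun y => cpartial j f (y + c).
Proof.
apply/funext => x; rewrite /cpartial.
by rewrite (derive_translation (fun y => Re (f y))) (derive_translation (fun y => Im (f y))).
Qed.

Lemma cpartials_translation d s (f : 'rV[R]_d -> R[i]) c :
  cpartials s (fun y => f (y + c)) = fun y => cpartials s f (y + c).
Proof. by elim: s => [//|j s IHs] /=; rewrite IHs cpartial_translation. Qed.

Lemma smooth_translation d (f : 'rV[R]_d -> R[i]) c :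
  smooth f -> smooth (fun y => f (y + c)).
Proof.
by move=> fs s x; rewrite cpartials_translation; apply: C1_at_translation; exact: fs.
Qed.

Lemma smoothN d (f : 'rV[R]_d -> R[i]) : smooth f -> smooth (fun x => - f x).
Proof.
move=> fs; have -> : (fun x => - f x) = (cst (-1) : 'rV[R]_d -> R[i]) * f.
  by apply/funext => x; rewrite -[RHS]/(-1 * f x) mulN1r.
by apply: smoothM fs; exact: smooth_cst.
Qed.

Lemma derivable_le_line d (g : 'rV[R]_d -> R) (v x : 'rV[R]_d) (t C : R) :
  (forall y, derivable g y v) -> (forall s : R, `|s| <= `|t| -> `|'D_v g (s *: v + x)| <= C) ->
  `|g (t *: v + x) - g x| <= C * `|t|.
Proof.
move=> dg gC; rewrite -{2}[x]add0r -(scale0r v).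
apply: (@derive_le_norm _ (fun s : R => g (s *: v + x)) (fun s => 'D_v g (s *: v + x))) => //.
by move=> s _; exact: is_derive_line.
Qed.

Lemma cpartial_le_line d (f : 'rV[R]_d -> R[i]) (x : 'rV[R]_d) j (t C : R) :
  (forall y, C1_at f y) ->
  (forall s : R, `|s| <= `|t| -> normc (cpartial j f (s *: basis_vec R j + x)) <= C) ->
  normc (f (t *: basis_vec R j + x) - f x) <= 2 * C * `|t|.
Proof.
move=> fC1 fC; rewrite (le_trans (normc_le _))//.
have -> : 2 * C * `|t| = C * `|t| + C * `|t| by ring.
have -> (a b : R[i]) : Re (a - b) = Re a - Re b by case: a b => ? ? [].
have -> (a b : R[i]) : Im (a - b) = Im a - Im b by case: a b => ? ? [].
apply: lerD.
- apply: (@derivable_le_line _ (fun y => Re (f y))) => [y|s st].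
    by case: (fC1 y).
  exact: le_trans (normc_ge_Re _) (fC s st).
- apply: (@derivable_le_line _ (fun y => Im (f y))) => [y|s st].
    by case: (fC1 y).
  exact: le_trans (normc_ge_Im _) (fC s st).
Qed.

Definition fdiff d (c : 'rV[R]_d) (f : 'rV[R]_d -> R[i]) : 'rV[R]_d -> R[i] :=
  fun x => f (x + c) - f x.

Lemma smooth_fdiff d c (f : 'rV[R]_d -> R[i]) : smooth f -> smooth (fdiff c f).
Proof.
move=> fs; have := smoothD (smooth_translation c fs) (smoothN fs).
by congr smooth; apply/funext.
Qed.

Lemma cpartials_fdiff d s c (f : 'rV[R]_d -> R[i]) : smooth f ->
  cpartials s (fdiff c f) = fdiff c (cpartials s f).
Proof.
move=> fs; have -> : fdiff c f = (fun x => f (x + c)) + cst (-1) * f.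
  by apply/funext => x; rewrite -[RHS]/(f (x + c) + -1 * f x) mulN1r.
have cN (g : 'rV[R]_d -> R[i]) : smooth g -> cpartials s (cst (-1) * g) = - cpartials s g.
  elim/last_ind: s g => [|s j IHs] g gs.
    by apply/funext => x; rewrite -[LHS]/(-1 * g x) mulN1r.
  rewrite cpartialsM_rcons; [|exact: smooth_cst|exact: gs].
  rewrite cpartial_cst IHs; last exact: smooth_partial.
  have -> : (cst 0 : 'rV[R]_d -> R[i]) * g = cst 0.
    by apply/funext => x; rewrite -[LHS]/(0 * g x) mul0r.
  by rewrite cpartials_cst if_same cpartials_rcons add0r.
rewrite cpartialsD; first rewrite (cN _ fs).
- by rewrite cpartials_translation; apply/funext.
- exact: smooth_translation.
- by apply: smoothM fs; exact: smooth_cst.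
Qed.

(** Each difference gains [h] by the mean value inequality and loses 2 through the separate
    treatment of real and imaginary parts. *)
Lemma normc_iter_fdiff d (f : 'rV[R]_d -> R[i]) j (h B : R) q : 0 <= h -> smooth f ->
  (forall x, normc (cpartials (nseq q j) f x) <= B) ->
  forall x, normc (iter q (fdiff (h *: basis_vec R j)) f x) <= (2 * h) ^+ q * B.
Proof.
move=> h0; elim: q f B => [|q IHq] f B fs fB x; first by rewrite expr0 mul1r; exact: fB.
rewrite iterSr exprS -mulrA mulrCA; apply: IHq; first exact: smooth_fdiff.
move=> y; rewrite cpartials_fdiff// /fdiff [y + _]addrC.
rewrite -mulrA [h * B]mulrC mulrA -{2}(ger0_norm h0).
by apply: cpartial_le_line => [z|s _]; [exact: fs|exact: fB].
Qed.

(** Each difference widens the support by [h] in direction [j]. *)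
Lemma iter_fdiff0 d (f : 'rV[R]_d -> R[i]) j (h M : R) q : 0 <= h ->
  (forall x : 'rV[R]_d, M < `|x ord0 j| -> f x = 0) ->
  forall x : 'rV[R]_d, M + q%:R * h < `|x ord0 j| ->
  iter q (fdiff (h *: basis_vec R j)) f x = 0.
Proof.
move=> h0; elim: q => [|q IHq] f0 x.
  by rewrite mul0r addr0; exact: f0.
rewrite -natr1 mulrDl mul1r addrA => Mx /=; rewrite /fdiff !IHq ?subrr//.
  by apply: le_lt_trans Mx; rewrite lerDl.
rewrite !mxE !eqxx mulr1.
have := ler_normB (x ord0 j + h) h; rewrite addrK (ger0_norm h0).
move: Mx; lra.
Qed.

(** Turns directional derivatives into one-variable derivatives at 0, so that the chain rule on the
    line can be used. *)
Lemma is_derive_lineP d (g : 'rV[R]_d -> R) (v x : 'rV[R]_d) (dg : R) :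
  is_derive x v g dg <-> is_derive (0 : R) 1 (fun h : R => g (h *: v + x)) dg.
Proof.
have E : (fun h : R => h^-1 *: (((fun h : R => g (h *: v + x)) \o shift 0) (h *: (1 : R))
    - g (0 *: v + x))) = (fun h : R => h^-1 *: ((g \o shift x) (h *: v) - g x)).
  by apply/funext => h /=; rewrite scale0r add0r addr0 [h *: (1 : R)]mulr1.
split=> -[H1 H2]; split.
- by rewrite /derivable E.
- by rewrite /derive E.
- by move: H1; rewrite /derivable E.
- by move: H2; rewrite /derive E.
Qed.

Lemma is_derive_comp_line d (phi : R -> R) (g : 'rV[R]_d -> R) (v x : 'rV[R]_d) (dphi dg : R) :
  is_derive (g x) 1 phi dphi -> is_derive x v g dg ->
  is_derive x v (fun y => phi (g y)) (dphi * dg).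
Proof.
move=> dp /is_derive_lineP H; apply/is_derive_lineP.
by apply: (@is_derive1_comp _ phi (fun h : R => g (h *: v + x))) => //; rewrite scale0r add0r.
Qed.

End SmoothCalculus.

(** * Trigonometric interpolation on a grid *)

Section Trigonometry.
Variable R : realType.

Lemma normc_cisB1 (a : R) : normc (cis a - 1) = 2 * `|sin (a / 2)|.
Proof.
have -> : cis a - 1 = ((cos a - 1) +i* sin a)%C by apply: complexP; rewrite /= ?subr0.
rewrite /=; have Ec := cos_mulr2n (a / 2); have Es := sin_mulr2n (a / 2).
have a2 : a / 2 *+ 2 = a by rewrite -mulr_natr divfK// pnatr_eq0.
rewrite a2 in Ec Es; rewrite Ec Es.
have -> : (cos (a / 2) ^+ 2 *+ 2 - 1 - 1) ^+ 2 + (cos (a / 2) * sin (a / 2) *+ 2) ^+ 2 =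
  (2 * sin (a / 2)) ^+ 2.
  have C := sin2cos2 (a / 2).
  rewrite !expr2 in C *; move: (sin (a / 2)) (cos (a / 2)) C => s c C.
  have -> : (c * c *+ 2 - 1 - 1) * (c * c *+ 2 - 1 - 1) = 4 * (1 - c * c) * (1 - c * c) by ring.
  have E : c * c = 1 - s * s by rewrite C; ring.
  have -> : c * s *+ 2 * (c * s *+ 2) = 4 * (c * c) * (s * s) by ring.
  by rewrite -C E; ring.
by rewrite sqrtr_sqr normrM ger0_norm.
Qed.

(** On [0, 1] the mean value theorem with cos >= cos 1 gives even the slope cos 1. On [1, pi / 2]
    the sine is at least sin 1 >= cos 1, while y < 2 halves the slope. *)
Lemma sin_ge_linear (y : R) : 0 <= y <= pi / 2 -> cos 1 / 2 * y <= sin y.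
Proof.
move=> /andP[y0 ypi]; have c10 := @cos1_gt0 R; have pi1 := pihalf_ge1 R.
have lin (z : R) : 0 <= z <= 1 -> cos 1 * z <= sin z.
  move=> /andP[z0 z1].
  have [|c] := @MVT_segment R sin cos 0 z z0.
    exact/continuous_subspaceT/continuous_sin.
  rewrite sin0 !subr0 in_itv/= => /andP[c0 cz] ->; rewrite ler_wpM2r//.
  have pi1' : 1 <= pi :> R by have := @pi_ge2 R; lra.
  rewrite leNgt; apply/negP => cc.
  have := @ltr_cos R 1 c; rewrite !in_itv/= cc ler01 pi1' c0 (le_trans cz (le_trans z1 _))//.
  by move=> /(_ isT isT)/esym/idP; rewrite ltNge (le_trans cz z1).
have [y1|y1] := leP y 1.
  rewrite (le_trans _ (lin y _)) ?y0//; rewrite ler_wpM2r//.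
  by move: c10; lra.
apply: (@le_trans _ _ (sin 1)).
  have := lin 1; rewrite ler01 lexx mulr1 => /(_ isT).
  have := pihalf_lt2 R; have : cos 1 * y <= cos 1 * 2 :> R.
    by rewrite ler_wpM2l ?ltW//; have := pihalf_lt2 R; move: ypi; lra.
  lra.
rewrite leNgt; apply/negP => ss.
have := @ltr_sin R y 1; rewrite !in_itv/= ss ypi pi1.
rewrite !(le_trans _ y0) ?(le_trans _ ler01) ?oppr_le0 ?divr_ge0 ?pi_ge0//.
by move=> /(_ isT isT)/esym/idP; rewrite ltNge ltW.
Qed.

(** [cis a - 1] is the symbol of a forward difference; this lower bound is what one divides by in
    the summation by parts. *)
Lemma normc_cisB1_ge (a : R) : `|a| <= pi -> cos 1 / 2 * `|a| <= normc (cis a - 1).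
Proof.
move=> api; rewrite normc_cisB1.
wlog a0 : a api / 0 <= a.
  move=> H; have [/H//|a0] := leP 0 a; first exact.
  have := H (- a); rewrite normrN mulNr sinN normrN; apply=> //.
  by rewrite oppr_ge0 ltW.
rewrite ger0_norm// in api *.
have H : 0 <= a / 2 <= pi / 2 by rewrite divr_ge0//= ler_pM2r.
rewrite (_ : cos 1 / 2 * a = 2 * (cos 1 / 2 * (a / 2))); last by field.
by rewrite ler_pM2l// (le_trans (sin_ge_linear H))// ler_norm.
Qed.

Lemma cis_neq1 (a : R) : 0 < `|a| < 2 * pi -> cis a != 1.
Proof.
move=> /andP[a0 api]; apply/eqP => H; have := normc_cisB1 a.
rewrite H subrr normc0 => /esym/eqP; rewrite mulf_eq0 pnatr_eq0 /= normr_eq0.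
apply/negP; move: a0 api {H}; wlog : a / 0 < a.
  move=> H a0 api; have [/H/(_ a0 api)//|a1|a1] := ltgtP 0 a; last by rewrite -a1 normr0 ltxx in a0.
  have := H (- a); rewrite normrN mulNr sinN oppr_eq0; apply=> //.
  by rewrite oppr_gt0.
move=> a0 _; rewrite gtr0_norm// => api; rewrite gt_eqF// sin_gt0_pi// divr_gt0//=.
by rewrite ltr_pdivrMr// mulrC.
Qed.

Lemma cis2pi : cis (2 * pi) = 1 :> R[i].
Proof.
by rewrite mulr_natl /cis cos2pi sin2pi.
Qed.

Lemma cis_natmul (a : R) n : cis (n%:R * a) = cis a ^+ n.
Proof.
elim: n => [|n IHn]; first by rewrite mul0r cis0 expr0.
by rewrite -natr1 mulrDl mul1r cisD IHn exprSr.
Qed.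

Lemma cis_sum (I : finType) (F : I -> R) : cis (\sum_i F i) = \prod_i cis (F i).
Proof. by rewrite (big_morph _ (@cisD R) (@cis0 R)). Qed.

Lemma cis_int (a b : nat) : cis (2 * pi * (a%:R - b%:R)) = 1 :> R[i].
Proof.
have c1 n : cis (2 * pi * n%:R) = 1 :> R[i] by rewrite mulrC cis_natmul cis2pi expr1n.
have := @cisD R (2 * pi * (a%:R - b%:R)) (2 * pi * b%:R).
by rewrite -mulrDr subrK !c1 mulr1 => <-.
Qed.

Lemma normc_cis_lipschitz (a b : R) : normc (cis a - cis b) <= `|a - b|.
Proof.
have -> : cis a - cis b = cis b * (cis (a - b) - 1).
  by rewrite mulrBr mulr1 -cisD [b + _]addrC subrK.
rewrite normcM normc_cis mul1r normc_cisB1.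
have H (y : R) : `|sin y| <= `|y|.
  rewrite -[sin y]subr0 -sin0 -[leRHS]mul1r.
  by apply: (@derive_le_norm R sin cos) => s _; exact: cos_max.
have := H ((a - b) / 2); rewrite normrM (gtr0_norm (_ : 0 < 2^-1)) ?invr_gt0// .
by move: `|sin _| `|a - b| => u v; lra.
Qed.

Lemma normc_sum (I : Type) (r : seq I) (P : pred I) (F : I -> R[i]) :
  normc (\sum_(i <- r | P i) F i) <= \sum_(i <- r | P i) normc (F i).
Proof.
elim/big_ind2: _ => //; first by rewrite normc0.
by move=> x1 x2 y1 y2 H1 H2; rewrite (le_trans (le_normcD _ _))// lerD.
Qed.

Lemma normc_nat n : normc (n%:R : R[i]) = n%:R.
Proof.
have -> : n%:R = (n%:R +i* 0)%C :> R[i].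
  elim: n => [//|n IHn]; rewrite -natr1 IHn -natr1.
  by apply: complexP; rewrite ?ReD ?ImD /= ?addr0.
by rewrite /= expr0n /= addr0 sqrtr_sqr ger0_norm.
Qed.

Lemma normcX (x : R[i]) n : normc (x ^+ n) = normc x ^+ n.
Proof. by elim: n => [|n IHn]; rewrite ?expr0 ?normc1// !exprS normcM IHn. Qed.

Lemma normcV (x : R[i]) : x != 0 -> normc x^-1 = (normc x)^-1.
Proof.
move=> x0; have nx : normc x != 0 by apply: contra x0 => /eqP/eq0_normc ->.
by apply: (mulfI nx); rewrite -normcM divff// divff// normc1.
Qed.

End Trigonometry.

(** * Summability over the grid of frequencies *)

Section GridFrequencies.
Variables (R : realType) (d h : nat).
Local Notation m := (h.*2.+1).
Local Notation K := {ffun 'I_d -> 'I_m}.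

(** The odd number of indices makes the grid symmetric, with integer coordinates from -h to h. The
    same vectors serve as frequencies and, after scaling, as sample points. *)
Definition grid_freq (k : K) : 'rV[R]_d := \row_j ((k j)%:R - h%:R).

Lemma sum_inv_sqr_le n : \sum_(i < n) (1 + i%:R) ^- 2 <= 2 :> R.
Proof.
(* The bound is strengthened to a telescoping one that can be proved by induction. *)
suff H : \sum_(i < n) (1 + i%:R) ^- 2 <= 2 - 2 / (n%:R + 1) :> R.
  by apply: le_trans H _; rewrite gerBl divr_ge0 ?addr_ge0.
elim: n => [|n IHn]; first by rewrite big_ord0 add0r divr1 subrr.
rewrite big_ord_recr /=; apply: le_trans (lerD IHn (lexx _)) _.
rewrite -[n.+1%:R]natr1 [1 + n%:R]addrC; have : 0 <= n%:R :> R by [].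
move: (n%:R) => x x0; rewrite -subr_ge0.
have -> : 2 - 2 / (x + 1 + 1) - (2 - 2 / (x + 1) + (x + 1) ^- 2) =
   x / ((x + 1 + 1) * (x + 1) ^+ 2).
  by field; apply/andP; split; apply/eqP; lra.
by rewrite divr_ge0// mulr_ge0 ?sqr_ge0//; lra.
Qed.

Lemma sum_grid_freq_le : \sum_(i < m) (1 + `|i%:R - h%:R|) ^- 2 <= 4 :> R.
Proof.
have mono (x y : R) : 0 <= x -> x <= y -> (1 + y) ^- 2 <= (1 + x) ^- 2.
  move=> x0 xy; rewrite lef_pV2 ?posrE ?exprn_gt0 ?lerXn2r ?nnegrE; lra.
rewrite -(big_mkord xpredT (fun i => (1 + `|i%:R - h%:R : R|) ^- 2)).
rewrite (@big_cat_nat _ _ _ h)//=; last by rewrite -addnn leqW// leq_addr.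
rewrite (_ : 4 = 2 + 2); last by ring.
apply: lerD.
  rewrite big_nat_rev /= add0n big_mkord; apply: le_trans (sum_inv_sqr_le h).
  apply: ler_sum => i _; apply: mono => //.
  rewrite natrB// distrC opprB addrC subrK ger0_norm// ler_nat//.
rewrite -{1}[h]add0n big_addn big_mkord; apply: le_trans (sum_inv_sqr_le (m - h)).
by apply: ler_sum => i _; rewrite natrD addrK ger0_norm.
Qed.

(** In the maximum norm (1 + |k|)^(2d) dominates the product of the (1 + |k_j|)^2, and the sum of
    the product factors over the coordinates. What matters is that the bound does not depend on
    [h]. *)
Lemma sum_grid_le : \sum_(k : K) (1 + `|grid_freq k|) ^- (2 * d) <= 4 ^+ d.
Proof.
have -> : 4 ^+ d = \prod_(j < d) (4 : R) by rewrite prodr_const card_ord.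
apply: (@le_trans _ _ (\prod_(j < d) \sum_(i < m) (1 + `|i%:R - h%:R|) ^- 2)); last first.
  apply: ler_prod => j _; rewrite sum_grid_freq_le andbT.
  by apply: sumr_ge0 => i _; rewrite invr_ge0 exprn_ge0// addr_ge0.
rewrite bigA_distr_bigA; apply: ler_sum => k _.
have -> : (1 + `|grid_freq k|) ^- (2 * d) = \prod_(j < d) (1 + `|grid_freq k|) ^- 2.
  by rewrite prodr_const card_ord exprM -exprVn.
apply: ler_prod => j _.
rewrite invr_ge0 exprn_ge0 ?addr_ge0//=.
rewrite lef_pV2 ?posrE ?exprn_gt0 ?ltr_pwDl// lerXn2r ?nnegrE ?addr_ge0// lerD2l.
by have := coord_le_norm (grid_freq k) j; rewrite mxE.
Qed.

End GridFrequencies.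

(** * Discrete Fourier coefficients and their decay *)

Section DiscreteFourier.
Variables (R : realType) (d : nat) (M : R) (h : nat).
Hypothesis M0 : 0 < M.

Local Notation m := (h.*2.+1).
Local Notation K := {ffun 'I_d -> 'I_m}.
Local Notation freq := (@grid_freq R d h).
(** Fundamental frequency for the period 4 M. The support of [g] has radius M, so a margin of about
    M on either side is left for the support to spread under repeated differences. *)
Let kappa : R := pi / (2 * M).
Let step : R := 4 * M / m%:R.

Let point (a : K) : 'rV[R]_d := step *: freq a.
Let coefsum (g : 'rV[R]_d -> R[i]) (k : K) : R[i] :=
  \sum_a g (point a) * cis (- (kappa * dot (point a) (freq k))).

Let m0 : 0 < m%:R :> R. Proof. by rewrite ltr0n. Qed.
Let step0 : 0 < step. Proof. by rewrite divr_gt0// mulr_gt0. Qed.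
Let kappa0 : 0 < kappa. Proof. by rewrite divr_gt0 ?pi_gt0// mulr_gt0. Qed.
Let kappa_step : kappa * step = 2 * pi / m%:R.
Proof. by rewrite /kappa /step; field; rewrite ?gt_eqF// ltr0n. Qed.

Let shift_index (j : 'I_d) (a : K) : K :=
  [ffun i => if i == j then ordS (a i) else a i].

Let shift_index_inj j : injective (shift_index j).
Proof.
move=> a b /ffunP ab; apply/ffunP => i; have := ab i; rewrite !ffunE.
by case: eqP => // _ /ordS_inj.
Qed.

Let dotDl (x y z : 'rV[R]_d) : dot (x + y) z = dot x z + dot y z.
Proof. by rewrite /dot -big_split; apply: eq_bigr => j _; rewrite !mxE mulrDl. Qed.

Let dotZl c (x y : 'rV[R]_d) : dot (c *: x) y = c * dot x y.
Proof. by rewrite /dot mulr_sumr; apply: eq_bigr => j _; rewrite !mxE mulrA. Qed.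

Let dot_basis j (x : 'rV[R]_d) : dot (basis_vec R j) x = x ord0 j.
Proof.
rewrite /dot (bigD1 j)//= big1 ?addr0 ?mxE ?eqxx ?mul1r// => i ij.
by rewrite mxE eqxx /= (negbTE ij) mul0r.
Qed.

(* The grid is periodic up to the values of g on its boundary. *)
Let coefsum_shift j (g : 'rV[R]_d -> R[i]) (k : K) :
  (forall x : 'rV[R]_d, step * h%:R <= `|x ord0 j| -> g x = 0) ->
  coefsum (fun x => g (x + step *: basis_vec R j)) k =
  cis (kappa * step * freq k ord0 j) * coefsum g k.
Proof.
move=> g0; rewrite [in RHS]/coefsum (reindex_inj (@shift_index_inj j)) mulr_sumr.
apply: eq_bigr => a _.
have [aj|aj] := ltnP (a j).+1 m.
  have -> : point (shift_index j a) = point a + step *: basis_vec R j.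
    rewrite /point -scalerDr; congr (_ *: _); apply/rowP => i.
    rewrite !mxE ffunE !eqxx /=; case: eqP => [->|_]; last by rewrite addr0.
    by rewrite /= modn_small// -natr1 addrAC.
  rewrite mulrCA -cisD; congr (_ * cis _).
  rewrite dotDl dotZl dot_basis mulrDr; ring.
(* At the last index the shift wraps around. The left side then evaluates [g] one step beyond the
   grid and the right side on the opposite face, and both values vanish. *)
have ajE : (a j : nat) = h.*2.
  by apply/eqP; rewrite eqn_leq -ltnS ltn_ord -ltnS.
rewrite [g (point (shift_index _ _))]g0 ?g0 ?mul0r ?mulr0//.
- rewrite /point !mxE !eqxx mulr1 ajE.
  rewrite -muln2 natrM (_ : step * _ + step = step * (h%:R + 1)); last by ring.
  by rewrite ger0_norm ?ler_pM2l ?lerDl// mulr_ge0 ?addr_ge0 ?(ltW step0).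
- rewrite /point !mxE ffunE eqxx /= ajE modnn sub0r mulrN normrN.
  exact: ler_norm.
Qed.

(** The periodic shift agrees with the true one as long as the growing support stays away from the
    boundary of the grid; this is the condition relating [r], [q] and [h]. *)
Let coefsum_iter_fdiff j (g : 'rV[R]_d -> R[i]) (k : K) q (r : R) :
  (forall x : 'rV[R]_d, r < `|x ord0 j| -> g x = 0) ->
  r + q%:R * step < step * h%:R ->
  coefsum (iter q (fdiff (step *: basis_vec R j)) g) k =
  (cis (kappa * step * freq k ord0 j) - 1) ^+ q * coefsum g k.
Proof.
move=> g0; elim: q => [|q IHq] rq; first by rewrite expr0 mul1r.
rewrite exprS -mulrA -IHq; last first.
  by apply: le_lt_trans rq; rewrite lerD2l ler_pM2r// ler_nat.
rewrite mulrBl mul1r -coefsum_shift => [|x hx].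
  rewrite /coefsum -sumrB; apply: eq_bigr => a _.
  by rewrite -mulrBl.
apply: iter_fdiff0 g0 _ _ => //; first exact: ltW.
apply: lt_le_trans hx; apply: le_lt_trans rq; rewrite lerD2l ler_pM2r// ler_nat//.
Qed.

Let normc_coefsum (g : 'rV[R]_d -> R[i]) (k : K) (B : R) :
  (forall x, normc (g x) <= B) -> normc (coefsum g k) <= m%:R ^+ d * B.
Proof.
move=> gB; rewrite (le_trans (normc_sum _ _ _))//.
apply: (@le_trans _ _ (\sum_(a : K) B)).
  by apply: ler_sum => a _; rewrite normcM normc_cis mulr1.
by rewrite sumr_const card_ffun !card_ord -[leRHS]mulrC -natrX mulr_natr.
Qed.

Let freq_le (k : K) j : `|freq k ord0 j| <= h%:R.
Proof.
rewrite mxE ler_norml lerBrDr addNr ler0n /= lerBlDr -natrD ler_nat addnn.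
by rewrite -ltnS ltn_ord.
Qed.

(* Summation by parts: p differences of g in direction j bring out the factor
   (cis (kappa * step * k_j) - 1) ^+ p, which is at least of size |k_j| ^+ p. *)
Let normc_coefsum_decay (g : 'rV[R]_d -> R[i]) (k : K) j p (B : R) :
  smooth g -> (forall x : 'rV[R]_d, M < `|x ord0 j| -> g x = 0) ->
  (p.*2.+1 < h)%N ->
  (forall x, normc (cpartials (nseq p j) g x) <= B) ->
  normc (coefsum g k) * (cos 1 / 4 * kappa * `|freq k ord0 j|) ^+ p <= m%:R ^+ d * B.
Proof.
move=> gs g0 ph gB; pose th := kappa * step * freq k ord0 j.
(* In units of [step] the radius M is (2h + 1) / 4, so p differences fit inside the grid when 4p + 1
   < 2h. *)
have pih : M + p%:R * step < step * h%:R.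
  have mE : m%:R = 2 * h%:R + 1 :> R by rewrite -natr1 -mul2n natrM.
  have Ms : M = step * ((2 * h%:R + 1) / 4).
    by rewrite /step mE; field; rewrite -mE gt_eqF.
  have : (p.*2.+2)%:R <= h%:R :> R by rewrite ler_nat.
  rewrite -mul2n -2!natr1 natrM => ph'.
  rewrite [in X in X + _]Ms [_ * step]mulrC -mulrDr ltr_pM2l//.
  move: ph'; lra.
(* [th] is 2 pi k_j / m with |k_j| <= h < m / 2, the range in which [cis th - 1] is bounded below
   linearly. *)
have api : `|th| <= pi.
  rewrite /th kappa_step normrM (@ger0_norm _ (2 * pi / m%:R)); last first.
    by rewrite !mulr_ge0 ?invr_ge0 ?pi_ge0.
  rewrite (le_trans (ler_wpM2l _ (freq_le k j)))//.
    by rewrite !mulr_ge0 ?invr_ge0 ?pi_ge0.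
  rewrite mulrAC ler_pdivrMr// [2 * pi]mulrC -mulrA ler_pM2l ?pi_gt0//.
  by rewrite -natrM ler_nat mul2n.
have := normc_coefsum k (normc_iter_fdiff (ltW step0) gs gB).
rewrite (coefsum_iter_fdiff k g0 pih) normcM normcX => H.
(* The bound on the differences and the lower bound on the symbol both contain (2 step)^p.
   Cancelling it leaves an estimate independent of the mesh and turns cos 1 / 2 into cos 1 / 4. *)
have s2 : 0 < 2 * step by rewrite mulr_gt0.
rewrite -(ler_pM2l (exprn_gt0 p s2)) [leRHS]mulrCA; apply: le_trans H.
rewrite mulrCA -exprMn [leLHS]mulrC ler_wpM2r ?normc_ge0//.
have c10 := @cos1_gt0 R.
rewrite lerXn2r ?nnegrE ?normc_ge0//.
  exact: mulr_ge0 (ltW s2) (mulr_ge0 (ltW (mulr_gt0 (divr_gt0 c10 (ltr0n R 4)) kappa0)) (normr_ge0 _)).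
apply: le_trans (normc_cisB1_ge api).
rewrite /th normrM (gtr0_norm (mulr_gt0 kappa0 step0)); apply: eq_ler.
by move: (step) (kappa) => s l; field.
Qed.

(** Orthogonality of characters: for distinct [a], [b] below m the ratio [cis al] is a nontrivial
    m-th root of unity, so the geometric sum vanishes. *)
Let geometric (a b : nat) : (a < m)%N -> (b < m)%N ->
  \sum_(i < m) cis (2 * pi / m%:R * (b%:R - a%:R) * (i%:R - h%:R)) =
  if a == b then m%:R else 0 :> R[i].
Proof.
move=> am bm; case: eqP => [->|/eqP ab].
  rewrite (eq_bigr (fun=> 1)) ?sumr_const ?card_ord// => i _.
  by rewrite subrr mulr0 mul0r cis0.
set al := _ * (b%:R - a%:R).
have al1 : cis al != 1.
  apply: cis_neq1; rewrite /al normrM gtr0_norm ?divr_gt0 ?mulr_gt0 ?pi_gt0//.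
  - rewrite /= mulrAC ltr_pdivrMr// ltr_pM2l ?mulr_gt0 ?pi_gt0//.
    move: am bm; rewrite -!(ltr_nat R) ltr_norml; have := ler0n R a; have := ler0n R b.
    lra.
  - by rewrite normr_gt0 subr_eq0 eqr_nat eq_sym.
rewrite (eq_bigr (fun i : 'I_m => cis (- (al * h%:R)) * cis al ^+ i)); last first.
  by move=> i _; rewrite -cis_natmul -cisD; congr cis; ring.
rewrite -mulr_sumr; apply/eqP; rewrite mulf_eq0; apply/orP; right.
have := subrX1 (cis al) m.
rewrite -cis_natmul /al (_ : _ * _ = 2 * pi * (b%:R - a%:R)); last by field; rewrite gt_eqF.
rewrite cis_int subrr => /esym/eqP; rewrite mulf_eq0 subr_eq0 => /orP[/eqP E|//].
by rewrite -E eqxx in al1.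
Qed.

(** After exchanging the sums, the sum over frequencies factors over the coordinates, and a
    coordinate in which [a] and [b] differ annihilates the product. *)
Let coefsum_inversion (g : 'rV[R]_d -> R[i]) (b : K) :
  \sum_k coefsum g k * cis (kappa * dot (point b) (freq k)) =
  m%:R ^+ d * g (point b).
Proof.
rewrite /coefsum; under eq_bigr do rewrite mulr_suml.
rewrite exchange_big /= (bigD1 b)//= [X in _ + X]big1 => [|a ab].
  rewrite addr0 (eq_bigr (fun=> g (point b))); last first.
    by move=> k _; rewrite -mulrA -cisD addNr cis0 mulr1.
  by rewrite sumr_const card_ffun !card_ord -natrX mulr_natl.
rewrite (eq_bigr (fun k : K => g (point a) * \prod_j
    cis (2 * pi / m%:R * ((b j)%:R - (a j)%:R) * ((k j)%:R - h%:R)))); last first.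
  move=> k _; rewrite -mulrA -cisD -cis_sum; congr (_ * cis _).
  have E c : kappa * dot (point c) (freq k) =
      2 * pi / m%:R * dot (freq c) (freq k).
    by rewrite dotZl mulrA kappa_step.
  rewrite !E addrC -mulrBr /dot -sumrB mulr_sumr; apply: eq_bigr => j _.
  by rewrite -[RHS]mulrA; congr (_ * _); rewrite !mxE; ring.
rewrite -mulr_sumr -(bigA_distr_bigA (fun (j : 'I_d) (i : 'I_m) =>
  cis (2 * pi / m%:R * ((b j)%:R - (a j)%:R) * (i%:R - h%:R)))).
have [j abj] : exists j, a j != b j.
  apply/existsP; apply: contraNT ab; rewrite negb_exists => /forallP H.
  by apply/eqP/ffunP => j; apply/eqP; have := H j; rewrite negbK.
rewrite (bigD1 j)//= geometric ?ltn_ord//.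
by rewrite -val_eqE /= in abj; rewrite (negbTE abj) mul0r mulr0.
Qed.

Let coef (g : 'rV[R]_d -> R[i]) (k : K) : R[i] := coefsum g k / m%:R ^+ d.

Let normc_coef (g : 'rV[R]_d -> R[i]) (k : K) :
  normc (coef g k) = normc (coefsum g k) / m%:R ^+ d.
Proof.
by rewrite normcM normcV ?normcX ?normc_nat// expf_neq0// pnatr_eq0.
Qed.

(** Depends on M and p only, so it survives the refinement of the grid. The two summands belong to
    the trivial bound and to the bound with p differences. *)
Definition decay_const p : R := 2 ^+ p * (1 + (cos 1 / 4 * kappa) ^- p).

Let coef_decay (g : 'rV[R]_d -> R[i]) (k : K) p (B : R) :
  smooth g -> (forall x : 'rV[R]_d, M < `|x| -> g x = 0) -> (p.*2.+1 < h)%N ->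
  (forall x, normc (g x) <= B) ->
  (forall j x, normc (cpartials (nseq p j) g x) <= B) ->
  normc (coef g k) * (1 + `|freq k|) ^+ p <= decay_const p * B.
Proof.
move=> gs g0 ph gB gpB.
have B0 : 0 <= B := le_trans (normc_ge0 _) (gB 0).
have c0 : 0 < cos 1 / 4 * kappa by rewrite mulr_gt0// divr_gt0// cos1_gt0.
have md0 : 0 < m%:R ^+ d :> R by rewrite exprn_gt0.
have b1 : normc (coef g k) <= B.
  by rewrite normc_coef ler_pdivrMr// mulrC normc_coefsum.
have b2 : normc (coef g k) * `|freq k| ^+ p <= (cos 1 / 4 * kappa) ^- p * B.
  have [k0|k0] := eqVneq (freq k) 0.
    case: p {ph gpB} => [|p]; first by rewrite !expr0 invr1 mulr1 mul1r.
    rewrite k0 normr0 expr0n mulr0 mulr_ge0// invr_ge0 exprn_ge0//; exact: ltW.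
  (* The maximum norm is attained at some coordinate [j]; the differences are taken in that
     direction. *)
  have [[i j] /= kj] : exists i, `|freq k| = `|freq k i.1 i.2|.
    by apply: mx_norm_neq0; rewrite -[mx_norm _]/(`|freq k|) normr_eq0.
  rewrite kj (ord1 i) -[leRHS]mulrC ler_pdivlMr ?exprn_gt0//.
  have g0j (x : 'rV[R]_d) : M < `|x ord0 j| -> g x = 0.
    by move=> Mx; apply: g0; apply: lt_le_trans Mx (coord_le_norm _ _).
  have H := normc_coefsum_decay k gs g0j ph (gpB j).
  rewrite normc_coef -(ler_pM2l md0); apply: le_trans H; apply: eq_ler.
  rewrite [in RHS]exprMn [_ ^+ p * _ in RHS]mulrC mulrA [in RHS]mulrA; congr (_ * _).
  by rewrite mulrA [_ ^+ d * _]mulrC divfK// gt_eqF.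
have y0 := normr_ge0 (freq k); move: `|_| y0 b2 => y y0 b2.
have yp : (1 + y) ^+ p <= 2 ^+ p * (1 + y ^+ p).
  have [y1|y1] := leP y 1.
    apply: (@le_trans _ _ (2 ^+ p)); last by rewrite ler_peMr ?exprn_ge0// lerDl exprn_ge0.
    by rewrite lerXn2r ?nnegrE ?addr_ge0//; lra.
  apply: (@le_trans _ _ (2 ^+ p * y ^+ p)).
    by rewrite -exprMn lerXn2r ?nnegrE ?addr_ge0 ?mulr_ge0//; lra.
  by rewrite ler_pM2l ?exprn_gt0// lerDr.
rewrite (le_trans (ler_wpM2l (normc_ge0 _) yp))//.
rewrite mulrCA /decay_const -[leRHS]mulrA ler_pM2l ?exprn_gt0//.
by rewrite mulrDr mulrDl mulr1 mul1r lerD.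
Qed.

Let trigpoly (g : 'rV[R]_d -> R[i]) x := \sum_k coef g k * cis (kappa * dot x (freq k)).

Let trigpoly_point g b : trigpoly g (point b) = g (point b).
Proof.
apply: (@mulfI _ (m%:R ^+ d : R[i])); first by rewrite expf_neq0// pnatr_eq0.
rewrite -(coefsum_inversion g b) /trigpoly mulr_sumr; apply: eq_bigr => k _.
by rewrite mulrA /coef [_ * (_ / _)]mulrC divfK// expf_neq0// pnatr_eq0.
Qed.

Let normc_dot_le (x y : 'rV[R]_d) : `|dot x y| <= d%:R * (`|x| * `|y|).
Proof.
rewrite (le_trans (ler_norm_sum _ _ _))//.
apply: (@le_trans _ _ (\sum_(j < d) `|x| * `|y|)).
  by apply: ler_sum => j _; rewrite normrM ler_pM// coord_le_norm.
by rewrite sumr_const card_ord mulr_natl.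
Qed.

Let kd0 : 0 <= kappa * d%:R. Proof. exact: mulr_ge0 (ltW kappa0) (ler0n _ _). Qed.

(** Decay of order above 2d is required: one power absorbs the frequency brought out by the
    increment, and 2d powers make the sum over the grid bounded. *)
Let trigpoly_lipschitz (g : 'rV[R]_d -> R[i]) p (B : R) x y : 0 <= B ->
  (2 * d < p)%N ->
  (forall k, normc (coef g k) * (1 + `|freq k|) ^+ p <= B) ->
  normc (trigpoly g x - trigpoly g y) <= kappa * d%:R * (B * 4 ^+ d) * `|x - y|.
Proof.
move=> B0 dp cB; rewrite -sumrB (le_trans (normc_sum _ _ _))//.
apply: (@le_trans _ _ (\sum_k kappa * d%:R * `|x - y| * (B * (1 + `|freq k|) ^- (2 * d)))).
  apply: ler_sum => k _; rewrite -mulrBr normcM.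
  apply: (@le_trans _ _ (normc (coef g k) * (kappa * (d%:R * (`|x - y| * `|freq k|))))).
    rewrite ler_wpM2l ?normc_ge0// (le_trans (normc_cis_lipschitz _ _))//.
    by rewrite -mulrBr -dotB normrM (gtr0_norm kappa0) ler_pM2l// normc_dot_le.
  rewrite [leLHS](_ : _ = kappa * d%:R * `|x - y| * (normc (coef g k) * `|freq k|)); last first.
    by move: (kappa) => l; ring.
  apply: ler_wpM2l; first exact: mulr_ge0 kd0 (normr_ge0 _).
  have F0 : 0 < 1 + `|freq k| by rewrite ltr_pwDl.
  rewrite ler_pdivlMr ?exprn_gt0//; apply: le_trans (cB k).
  rewrite -mulrA ler_wpM2l ?normc_ge0//.
  apply: (@le_trans _ _ ((1 + `|freq k|) ^+ (2 * d).+1)).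
    by rewrite exprS ler_wpM2r ?exprn_ge0 ?(ltW F0)// lerDr.
  by rewrite ler_weXn2l// lerDl.
rewrite -mulr_sumr -mulr_sumr [leRHS]mulrAC.
apply: ler_wpM2l; first exact: mulr_ge0 kd0 (normr_ge0 _).
by rewrite ler_wpM2l// sum_grid_le.
Qed.

Let point_near (x : 'rV[R]_d) : (0 < h)%N -> `|x| <= M -> exists a, `|x - point a| <= step.
Proof.
move=> h0 xM.
have aP j : exists n : 'I_m, `|x ord0 j - step * (n%:R - h%:R)| <= step.
  (* The coordinate in grid units, counted from the corner of the grid. |x| <= M keeps it between 0
     and m, and truncation moves it by less than one unit. *)
  pose y := x ord0 j / step + h%:R.
  have mE : m%:R = 2 * h%:R + 1 :> R by rewrite -natr1 -mul2n natrM.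
  have h1 : 1 <= h%:R :> R by rewrite ler1n.
  have Ms : M = step * ((2 * h%:R + 1) / 4).
    by rewrite /step mE; field; rewrite -mE gt_eqF.
  have := le_trans (coord_le_norm x j) xM; rewrite {1}Ms ler_norml -mulrN => /andP[x1 x2].
  have y1 : 0 <= y.
    rewrite /y -lerBlDr ler_pdivlMr// mulrC (le_trans _ x1)// ler_pM2l//.
    by move: h1; lra.
  have y2 : y < m%:R.
    rewrite /y -ltrBrDr ltr_pdivrMr// mulrC (le_lt_trans x2)// ltr_pM2l// mE.
    by move: h1; lra.
  have /andP[t1 t2] := truncn_itv y1.
  have tm : (Num.truncn y < m)%N by rewrite -(ltr_nat R) (le_lt_trans t1).
  exists (Ordinal tm) => /=.
  have -> : x ord0 j = step * (y - h%:R).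
    by rewrite /y addrK mulrC divfK// gt_eqF.
  rewrite -mulrBr opprB addrA subrK normrM (gtr0_norm step0).
  rewrite ger_pMr// ler_norml; move: t1 t2; rewrite -natr1; lra.
exists [ffun j => sval (cid (aP j))]; apply/rV_norm_leP => [|j]; first exact: ltW.
by rewrite !mxE ffunE; exact: (svalP (cid (aP j))).
Qed.

(* The exponentials have period 4 M, twice the diameter of the support of g, so
   that g extends periodically. The error is controlled between neighbouring
   grid points, where both sides agree. *)
Lemma trig_interpolation (g : 'rV[R]_d -> R[i]) p (B dl : R) :
  smooth g -> (forall x : 'rV[R]_d, M < `|x| -> g x = 0) ->
  (p.*2.+1 < h)%N -> (2 * d < p)%N ->
  (forall x, normc (g x) <= B) ->
  (forall j x, normc (cpartials (nseq p j) g x) <= B) ->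
  (forall x y : 'rV[R]_d, `|x - y| <= 4 * M / m%:R -> normc (g x - g y) <= dl) ->
  exists c : K -> R[i],
    (forall k, normc (c k) * (1 + `|freq k|) ^+ p <= decay_const p * B) /\
    forall x : 'rV[R]_d, `|x| <= M ->
      normc (g x - \sum_k c k * cis (kappa * dot x (freq k))) <=
      dl + kappa * d%:R * (decay_const p * B * 4 ^+ d) * (4 * M / m%:R).
Proof.
move=> gs g0 ph dp gB gpB gdl; exists (coef g).
have cB k := coef_decay k gs g0 ph gB gpB.
have B0 : 0 <= decay_const p * B.
  by apply: le_trans (cB [ffun=> ord0]); rewrite mulr_ge0 ?normc_ge0 ?exprn_ge0 ?addr_ge0.
split=> // x xM; have [|a xa] := point_near _ xM; first exact: leq_ltn_trans ph.
rewrite -/(trigpoly g x) -[g x](subrK (g (point a))) -{2}trigpoly_point -addrA.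
rewrite (le_trans (le_normcD _ _))// lerD//; first exact: gdl.
rewrite (le_trans (trigpoly_lipschitz _ _ B0 dp cB))// distrC.
by apply: ler_wpM2l => //; apply: mulr_ge0 kd0 (mulr_ge0 B0 (exprn_ge0 _ _)).
Qed.

End DiscreteFourier.

(** * Fourier transform of a product *)

Section FourierProduct.
Variable R : realType.

(** The tube lemma is applied with the increment as parameter, over the ball of radius M + 1; beyond
    it, points at distance at most 1 lie both off the support. *)
Lemma Cc_unif_continuous d (M dl : R) (f : 'rV[R]_d -> R) : Cc M f -> 0 < dl ->
  exists2 eta : R, 0 < eta & forall x y, `|x - y| <= eta -> `|f x - f y| <= dl.
Proof.
move=> [cf f0] dl0.
have cF (x : 'rV[R]_d) : {for (0 : 'rV[R]_d, x), continuous (fun p : 'rV[R]_d * 'rV[R]_d => f (p.2 + p.1))}.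
  apply: (@continuous_comp _ _ _ (fun p : 'rV[R]_d * 'rV[R]_d => p.2 + p.1) f); last exact: cf.
  by apply: continuousD; [exact: cvg_snd|exact: cvg_fst].
have := @unif_continuous_param R _ _ (fun s x : 'rV[R]_d => f (x + s))
  [set x : 'rV[R]_d | `|x| <= M + 1] 0 dl (@compact_ball _ _ _) (fun x _ => cF x) dl0.
move=> /nbhs_ballP[e /= e0 He].
exists (Num.min (e / 2) 1); first by rewrite lt_min divr_gt0 ?ltr01.
move=> x y; rewrite le_min => /andP[xye xy1].
have [yM|My] := leP `|y| (M + 1).
  have := He (x - y); rewrite -ball_normE /= sub0r normrN => H.
  have /H/(_ y yM) : `|x - y| < e by apply: le_lt_trans xye _; rewrite ltr_pdivrMr// ltr_pMr// ltr1n.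
  by rewrite subrKC addr0 => /ltW.
rewrite !f0 ?subrr ?normr0 ?(ltW dl0)//; first by apply: le_lt_trans My; rewrite lerDl.
have := ler_normB (x) (x - y); rewrite opprB subrKC => H.
by move: H My xy1; lra.
Qed.

Lemma Ccc_unif_continuous d (M dl : R) (f : 'rV[R]_d -> R[i]) : Ccc M f -> 0 < dl ->
  exists2 eta : R, 0 < eta & forall x y, `|x - y| <= eta -> normc (f x - f y) <= dl.
Proof.
move=> fc dl0; have dl20 : 0 < dl / 2 by rewrite divr_gt0.
have [e1 e10 H1] := Cc_unif_continuous (CccRe fc) dl20.
have [e2 e20 H2] := Cc_unif_continuous (CccIm fc) dl20.
exists (Num.min e1 e2); first by rewrite lt_min e10.
move=> x y; rewrite le_min => /andP[xy1 xy2].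
rewrite (le_trans (normc_le _))// [dl]splitr.
have -> : Re (f x - f y) = Re (f x) - Re (f y) by case: (f x) (f y) => ? ? [].
have -> : Im (f x - f y) = Im (f x) - Im (f y) by case: (f x) (f y) => ? ? [].
by rewrite lerD ?H1 ?H2.
Qed.

Lemma smooth_Ccc d (M : R) (f : 'rV[R]_d -> R[i]) : smooth f ->
  (forall x : 'rV[R]_d, M < `|x| -> f x = 0) -> Ccc M f.
Proof. by move=> fs f0; split=> // x; case: (fs [::] x). Qed.

Lemma trig_approx d (M : R) p (B dl : R) (g : 'rV[R]_d -> R[i]) : 0 < M -> 0 < dl ->
  smooth g -> (forall x : 'rV[R]_d, M < `|x| -> g x = 0) -> (2 * d < p)%N ->
  (forall x, normc (g x) <= B) ->
  (forall j x, normc (cpartials (nseq p j) g x) <= B) ->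
  exists h (c : {ffun 'I_d -> 'I_(h.*2.+1)} -> R[i]),
    (forall k, normc (c k) * (1 + `|grid_freq R k|) ^+ p <= decay_const M p * B) /\
    forall x : 'rV[R]_d, `|x| <= M ->
      normc (g x - \sum_k c k * cis (pi / (2 * M) * dot x (grid_freq R k))) <= dl.
Proof.
move=> M0 dl0 gs g0 dp gB gpB; have dl20 : 0 < dl / 2 by rewrite divr_gt0.
have [eta eta0 geta] := Ccc_unif_continuous (smooth_Ccc gs g0) dl20.
pose L := pi / (2 * M) * d%:R * (decay_const M p * B * 4 ^+ d).
(* The three summands are the three requirements on [h]: mesh at most [eta], Lipschitz error at most
   dl / 2, and room for p differences. *)
pose X := 4 * M / eta + `|L| * (4 * M) / (dl / 2) + (p.*2.+1)%:R.
pose h := (Num.truncn X).+1.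
have M4 : 0 <= 4 * M by rewrite mulr_ge0// ltW.
have t1 : 0 <= 4 * M / eta by rewrite divr_ge0// ltW.
have t2 : 0 <= `|L| * (4 * M) / (dl / 2).
  exact: divr_ge0 (mulr_ge0 (normr_ge0 _) M4) (ltW dl20).
have t3 : 0 <= (p.*2.+1)%:R :> R by [].
have X0 : 0 <= X by exact: addr_ge0 (addr_ge0 t1 t2) t3.
have hX : X < h%:R by case/andP: (truncn_itv X0).
have mX : X <= (h.*2.+1)%:R.
  by rewrite (le_trans (ltW hX))// ler_nat -addnn leqW// leq_addr.
have m0 : 0 < (h.*2.+1)%:R :> R by rewrite ltr0n.
have ph : (p.*2.+1 < h)%N.
  by rewrite -(ltr_nat R) (le_lt_trans _ hX)// lerDr addr_ge0.
have s1 : 4 * M / (h.*2.+1)%:R <= eta.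
  by rewrite ler_pdivrMr// [leRHS]mulrC -ler_pdivrMr// (le_trans _ mX)// /X -addrA lerDl addr_ge0.
have s2 : `|L| * (4 * M / (h.*2.+1)%:R) <= dl / 2.
  rewrite mulrA ler_pdivrMr// [leRHS]mulrC -ler_pdivrMr// (le_trans _ mX)// /X addrAC lerDr.
  exact: addr_ge0.
have [|c [c1 c2]] := @trig_interpolation R d M h M0 g p B (dl / 2) gs g0 ph dp gB gpB.
  by move=> x y xy; apply: geta; apply: le_trans xy s1.
exists h, c; split=> // x xM; apply: le_trans (c2 x xM) _.
rewrite [leRHS]splitr lerD2l (le_trans _ s2)// ler_wpM2r ?ler_norm//.
exact: divr_ge0.
Qed.

Lemma fourier_bound d (M F : R) (f : 'rV[R]_d -> R[i]) xi : 0 <= M -> Ccc M f ->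
  (forall x, normc (f x) <= F) -> normc (fourier f xi) <= 2 * ((2 * M) ^+ d * F).
Proof.
move=> M0 fc fF; have [H1 H2] := cisN_dot_continuous xi; rewrite fourierE.
apply: normc_cint => //; first exact: CccM.
by move=> x; rewrite normcM normc_cis mul1r.
Qed.

Lemma fourier_translation d (M : R) (f : 'rV[R]_d -> R[i]) c xi : 0 <= M -> Ccc M f ->
  fourier (fun x => f (x - c)) xi = cis (- dot c xi) * fourier f xi.
Proof.
move=> M0 fc; have [H1 H2] := cisN_dot_continuous xi; rewrite !fourierE.
have gc := CccM H1 H2 fc.
rewrite -(cintZ _ M0 gc) -(cint_translation c M0 (CccZ _ gc)).
congr cint; apply/funext => x; rewrite mulrA -cisD dotB; congr (cis _ * _); ring.
Qed.

(** Modulation by [cis (dot x w)] translates the transform by [w]; the rest is linearity over a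
    finite sum. *)
Lemma fourier_trigpoly d (M : R) (I : finType) (c : I -> R[i]) (w : I -> 'rV[R]_d)
    (f : 'rV[R]_d -> R[i]) xi : 0 <= M -> Ccc M f ->
  Ccc M (fun x => (\sum_i c i * cis (dot x (w i))) * (cis (- dot x xi) * f x)) /\
  cint (fun x => (\sum_i c i * cis (dot x (w i))) * (cis (- dot x xi) * f x)) =
  \sum_i c i * fourier f (xi - w i).
Proof.
move=> M0 fc; have [H1 H2] := cisN_dot_continuous xi.
have hc := CccM H1 H2 fc.
have E : (fun x => (\sum_i c i * cis (dot x (w i))) * (cis (- dot x xi) * f x)) =
  (fun x => \sum_i c i * (cis (dot x (w i)) * (cis (- dot x xi) * f x))).
  by apply/funext => x; rewrite mulr_suml; apply: eq_bigr => i _; rewrite -mulrA.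
have kc i : Ccc M (fun x => cis (dot x (w i)) * (cis (- dot x xi) * f x)).
  by have [K1 K2] := cis_dot_continuous (w i); exact: CccM.
have [C1 C2] := @cint_sum R d M I (index_enum I) _ M0 (fun i => CccZ (c i) (kc i)).
rewrite E; split=> //; rewrite C2; apply: eq_bigr => i _.
rewrite (cintZ _ M0 (kc i)) fourierE; congr (_ * cint _); apply/funext => x.
by rewrite mulrA -cisD dotBr; congr (cis _ * _); ring.
Qed.

(* Replacing g by trigonometric polynomials turns the transform of g * f into
   the sum of c_k * fourier f (xi - kappa k), which makes Fourier inversion
   unnecessary. Frequencies with |kappa k| <= rho use the bound G, the others
   the decay of c_k. *)
Lemma fourier_mul_bound d (M : R) r (B S G rho : R) (g f : 'rV[R]_d -> R[i]) xi :
  0 < M -> smooth g -> (forall x : 'rV[R]_d, M < `|x| -> g x = 0) ->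
  (forall x, normc (g x) <= B) ->
  (forall j x, normc (cpartials (nseq (2 * d + r.+1) j) g x) <= B) ->
  Ccc M f -> (forall x, normc (f x) <= S) -> 0 <= rho -> 0 <= G ->
  (forall eta, `|eta - xi| <= rho -> normc (fourier f eta) <= G) ->
  normc (fourier (g * f) xi) <=
    decay_const M (2 * d + r.+1) * B * 4 ^+ d *
      (G + 2 * ((2 * M) ^+ d * S) * (1 + rho / (pi / (2 * M))) ^- r.+1).
Proof.
move=> M0 gs g0 gB gpB fc fS rho0 G0 fG.
set kappa := pi / (2 * M); set p := (2 * d + r.+1)%N; set A := decay_const M p * B.
set F := 2 * ((2 * M) ^+ d * S).
have kappa0 : 0 < kappa by rewrite divr_gt0 ?pi_gt0 ?mulr_gt0.
have M0' := ltW M0.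
have S0 : 0 <= S := le_trans (normc_ge0 _) (fS 0).
have F0 : 0 <= F by rewrite !mulr_ge0 ?exprn_ge0 ?mulr_ge0.
have fF eta : normc (fourier f eta) <= F by exact: fourier_bound.
apply/ler_addgt0Pr => e e0.
(* The approximation error contributes F * dl to the transform, which is to stay below the arbitrary
   [e]; the [+ 1] avoids division by zero. *)
pose dl := e / (F + 1).
have dl0 : 0 < dl by rewrite divr_gt0// ltr_wpDl.
have dp : (2 * d < p)%N by rewrite /p addnS ltnS leq_addr.
have [h [c [c1 c2]]] := trig_approx M0 dl0 gs g0 dp gB gpB.
have [Pc PE] := fourier_trigpoly c (fun k => kappa *: grid_freq R k) xi M0' fc.
have [H1 H2] := cisN_dot_continuous xi.
have hc := CccM H1 H2 fc.
have dotZr (x y : 'rV[R]_d) : dot x (kappa *: y) = kappa * dot x y.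
  by rewrite /dot mulr_sumr; apply: eq_bigr => j _; rewrite !mxE mulrCA.
have gc : Ccc M (fun x => g x * (cis (- dot x xi) * f x)).
  by apply: CccM hc => x; case: (gs [::] x).
pose S' := \sum_k c k * fourier f (xi - kappa *: grid_freq R k).
have -> : fourier (g * f) xi = S' + (fourier (g * f) xi - S') by rewrite subrKC.
rewrite (le_trans (le_normcD _ _))// lerD//; last first.
  have -> : fourier (g * f) xi - S' = cint (fun x =>
      (g x - \sum_k c k * cis (kappa * dot x (grid_freq R k))) * (cis (- dot x xi) * f x)).
    rewrite /S' -PE -[X in _ - X]mul1r -mulNr -(cintZ _ M0' Pc) fourierE.
    have -> : cint (fun x => cis (- dot x xi) * (g * f) x) =
              cint (fun x => g x * (cis (- dot x xi) * f x)).
      by congr cint; apply/funext => x; rewrite mulrCA.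
    rewrite -(cintD M0' gc (CccZ _ Pc)); congr cint; apply/funext => x.
    rewrite mulN1r mulrBl; congr (_ - _ * _).
    by apply: eq_bigr => k _; rewrite dotZr.
  apply: (@le_trans _ _ (2 * ((2 * M) ^+ d * (dl * S)))); last first.
    rewrite (_ : _ * _ = F * dl); last by rewrite /F; ring.
    by rewrite /dl mulrA ler_pdivrMr ?ltr_wpDl// mulrC ler_wpM2l ?(ltW e0)// lerDl.
  apply: normc_cint => //.
    have := CccD gc (CccZ (-1) Pc); congr Ccc; apply/funext => x.
    rewrite mulN1r mulrBl; congr (_ - _ * _).
    by apply: eq_bigr => k _; rewrite dotZr.
  move=> x; have [xM|Mx] := leP `|x| M.
    by rewrite normcM normcM normc_cis mul1r ler_pM ?normc_ge0 ?fS ?c2.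
  by case: fc => _ _ ->; rewrite // !mulr0 normc0 mulr_ge0// ltW.
rewrite (le_trans (normc_sum _ _ _))//.
set T := G + _.
have rk0 : 0 < 1 + rho / kappa by rewrite ltr_pwDl// divr_ge0// ltW.
have T1 : F * (1 + rho / kappa) ^- r.+1 <= T by rewrite lerDr.
have T2 : G <= T by rewrite lerDl mulr_ge0// invr_ge0 exprn_ge0// ltW.
have T0 := le_trans G0 T2.
(* Of the 2d + r + 1 powers of decay of [c k], 2d are spent on summing over the grid. The other r +
   1 are spent on the frequencies beyond [rho]. *)
apply: (@le_trans _ _ (\sum_k A * T * (1 + `|grid_freq R k|) ^- (2 * d))); last first.
  rewrite -mulr_sumr [leRHS]mulrAC; apply: ler_wpM2l; last exact: sum_grid_le.
  apply: mulr_ge0 => //; apply: le_trans (c1 [ffun=> ord0]).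
  by rewrite mulr_ge0 ?normc_ge0 ?exprn_ge0 ?addr_ge0.
apply: ler_sum => k _; rewrite normcM.
have K0 : 0 < 1 + `|grid_freq R k| by rewrite ltr_pwDl.
rewrite ler_pdivlMr ?exprn_gt0//.
have ck := c1 k; rewrite -/A /p exprD in ck.
have [small|large] := leP (kappa * `|grid_freq R k|) rho.
  apply: (@le_trans _ _ (normc (c k) * (1 + `|grid_freq R k|) ^+ (2 * d) * T)).
    rewrite mulrAC ler_wpM2l ?mulr_ge0 ?normc_ge0 ?exprn_ge0 ?(ltW K0)//.
    apply: le_trans T2; apply: fG; rewrite addrAC subrr sub0r normrN normrZ.
    by rewrite gtr0_norm.
  rewrite ler_wpM2r// (le_trans _ ck)// ler_wpM2l ?normc_ge0//.
  by rewrite ler_peMr ?exprn_ge0 ?(ltW K0)// exprn_ege1// lerDl.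
apply: (@le_trans _ _ (normc (c k) * (1 + `|grid_freq R k|) ^+ (2 * d) * F)).
  by rewrite mulrAC ler_wpM2l ?mulr_ge0 ?normc_ge0 ?exprn_ge0 ?(ltW K0).
have kl : (1 + rho / kappa) ^+ r.+1 <= (1 + `|grid_freq R k|) ^+ r.+1.
  rewrite lerXn2r ?nnegrE ?(ltW rk0) ?(ltW K0)// lerD2l ler_pdivrMr// mulrC.
  exact: ltW.
rewrite -(ler_pM2r (exprn_gt0 r.+1 rk0)).
apply: (@le_trans _ _ (A * (F * (1 + rho / kappa) ^- r.+1) * (1 + rho / kappa) ^+ r.+1)); last first.
  rewrite ler_wpM2r ?exprn_ge0 ?(ltW rk0)// ler_wpM2l//.
  by apply: le_trans ck; rewrite mulr_ge0 ?normc_ge0 ?mulr_ge0 ?exprn_ge0 ?(ltW K0).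
rewrite -[leRHS]mulrA divfK ?expf_neq0 ?gt_eqF//.
rewrite [leLHS]mulrAC -(mulrA (normc _)) ler_wpM2r//.
apply: le_trans ck; rewrite ler_wpM2l ?normc_ge0// ler_wpM2l//.
Qed.

End FourierProduct.

(** * Bump functions *)

Section SmoothConstructions.
Variable R : realType.

Lemma smooth_uptoS d n (f : 'rV[R]_d -> R[i]) : (forall x, C1_at f x) ->
  (forall j, smooth_upto n (cpartial j f)) -> smooth_upto n.+1 f.
Proof.
move=> f1 fp s x; case/lastP: s => [_|s j]; first exact: f1.
by rewrite size_rcons ltnS cpartials_rcons => sn; apply: fp.
Qed.

Lemma smoothW d n (f : 'rV[R]_d -> R[i]) : smooth f -> smooth_upto n f.
Proof. by move=> fs s x _; exact: fs. Qed.

Lemma smooth_C1 d (f : 'rV[R]_d -> R[i]) x : smooth f -> C1_at f x.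
Proof. by move=> fs; exact: (fs [::]). Qed.

(** Smoothness is defined for complex valued functions only, so real ones are embedded. *)
Definition ofreal d (r : 'rV[R]_d -> R) : 'rV[R]_d -> R[i] := fun x => (r x +i* 0)%C.

Lemma C1_at_ofreal d (r : 'rV[R]_d -> R) x : {for x, continuous r} ->
  (forall j, derivable r x (basis_vec R j)) -> C1_at (ofreal r) x.
Proof.
move=> rc rd; split; [exact: rc|exact: cst_continuous|exact: rd|].
by move=> j; exact: derivable_cst.
Qed.

Lemma cpartial_ofreal d j (r : 'rV[R]_d -> R) :
  cpartial j (ofreal r) = ofreal (fun x => 'D_(basis_vec R j) r x).
Proof. by apply/funext => x; rewrite /cpartial/= derive_cst. Qed.

Lemma ofrealM d (r s : 'rV[R]_d -> R) : ofreal r * ofreal s = ofreal (fun x => r x * s x).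
Proof.
apply/funext => x; rewrite -[LHS]/(ofreal r x * ofreal s x).
by apply: complexP; rewrite ?ReM ?ImM /= ?mulr0 ?mul0r ?subr0 ?addr0.
Qed.

(** Induction on the order: the derivative of 1 / r is - r' times the square of 1 / r, to which the
    product rule applies. *)
Lemma smooth_inv d (r : 'rV[R]_d -> R) : (forall x, r x != 0) ->
  smooth (ofreal r) -> smooth (ofreal (fun x => (r x)^-1)).
Proof.
move=> r0 rs; apply/smooth_uptoP => n.
have C1 x : C1_at (ofreal (fun x => (r x)^-1)) x.
  have [rc _ rd _] := smooth_C1 x rs; apply: C1_at_ofreal.
    by apply: continuousV; [exact: r0|exact: rc].
  by move=> j; apply: derivableV; [exact: r0|exact: rd].
elim: n => [|n IHn]; first by move=> s x; rewrite leqn0 => /nilP ->.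
apply: (smooth_uptoS C1) => j.
have -> : cpartial j (ofreal (fun x => (r x)^-1)) =
    cst (-1) * cpartial j (ofreal r) *
    (ofreal (fun x => (r x)^-1) * ofreal (fun x => (r x)^-1)).
  rewrite !cpartial_ofreal !ofrealM.
  have -> : (cst (-1) : 'rV[R]_d -> R[i]) = ofreal (cst (-1)).
    by apply/funext => x; apply: complexP; rewrite /= ?oppr0.
  rewrite !ofrealM; congr ofreal; apply/funext => x.
  have [_ _ rd _] := smooth_C1 x rs.
  rewrite (deriveV (r0 x) (rd j)) -[LHS]/(_ * _) /=.
  by field; exact: r0.
apply: smooth_uptoM (smooth_uptoM _ _) (smooth_uptoM IHn IHn).
  by apply: smoothW; exact: smooth_cst.
by apply: smoothW; exact: smooth_partial.
Qed.

Lemma smooth_prod d (I : Type) (r : seq I) (f : I -> 'rV[R]_d -> R[i]) :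
  (forall i, smooth (f i)) -> smooth (\prod_(i <- r) f i).
Proof.
move=> fs; elim/big_ind: _ => [|g h|i _]; [|exact: smoothM|exact: fs].
exact: (@smooth_cst R d 1).
Qed.

(** A smooth function of one variable is given as the sequence [g] of its successive derivatives,
    the form in which [flat] is available. *)
Lemma smooth_coord d (g : nat -> R -> R) (j : 'I_d) (a b : R) :
  (forall n (x : R), is_derive x 1 (g n) (g n.+1 x)) ->
  smooth (ofreal (fun x : 'rV[R]_d => g 0%N (a * x ord0 j + b))).
Proof.
move=> dg; have lin (x : 'rV[R]_d) i : is_derive x (basis_vec R i)
    (fun x : 'rV[R]_d => a * x ord0 j + b) (if i == j then a else 0).
  apply/is_derive_lineP; set al := if _ then a else 0.
  have -> : (fun h : R => a * (h *: basis_vec R i + x) ord0 j + b) =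
      (fun h => h * al + (a * x ord0 j + b)).
    apply/funext => h; rewrite !mxE eqxx eq_sym /= /al.
    by case: eqP => _; rewrite /= ?mulr1 ?mulr0; ring.
  have := is_deriveD (is_deriveM (is_derive_id (0 : R) (1 : R)) (is_derive_cst al (0 : R) 1))
    (is_derive_cst (a * x ord0 j + b) (0 : R) (1 : R)).
  by rewrite scaler0 add0r addr0 [_ *: _]mulr1.
have dg' n (x : 'rV[R]_d) i : is_derive x (basis_vec R i)
    (fun x : 'rV[R]_d => g n (a * x ord0 j + b))
    (if i == j then a * g n.+1 (a * x ord0 j + b) else 0).
  apply: (is_derive_eq (is_derive_comp_line (dg n _) (lin x i))).
  by case: (i == j); rewrite ?mulr0// mulrC.
have C1 n x : C1_at (ofreal (fun x : 'rV[R]_d => g n (a * x ord0 j + b))) x.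
  apply: C1_at_ofreal; last by move=> i; case: (dg' n x i).
  apply: (@continuous_comp _ _ _ (fun x : 'rV[R]_d => a * x ord0 j + b) (g n)).
    apply: continuousD; last exact: cst_continuous.
    by apply: continuousM; [exact: cst_continuous|exact: coord_continuous].
  by apply: differentiable_continuous; apply/derivable1_diffP; case: (dg n (a * x ord0 j + b)).
suff H m n : smooth_upto m (ofreal (fun x : 'rV[R]_d => g n (a * x ord0 j + b))).
  by apply/smooth_uptoP => m; exact: H.
elim: m n => [|m IHm] n.
  by move=> s x; rewrite leqn0 => /nilP ->; exact: C1.
apply: (smooth_uptoS (C1 n)) => i.
have -> : cpartial i (ofreal (fun x : 'rV[R]_d => g n (a * x ord0 j + b))) =
    cst (if i == j then (a +i* 0)%C else 0) * ofreal (fun x : 'rV[R]_d => g n.+1 (a * x ord0 j + b)).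
  rewrite cpartial_ofreal; apply/funext => x.
  rewrite -[RHS]/((if i == j then (a +i* 0)%C else 0) * _).
  have [_ H] := dg' n x i; rewrite /ofreal H.
  case: eqP => _; last by rewrite mul0r.
  by apply: complexP; rewrite ?ReM ?ImM /= ?mulr0 ?mul0r ?subr0 ?addr0.
by apply: smooth_uptoM (IHm _); apply: smoothW; exact: smooth_cst.
Qed.

(** With y = 1 / x one has dy/dx = - y^2, so the derivative of p(y) e^(-y) in x is y^2 (p - p')(y)
    e^(-y). *)
Fixpoint flat_poly n : {poly R} :=
  if n is n'.+1 then 'X^2 * (flat_poly n' - (flat_poly n')^`()) else 1.

(* the n-th derivative of e^{-1/x} 1_{x > 0} *)
Definition flat n (x : R) : R :=
  if 0 < x then (flat_poly n).[x^-1] * expR (- x^-1) else 0.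

Lemma poly_growth (p : {poly R}) : exists C k, 0 <= C /\ forall y : R, 1 <= y -> `|p.[y]| <= C * y ^+ k.
Proof.
elim/poly_ind: p => [|p c [C [k [C0 IH]]]].
  by exists 0, 0%N; split=> // y _; rewrite horner0 normr0 mul0r.
exists (C + `|c|), k.+1; split=> [|y y1]; first exact: addr_ge0.
have y0 : 0 <= y by apply: le_trans y1.
rewrite hornerMXaddC (le_trans (ler_normD _ _))// mulrDl lerD//.
  by rewrite normrM (ger0_norm y0) exprSr mulrA ler_wpM2r ?IH.
by rewrite ler_peMr// exprn_ege1.
Qed.

Lemma expR_ge_pow m (y : R) : 0 <= y -> (y / m.+1%:R) ^+ m.+1 <= expR y.
Proof.
move=> y0; have m0 : 0 < m.+1%:R :> R by rewrite ltr0n.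
have -> : expR y = expR (y / m.+1%:R) ^+ m.+1.
  by rewrite -expRM_natl mulrC divfK// gt_eqF.
rewrite lerXn2r ?nnegrE ?divr_ge0 ?expR_ge0// ?ltW//.
by apply: lt_le_trans (expR_ge1Dx _); rewrite ltrDr.
Qed.

(** With k the growth exponent of [p], the exponential is bounded by a multiple of x^(k+2). The
    square left over is one power more than the difference quotient at 0 consumes. *)
Lemma flat_poly_decay (p : {poly R}) : exists2 C, 0 <= C &
  forall x : R, 0 < x <= 1 -> `|p.[x^-1] * expR (- x^-1)| <= C * x ^+ 2.
Proof.
have [C [k [C0 pC]]] := poly_growth p.
have m0 : 0 < k.+2%:R :> R by rewrite ltr0n.
exists (C * k.+2%:R ^+ k.+2) => [|x /andP[x0 x1]].
  by rewrite mulr_ge0// exprn_ge0// ltW.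
have y0 : 0 < x^-1 by rewrite invr_gt0.
have y1 : 1 <= x^-1 by rewrite invf_ge1.
rewrite normrM (ger0_norm (expR_ge0 _)) expRN.
have E := expR_ge_pow k.+1 (ltW y0).
apply: (@le_trans _ _ (C * x^-1 ^+ k * (x^-1 / k.+2%:R) ^- k.+2)).
  apply: ler_pM; rewrite ?normr_ge0 ?invr_ge0 ?expR_ge0 ?pC//.
  by rewrite lef_pV2 ?posrE ?expR_gt0 ?exprn_gt0 ?divr_gt0.
apply: eq_ler; rewrite expr_div_n invf_div.
have -> : x^-1 ^+ k.+2 = x^-1 ^+ k * x^-1 ^+ 2 by rewrite -exprD addn2.
have z0 : x^-1 ^+ k != 0 by rewrite expf_neq0// gt_eqF.
move: (_ ^+ k.+2) (x^-1 ^+ k) z0 => u z z0; rewrite !expr2; field.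
by rewrite z0 gt_eqF.
Qed.

Lemma is_derive_flat n (x : R) : is_derive x 1 (flat n) (flat n.+1 x).
Proof.
have [x0|x0|->] := ltgtP x 0.
- rewrite {2}/flat ltNge (ltW x0) /=.
  apply: near_eq_is_derive (is_derive_cst (0 : R) x (1 : R)).
  near=> y; rewrite /flat ltNge ltW//; near: y; exact: lt_nbhsl.
- rewrite {2}/flat x0 /=.
  suff H : is_derive x 1 (fun y => (flat_poly n).[y^-1] * expR (- y^-1))
      ((flat_poly n.+1).[x^-1] * expR (- x^-1)).
    apply: near_eq_is_derive H; near=> y.
    by rewrite /flat ifT//; near: y; exact: lt_nbhsr.
  have xn0 : x != 0 by rewrite gt_eqF.
  have dV : is_derive x 1 (fun y : R => y^-1) (- x ^- 2).
    have := is_deriveV xn0 (is_derive_id x (1 : R)).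
    by rewrite [_ *: _]mulr1.
  have dp := @is_derive1_comp _ (horner (flat_poly n)) _ x _ _ (is_derive_poly _ _) dV.
  have de := @is_derive1_comp _ (@expR R) (fun y : R => - y^-1) x _ _ (is_derive_expR _) (is_deriveN dV).
  have [H1 H2] := is_deriveM dp de; apply: (DeriveDef H1); rewrite {}H2.
  rewrite -![_ *: _]/(_ * _) /= !(hornerM, hornerD, hornerN, hornerXn, hornerX) !expr2.
  by field.
- rewrite {2}/flat ltxx.
  have [C C0 fC] := flat_poly_decay (flat_poly n).
  have H : h^-1 *: ((flat n \o shift 0) (h *: (1 : R)) - flat n 0) @[h --> (0 : R)^'] --> (0 : R).
    apply/cvgrPdist_le => e e0; near=> h.
    rewrite /= addr0 [h *: 1]mulr1 {2}/flat ltxx subr0 sub0r normrN /flat.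
    case: ifPn => [h0|_]; last by rewrite scaler0 normr0 ltW.
    rewrite -[_ *: _]/(_ * _) normrM normfV (gtr0_norm h0) mulrC ler_pdivrMr//.
    have h1 : `|h| <= 1 by near: h; apply: dnbhs0_le.
    rewrite (gtr0_norm h0) in h1.
    rewrite (le_trans (fC h _)) ?h0// expr2 mulrA ler_wpM2r ?(ltW h0)//.
    have : `|h| <= e / (C + 1) by near: h; apply: dnbhs0_le; rewrite divr_gt0// ltr_wpDl.
    rewrite (gtr0_norm h0) ler_pdivlMr ?ltr_wpDl// mulrDr mulr1 mulrC.
    by move=> H; apply: le_trans H; rewrite lerDl ltW.
  by split; [apply/cvg_ex; exists 0|exact: cvg_lim].
Unshelve. all: by end_near. Qed.

Lemma flat_gt0 (x : R) : 0 < x -> 0 < flat 0 x.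
Proof. by move=> x0; rewrite /flat x0 /= hornerC mul1r expR_gt0. Qed.

Lemma flat_le0 (x : R) : x <= 0 -> flat 0 x = 0.
Proof. by move=> x0; rewrite /flat ltNge x0. Qed.

Lemma flat_ge0 (x : R) : 0 <= flat 0 x.
Proof. by have [/flat_le0->//|/flat_gt0/ltW] := leP x 0. Qed.

Lemma ofrealD d (r s : 'rV[R]_d -> R) : ofreal r + ofreal s = ofreal (fun x => r x + s x).
Proof.
apply/funext => x; rewrite -[LHS]/(ofreal r x + ofreal s x).
by apply: complexP; rewrite ?ReD ?ImD /= ?addr0.
Qed.

(** A smooth descent from 1 to 0 between [a] and [b]; for a < b the two terms of the denominator
    never vanish together. *)
Definition step_down (a b y : R) : R := flat 0 (b - y) / (flat 0 (b - y) + flat 0 (y - a)).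

Lemma step_down_den (a b y : R) : a < b -> 0 < flat 0 (b - y) + flat 0 (y - a).
Proof.
move=> ab; have [yb|yb] := ltP y b.
  by rewrite ltr_pwDl ?flat_ge0// flat_gt0// subr_gt0.
by rewrite ltr_wpDl ?flat_ge0// flat_gt0// subr_gt0 (lt_le_trans ab).
Qed.

Lemma step_down_itv (a b y : R) : a < b -> 0 <= step_down a b y <= 1.
Proof.
move=> ab; have D := step_down_den y ab.
rewrite divr_ge0 ?flat_ge0 ?(ltW D)//=.
by rewrite ler_pdivrMr// mul1r lerDl flat_ge0.
Qed.

Lemma step_down1 (a b y : R) : a < b -> y <= a -> step_down a b y = 1.
Proof.
move=> ab ya; have := step_down_den y ab.
rewrite /step_down (@flat_le0 (y - a)) ?subr_le0// addr0 => D.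
by rewrite divff// gt_eqF.
Qed.

Lemma step_down0 (a b y : R) : b <= y -> step_down a b y = 0.
Proof. by move=> yb; rewrite /step_down flat_le0 ?mul0r// subr_le0. Qed.

Lemma smooth_step_down d (j : 'I_d) (a b s c : R) : a < b ->
  smooth (ofreal (fun x : 'rV[R]_d => step_down a b (s * x ord0 j + c))).
Proof.
move=> ab.
have S1 : smooth (ofreal (fun x : 'rV[R]_d => flat 0 (b - (s * x ord0 j + c)))).
  have := @smooth_coord d flat j (- s) (b - c) is_derive_flat.
  by congr smooth; apply/funext => x; rewrite /ofreal; congr (_ +i* _)%C; congr (flat 0 _); ring.
have S2 : smooth (ofreal (fun x : 'rV[R]_d => flat 0 (s * x ord0 j + c - a))).
  have := @smooth_coord d flat j s (c - a) is_derive_flat.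
  by congr smooth; apply/funext => x; rewrite /ofreal; congr (_ +i* _)%C; congr (flat 0 _); ring.
have S3 := smoothD S1 S2; rewrite ofrealD in S3.
have H := smoothM S1 (smooth_inv _ S3); rewrite ofrealM in H.
by apply: H => x; rewrite gt_eqF// step_down_den.
Qed.

(** Balls of the maximum norm are cubes, so a product over the coordinates works, with one descent
    for each sign of x_j - c_j. *)
Lemma smooth_bump d (c : 'rV[R]_d) (a b : R) : 0 < a < b ->
  exists chi : 'rV[R]_d -> R, [/\ smooth (ofreal chi),
    forall x, 0 <= chi x <= 1,
    forall x, `|x - c| <= a -> chi x = 1 &
    forall x, b <= `|x - c| -> chi x = 0].
Proof.
move=> /andP[a0 ab]; have b0 := lt_trans a0 ab.
pose T (j : 'I_d) (x : 'rV[R]_d) := step_down a b (1 * x ord0 j + - c ord0 j) *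
                   step_down a b (-1 * x ord0 j + c ord0 j).
have TE j x : T j x = step_down a b ((x - c) ord0 j) * step_down a b (- (x - c) ord0 j).
  by rewrite /T !mxE mul1r mulN1r opprB [- _ + _]addrC.
have Ts j : smooth (ofreal (T j)).
  by have := smoothM (smooth_step_down j 1 (- c ord0 j) ab) (smooth_step_down j (-1) (c ord0 j) ab);
    rewrite ofrealM.
have T01 j x : 0 <= T j x <= 1.
  have /andP[u1 u2] := step_down_itv ((x - c) ord0 j) ab.
  have /andP[v1 v2] := step_down_itv (- (x - c) ord0 j) ab.
  by rewrite TE mulr_ge0//= mulr_ile1.
exists (fun x => \prod_j T j x); split.
- have := @smooth_prod d _ (index_enum 'I_d) (fun j => ofreal (T j)) Ts.
  congr smooth; apply/funext => x.
  rewrite (big_morph (fun f : 'rV[R]_d -> R[i] => f x) (id1 := 1) (op1 := *%R))//.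
  elim: (index_enum _) => [|j r IH]; first by rewrite /ofreal !big_nil.
  rewrite /ofreal !big_cons IH; apply: complexP; rewrite ?ReM ?ImM /=;
    by rewrite ?mulr0 ?mul0r ?subr0 ?addr0.
- move=> x; apply/andP; split; first by apply: prodr_ge0 => j _; case/andP: (T01 j x).
  by apply: (@le_trans _ _ (\prod_(j < d) (1 : R))); [exact: ler_prod|rewrite big1].
- move=> x xa; apply: big1 => j _; rewrite TE.
  have := le_trans (coord_le_norm (x - c) j) xa; rewrite ler_norml => /andP[h1 h2].
  by rewrite !step_down1 ?mulr1// lerNl.
- move=> x bx.
  have [j bj] : exists j, b <= `|(x - c) ord0 j|.
    apply/existsP; apply: contraLR bx; rewrite negb_exists => /forallP H.
    rewrite -ltNge; apply: (@le_lt_trans _ _ (\big[Num.max/0]_j `|(x - c) ord0 j|)).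
      apply/rV_norm_leP => [|j]; first by elim/big_ind: _ => // u v u0 v0; rewrite le_max u0.
      exact: (@le_bigmax _ _ _ 0 (fun j => `|(x - c) ord0 j|) j).
    by apply: bigmax_lt => // j _; rewrite ltNge.
  rewrite (bigD1 j)//= TE; have [h|h] := leP 0 ((x - c) ord0 j).
    by rewrite (step_down0 _ (_ : b <= (x - c) ord0 j)) ?mul0r// -(ger0_norm h).
  by rewrite (@step_down0 _ _ (- _)) ?mulr0 ?mul0r// -(ltr0_norm h).
Qed.

Lemma cpartials_Re d s (f : 'rV[R]_d -> R[i]) :
  cpartials s (ofreal (fun x => Re (f x))) = ofreal (fun x => Re (cpartials s f x)).
Proof. by elim: s => [//|j s IHs] /=; rewrite IHs cpartial_ofreal. Qed.

Lemma cpartials_Im d s (f : 'rV[R]_d -> R[i]) :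
  cpartials s (ofreal (fun x => Im (f x))) = ofreal (fun x => Im (cpartials s f x)).
Proof. by elim: s => [//|j s IHs] /=; rewrite IHs cpartial_ofreal. Qed.

Lemma smooth_Re d (f : 'rV[R]_d -> R[i]) : smooth f -> smooth (ofreal (fun x => Re (f x))).
Proof. by move=> fs s x; rewrite cpartials_Re; case: (fs s x) => ? _ ? _; exact: C1_at_ofreal. Qed.

Lemma smooth_Im d (f : 'rV[R]_d -> R[i]) : smooth f -> smooth (ofreal (fun x => Im (f x))).
Proof. by move=> fs s x; rewrite cpartials_Im; case: (fs s x) => _ ? _ ?; exact: C1_at_ofreal. Qed.

Lemma smooth_local_inverse d (f : 'rV[R]_d -> R[i]) (c : 'rV[R]_d) (a b : R) : 0 < a < b ->
  smooth f -> (forall x, `|x - c| <= b -> f x != 0) ->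
  exists2 g, smooth g & forall x, `|x - c| <= a -> g x * f x = 1.
Proof.
move=> ab fs f0; have [chi [chis chi01 chi1 chi0]] := smooth_bump c ab.
(* The inverse will be conj f / D. Adding [1 - chi] to |f|^2 keeps D positive where [f] may vanish
   and changes nothing on the inner ball. *)
pose D x := Re (f x) * Re (f x) + Im (f x) * Im (f x) + (1 - chi x).
have N0 (z : R[i]) : z != 0 -> 0 < Re z * Re z + Im z * Im z.
  move=> z0; rewrite lt_neqAle addr_ge0 -?expr2 ?sqr_ge0// andbT eq_sym.
  rewrite paddr_eq0 ?sqr_ge0// !sqrf_eq0; apply: contra z0 => /andP[/eqP h1 /eqP h2].
  by apply/eqP; apply: complexP.
have D0 x : D x != 0.
  rewrite gt_eqF// /D; have /andP[h1 h2] := chi01 x.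
  have [xb|bx] := leP `|x - c| b.
    by rewrite ltr_pwDl ?subr_ge0// N0// f0.
  by rewrite ltr_wpDl ?addr_ge0 -?expr2 ?sqr_ge0// chi0 ?subr0// ltW.
have Ds : smooth (ofreal D).
  have := smoothD (smoothD (smoothM (smooth_Re fs) (smooth_Re fs))
    (smoothM (smooth_Im fs) (smooth_Im fs))) (smoothD (@smooth_cst R d 1) (smoothN chis)).
  rewrite !ofrealM !ofrealD; congr smooth; apply/funext => x.
  by apply: complexP; rewrite /D /= ?ReD ?ImD /= ?oppr0 ?addr0.
exists ((ofreal (fun x => Re (f x)) + cst (0 -i* 1)%C * ofreal (fun x => Im (f x))) *
    ofreal (fun x => (D x)^-1)).
  apply: smoothM (smooth_inv D0 Ds); apply: smoothD (smooth_Re fs) _.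
  by apply: smoothM (smooth_Im fs); exact: smooth_cst.
move=> x xa.
rewrite -[X in X * _]/((ofreal (fun x => Re (f x)) x +
   (0 -i* 1)%C * ofreal (fun x => Im (f x)) x) * ofreal (fun x => (D x)^-1) x).
have := D0 x; rewrite /ofreal /D !(chi1 x xa) !subrr !addr0.
case: (f x) => u v /= uv0.
apply: complexP; rewrite !(ReM, ImM, ReD, ImD) /=; by field.
Qed.

End SmoothConstructions.

(** * Multiplication and translation of microlocal regularity *)

Section Microlocal.
Variable R : realType.

Lemma japanese_ge1 d (x : 'rV[R]_d) : 1 <= japanese x.
Proof.
rewrite /japanese -{1}sqrtr1 ler_sqrt ?lerDl ?addr_ge0 ?ler01// sumr_ge0// => j _;
by rewrite -expr2 sqr_ge0.
Qed.

Lemma japanese_lower d (x : 'rV[R]_d) : 1 + `|x| <= 2 * japanese x.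
Proof.
have j1 := japanese_ge1 x.
have : `|x| <= japanese x.
  apply/rV_norm_leP => [|j]; first exact: le_trans j1.
  rewrite -sqrtr_sqr /japanese ler_sqrt.
    rewrite /dot (bigD1 j)//= -expr2 addrCA lerDl addr_ge0 ?sumr_ge0// => i _.
    by rewrite -expr2 sqr_ge0.
  by rewrite addr_ge0// sumr_ge0// => i _; rewrite -expr2 sqr_ge0.
by lra.
Qed.

Lemma japanese_upper d (x : 'rV[R]_d) : japanese x <= d.+1%:R * (1 + `|x|).
Proof.
have X0 : 0 <= 1 + d%:R * `|x| by rewrite addr_ge0// mulr_ge0.
apply: (@le_trans _ _ (1 + d%:R * `|x|)); last first.
  rewrite -[d.+1%:R]natr1; have := normr_ge0 x; have := ler0n R d.
  move: (d%:R) `|x| => a b; lra.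
rewrite -[leRHS]ger0_norm// -sqrtr_sqr /japanese ler_sqrt ?sqr_ge0//.
have : dot x x <= d%:R * `|x| ^+ 2.
  rewrite mulr_natl -[X in _ *+ X]card_ord -sumr_const; apply: ler_sum => j _.
  by rewrite -expr2 -[leLHS]real_normK ?num_real// lerXn2r ?nnegrE ?coord_le_norm.
move=> H; rewrite sqrrD expr1n mul1r -addrA lerD2l (le_trans H)//.
move: `|x| (normr_ge0 x) {X0 H} => y y0; case: d {x} => [|d']; first by rewrite !mul0r mul0rn add0r sqr_ge0.
rewrite exprMn ler_wpDl ?mulrn_wge0 ?mulr_ge0// ler_wpM2r ?sqr_ge0//.
by rewrite expr2 ler_peMr// ler1n.
Qed.

(** [japanese xi] and 1 + |xi| are comparable up to constants depending on d, and [japanese xi >= 1]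
    allows a real exponent to be raised to an integer one. *)
Lemma bigO_japanese d (Gamma : set 'rV[R]_d) (F : R -> 'rV[R]_d -> R) (g : R -> R) :
  (forall e x, 0 <= F e x) ->
  (forall l : R, bigO_on Gamma (fun e xi => japanese xi `^ l * F e xi) g) <->
  (forall q : nat, bigO_on Gamma (fun e xi => (1 + `|xi|) ^+ q * F e xi) g).
Proof.
move=> F0; split=> [H q|H l].
  have [C C0 HC] := H q%:R; exists (2 ^+ q * C); first by rewrite mulr_gt0 ?exprn_gt0.
  apply: filterS HC => e HC x Gx; have j1 := japanese_ge1 x.
  rewrite -mulrA; apply: (@le_trans _ _ (2 ^+ q * (japanese x `^ q%:R * F e x))); last first.
    by rewrite ler_pM2l ?exprn_gt0// HC.
  rewrite mulrA ler_wpM2r// powR_mulrn; last exact: le_trans j1.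
  rewrite -exprMn lerXn2r ?nnegrE ?addr_ge0 ?mulr_ge0 ?japanese_lower//.
  exact: le_trans j1.
have [q lq] : exists q : nat, l <= q%:R.
  by exists (Num.truncn `|l|).+1; case/andP: (truncn_itv (normr_ge0 l)) => _ /ltW; apply: le_trans; exact: ler_norm.
have [C C0 HC] := H q; exists (d.+1%:R ^+ q * C); first by rewrite mulr_gt0 ?exprn_gt0.
apply: filterS HC => e HC x Gx; have j1 := japanese_ge1 x.
rewrite -mulrA; apply: (@le_trans _ _ (d.+1%:R ^+ q * ((1 + `|x|) ^+ q * F e x))); last first.
  by rewrite ler_pM2l ?exprn_gt0 ?ltr0n// HC.
rewrite mulrA ler_wpM2r// (le_trans (ler_powR j1 lq))// powR_mulrn; last exact: le_trans j1.
rewrite -exprMn lerXn2r ?nnegrE ?mulr_ge0 ?addr_ge0 ?japanese_upper//.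
exact: le_trans j1.
Qed.

Lemma subcone d (Gamma : set 'rV[R]_d) (xi0 : 'rV[R]_d) : conic Gamma -> nbhs xi0 Gamma ->
  exists Gamma' : set 'rV[R]_d, exists c : R,
  [/\ conic Gamma', nbhs xi0 Gamma', 0 < c <= 2^-1 &
      forall xi eta, Gamma' xi -> `|eta - xi| <= c * `|xi| -> Gamma eta].
Proof.
move=> Gc /nbhs_ballP[r /= r0 Gr].
(* The cone over the ball of radius r / 2 about [xi0]. The constant [c] makes c |xi| at most la * r
   / 2 on it; c <= 1/2 later keeps |eta| comparable to |xi|. *)
exists [set xi | exists2 la : R, 0 < la & `|xi - la *: xi0| < la * (r / 2)].
pose c := Num.min 2^-1 (r / 2 / (`|xi0| + r)).
have X0 : 0 < `|xi0| + r by rewrite ltr_wpDl.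
exists c; split.
- move=> la xi la0 [mu mu0 xm]; exists (la * mu); first exact: mulr_gt0.
  by rewrite -scalerA -scalerBr normrZ gtr0_norm// -mulrA ltr_pM2l.
- apply/nbhs_ballP; exists (r / 2); first by rewrite /= divr_gt0.
  move=> x; rewrite -ball_normE /= => xr; exists 1 => //.
  by rewrite scale1r mul1r distrC.
- by rewrite lt_min invr_gt0 ltr0n divr_gt0 ?divr_gt0//= ge_min lexx.
- move=> xi eta [la la0 xla] exi.
  have xin : `|xi| <= la * (`|xi0| + r).
    rewrite -[xi](subrK (la *: xi0)) (le_trans (ler_normD _ _))// addrC mulrDr.
    rewrite normrZ gtr0_norm// lerD2l (le_trans (ltW xla))// ler_pM2l//.
    by move: r0; lra.
  have e1 : `|eta - la *: xi0| < la * r.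
    rewrite -(subrK xi eta) -addrA (le_lt_trans (ler_normD _ _))//.
    rewrite (_ : la * r = la * (r / 2) + la * (r / 2)); last by field.
    rewrite ler_ltD// (le_trans exi)//.
    apply: (@le_trans _ _ (r / 2 / (`|xi0| + r) * (la * (`|xi0| + r)))).
      by apply: ler_pM => //; rewrite ?le_min ?ge_min ?lexx ?orbT// ?invr_ge0 ?divr_ge0 ?ltW.
    by rewrite mulrCA mulrA -[leLHS]mulrA divfK ?gt_eqF.
  have -> : eta = la *: (la^-1 *: eta) by rewrite scalerA divff ?scale1r// gt_eqF.
  apply: Gc => //; apply: Gr; rewrite -ball_normE /= distrC.
  have -> : la^-1 *: eta - xi0 = la^-1 *: (eta - la *: xi0).
    by rewrite scalerBr scalerA mulVf ?scale1r// gt_eqF.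
  by rewrite normrZ gtr0_norm ?invr_gt0// ltr_pdivrMl.
Qed.

Lemma exprV_ge0 (P : nat) (e : R) : 0 < e <= 1 -> 0 <= e ^- P.
Proof. by move=> /andP[e0 _]; rewrite invr_ge0 exprn_ge0// ltW. Qed.

(** [fourier_mul_bound] is used with rho = c |xi|. Frequencies below rho keep the argument in
    [Gamma], where the transform of [f] decays. For the others the coefficients of [psi] decay like
    a power of 1 + |xi|, against the crude bound of order [Q] on [f]. The final exponent is
    independent of [q] because [P] is the same for all derivatives of [psi]. *)
Lemma fourier_mul_decay d (Gamma : set 'rV[R]_d) (xi0 : 'rV[R]_d) (psi f : R -> 'rV[R]_d -> R[i])
    (M : R) (N P Q : nat) :
  0 < M -> conic Gamma -> nbhs xi0 Gamma ->
  (forall e, 0 < e <= 1 -> smooth (psi e)) ->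
  (forall e, 0 < e <= 1 -> forall x : 'rV[R]_d, M < `|x| -> psi e x = 0) ->
  (forall s, bigO_on setT (fun e x => normc (cpartials s (psi e) x)) (fun e => e ^- P)) ->
  (forall e, 0 < e <= 1 -> Ccc M (f e)) ->
  bigO_on setT (fun e x => normc (f e x)) (fun e => e ^- Q) ->
  (forall q, bigO_on Gamma (fun e xi => (1 + `|xi|) ^+ q * normc (fourier (f e) xi))
     (fun e => e ^- N)) ->
  exists Gamma' : set 'rV[R]_d, [/\ conic Gamma', nbhs xi0 Gamma' &
    forall q, bigO_on Gamma' (fun e xi => (1 + `|xi|) ^+ q *
      normc (fourier (psi e * f e) xi)) (fun e => e ^- (P + maxn N Q))].
Proof.
move=> M0 Gc Gn psis psi0 psib fc fb fG.
have [Gamma' [c [Gc' Gn' /andP[c0 c2] GG]]] := subcone Gc Gn.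
exists Gamma'; split=> // q.
pose p := (2 * d + q.+1)%N.
have [C1 C10 H1] := psib [::].
have [C2 C20 H2] : exists2 C2, 0 < C2 & \forall e \near 0^'+, forall j x,
    normc (cpartials (nseq p j) (psi e) x) <= C2 * e ^- P.
  have [C HC] := choice (fun j => let: ex_intro2 C C0 H := psib (nseq p j) in
    ex_intro (fun C => 0 < C /\ _) C (conj C0 H)).
  have S0 : 0 <= \sum_j C j by rewrite sumr_ge0// => j _; rewrite ltW//; case: (HC j).
  exists (1 + \sum_j C j); first exact: ltr_pwDl.
  have Hn : \forall e \near (0 : R)^'+, forall j x, [set: 'rV[R]_d] x ->
      normc (cpartials (nseq p j) (psi e) x) <= C j * e ^- P.
    by apply: filter_forall => j; case: (HC j).
  apply: filterS (filterI (near0_itv R) Hn) => e [e01 H] j x; apply: le_trans (H j x I) _.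
  rewrite ler_wpM2r ?exprV_ge0// (bigD1 j)//= addrCA lerDl addr_ge0// sumr_ge0// => i _.
  by rewrite ltW//; case: (HC i).
have [CS CS0 HS] := fb.
have [CG CG0 HG] := fG q.
pose kappa := pi / (2 * M).
have kappa0 : 0 < kappa by rewrite divr_gt0 ?pi_gt0 ?mulr_gt0.
(* Chosen so that c' (1 + |xi|) <= 1 + c |xi| / kappa. *)
pose c' := Num.min 1 (c / kappa).
have c'0 : 0 < c' by rewrite lt_min ltr01 divr_gt0.
pose A := decay_const M p * (C1 + C2) * 4 ^+ d.
pose V := 2 * ((2 * M) ^+ d * CS) * c' ^- q.+1.
have V0 : 0 <= V.
  by rewrite mulr_ge0 ?invr_ge0 ?exprn_ge0 ?(ltW c'0)// mulr_ge0// mulr_ge0 ?exprn_ge0 ?mulr_ge0 ?ltW.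
pose T := CG * 2 ^+ q + V.
have T0 : 0 <= T by rewrite addr_ge0// mulr_ge0 ?exprn_ge0// ltW.
exists (`|A| * T + 1); first by rewrite ltr_wpDl// mulr_ge0.
near=> e => xi Gxi.
have e01 : 0 < e <= 1 by near: e; exact: near0_itv.
have e0 : 0 < e by case/andP: e01.
have eP n : 0 <= e ^- n by rewrite invr_ge0 exprn_ge0// ltW.
have y1 : 1 <= 1 + `|xi| by rewrite lerDl.
have y0 : 0 < 1 + `|xi| by apply: lt_le_trans y1.
(* Bound for the transform of [f] near [xi]: |eta - xi| <= |xi| / 2 gives 1 + |xi| <= 2 (1 + |eta|),
   hence the factor 2^q. *)
pose G := CG * e ^- N * (2 ^+ q * (1 + `|xi|) ^- q).
have H1e : forall x, setT x -> normc (cpartials [::] (psi e) x) <= C1 * e ^- P by near: e.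
have H2e : forall j x, normc (cpartials (nseq p j) (psi e) x) <= C2 * e ^- P by near: e.
have HSe : forall x, setT x -> normc (f e x) <= CS * e ^- Q by near: e.
have HGe : forall xi, Gamma xi -> (1 + `|xi|) ^+ q * normc (fourier (f e) xi) <= CG * e ^- N by near: e.
have := @fourier_mul_bound R d M q ((C1 + C2) * e ^- P) (CS * e ^- Q) G (c * `|xi|)
  (psi e) (f e) xi M0 (psis e e01) (psi0 e e01) _ _ (fc e e01) _ _ _ _.
move=> H; have {H} : normc (fourier (psi e * f e) xi) <=
   decay_const M p * ((C1 + C2) * e ^- P) * 4 ^+ d *
   (G + 2 * ((2 * M) ^+ d * (CS * e ^- Q)) * (1 + c * `|xi| / kappa) ^- q.+1).
  apply: H.
  - move=> x; apply: le_trans (H1e x I) _; rewrite ler_wpM2r// lerDl ltW//.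
  - move=> j x; apply: le_trans (H2e j x) _; rewrite ler_wpM2r// lerDr ltW//.
  - by move=> x; exact: HSe.
  - by rewrite mulr_ge0// ltW.
  - by rewrite mulr_ge0 ?mulr_ge0 ?(ltW CG0) ?eP ?exprn_ge0.
  - move=> eta He; have := HGe eta (GG _ _ Gxi He).
    have X0 : 0 < 1 + `|eta| by rewrite ltr_pwDl.
    rewrite mulrC -ler_pdivlMr ?exprn_gt0// => /le_trans; apply.
    rewrite /G ler_wpM2l ?mulr_ge0 ?(ltW CG0)//.
    rewrite -exprVn -exprVn -exprMn lerXn2r ?nnegrE ?invr_ge0 ?mulr_ge0 ?(ltW X0) ?(ltW y0)//.
    rewrite ler_pdivlMr// mulrC ler_pdivrMr//.
    have := ler_normD eta (xi - eta); rewrite subrKC [`|xi - eta|]distrC => h1.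
    have h2 : c * `|xi| <= 2^-1 * `|xi| by rewrite ler_wpM2r.
    by move: h1 h2 He; lra.
rewrite -/p (_ : _ * 4 ^+ d = A * e ^- P); last by rewrite /A; ring.
set D := (1 + _) ^- q.+1 => H.
have D1 : D <= c' ^- q.+1 * (1 + `|xi|) ^- q.
  have Y0 : 0 < c' * (1 + `|xi|) by rewrite mulr_gt0.
  apply: (@le_trans _ _ ((c' * (1 + `|xi|)) ^- q.+1)).
    have cy : c' * (1 + `|xi|) <= 1 + c * `|xi| / kappa.
      rewrite mulrDr mulr1 lerD//; first by rewrite ge_min lexx.
      by rewrite mulrAC ler_wpM2r// ge_min lexx orbT.
    rewrite /D lef_pV2 ?posrE ?exprn_gt0//; last exact: lt_le_trans cy.
    by rewrite lerXn2r ?nnegrE ?(ltW Y0)// (le_trans (ltW Y0)).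
  rewrite exprMn invfM ler_wpM2l ?invr_ge0 ?exprn_ge0 ?(ltW c'0)//.
  rewrite lef_pV2 ?posrE ?exprn_gt0//.
  by rewrite exprS ler_peMl// exprn_ge0 ?ltW.
have NM : e ^- N <= e ^- maxn N Q by rewrite exprV_le_mono// leq_maxl.
have QM : e ^- Q <= e ^- maxn N Q by rewrite exprV_le_mono// leq_maxr.
have yq : (1 + `|xi|) ^+ q * (1 + `|xi|) ^- q = 1 by rewrite divff// expf_neq0// gt_eqF.
have yq0 : 0 <= (1 + `|xi|) ^+ q by rewrite exprn_ge0// ltW.
apply: (@le_trans _ _ ((1 + `|xi|) ^+ q * (A * e ^- P * (G + 2 * ((2 * M) ^+ d * (CS * e ^- Q)) * D)))).
  by rewrite ler_wpM2l.
apply: (@le_trans _ _ (`|A| * e ^- P * (CG * 2 ^+ q * e ^- N + V * e ^- Q))).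
  have MS n : 0 <= 2 * ((2 * M) ^+ d * (CS * e ^- n)).
    by rewrite mulr_ge0// mulr_ge0 ?exprn_ge0 ?mulr_ge0 ?(ltW M0) ?(ltW CS0).
  have D0 : 0 <= D.
    rewrite invr_ge0 exprn_ge0// addr_ge0//.
    exact: divr_ge0 (mulr_ge0 (ltW c0) (normr_ge0 _)) (ltW kappa0).
  have G0 : 0 <= G.
    by rewrite mulr_ge0 ?mulr_ge0 ?exprn_ge0 ?(ltW CG0)// invr_ge0 exprn_ge0// ltW.
  rewrite mulrCA; apply: (@le_trans _ _ (`|A| * e ^- P * ((1 + `|xi|) ^+ q *
      (G + 2 * ((2 * M) ^+ d * (CS * e ^- Q)) * D)))).
    apply: ler_wpM2r; first exact: mulr_ge0 yq0 (addr_ge0 G0 (mulr_ge0 (MS Q) D0)).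
    exact: ler_wpM2r (eP P) _ _ (ler_norm A).
  - apply: ler_wpM2l; first exact: mulr_ge0 (normr_ge0 _) (eP P).
    rewrite mulrDr lerD//.
      rewrite /G mulrCA [_ * (2 ^+ q * _)]mulrCA yq mulr1.
      by apply: eq_ler; ring.
    apply: (@le_trans _ _ ((1 + `|xi|) ^+ q * (2 * ((2 * M) ^+ d * (CS * e ^- Q)) *
       (c' ^- q.+1 * (1 + `|xi|) ^- q)))).
      exact: ler_wpM2l yq0 _ _ (ler_wpM2l (MS Q) D1).
    rewrite mulrCA [_ * (c' ^- _ * _)]mulrCA yq mulr1 /V.
    by apply: eq_ler; ring.
rewrite exprD invfM.
apply: (@le_trans _ _ (`|A| * e ^- P * (T * e ^- maxn N Q))).
  rewrite ler_wpM2l ?mulr_ge0// /T mulrDl lerD// ler_wpM2l//.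
  by rewrite mulr_ge0 ?exprn_ge0 ?(ltW CG0).
rewrite mulrACA ler_wpM2r ?mulr_ge0 ?eP//.
by rewrite lerDl.
Unshelve. all: by end_near. Qed.

Lemma cpartials_eq_open d (U : set 'rV[R]_d) (f g : 'rV[R]_d -> R[i]) s : open U ->
  (forall x, U x -> f x = g x) -> forall x, U x -> cpartials s f x = cpartials s g x.
Proof.
move=> Uo fg; elim: s => [//|j s IHs] x Ux /=; rewrite /cpartial.
have H : \near x, cpartials s f x = cpartials s g x.
  by near=> y; apply: IHs; near: y; exact: open_nbhs_nbhs.
by congr (_ +i* _)%C; apply: near_eq_derive; apply: filterS H => y ->.
Unshelve. all: by end_near. Qed.

Lemma open_norm_gt d (M : R) : open [set x : 'rV[R]_d | M < `|x|].
Proof.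
apply: (@open_comp _ _ (fun x : 'rV[R]_d => `|x|) [set y | M < y]) => [x _|].
  exact: norm_continuous.
exact: open_gt.
Qed.

Lemma cpartials0 d s : cpartials s (fun _ : 'rV[R]_d => 0 : R[i]) = fun=> 0.
Proof. by rewrite -[X in cpartials s X]/(cst 0) cpartials_cst if_same. Qed.

Lemma cpartials_vanish d (M : R) (f : 'rV[R]_d -> R[i]) s :
  (forall x : 'rV[R]_d, M < `|x| -> f x = 0) ->
  forall x : 'rV[R]_d, M < `|x| -> cpartials s f x = 0.
Proof.
move=> f0 x Mx; have := @cpartials_eq_open d _ f (fun=> 0) s (@open_norm_gt d M) f0 x Mx.
by rewrite cpartials0.
Qed.

Lemma compact_bound d (K : set 'rV[R]_d) (f : 'rV[R]_d -> R[i]) : compact K ->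
  smooth f -> exists2 B : R, 0 < B & forall x, K x -> normc (f x) <= B.
Proof.
move=> Kc fs.
have bd (g : 'rV[R]_d -> R) : continuous g -> exists2 B : R, 0 < B & forall x, K x -> `|g x| <= B.
  move=> gc; have : compact (g @` K).
    by apply: continuous_compact => //; exact: continuous_subspaceT.
  move=> /compact_bounded[B [_ HB]]; exists (`|B| + 1); first by rewrite ltr_wpDl.
  by move=> x Kx; apply: (HB (`|B| + 1)); [rewrite ltr_pwDr// ler_norm|exists x].
have [B1 B10 H1] : exists2 B : R, 0 < B & forall x, K x -> `|Re (f x)| <= B.
  by apply: bd => x; case: (smooth_C1 x fs).
have [B2 B20 H2] : exists2 B : R, 0 < B & forall x, K x -> `|Im (f x)| <= B.
  by apply: bd => x; case: (smooth_C1 x fs).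
exists (B1 + B2); first exact: addr_gt0.
by move=> x Kx; rewrite (le_trans (normc_le _))// lerD ?H1 ?H2.
Qed.

Lemma smooth_cpartials d s (f : 'rV[R]_d -> R[i]) : smooth f -> smooth (cpartials s f).
Proof. by move=> fs; elim: s => [//|j s IHs]; exact: smooth_partial. Qed.

Lemma cpartials_bound d (M : R) (f : 'rV[R]_d -> R[i]) s : smooth f ->
  (forall x : 'rV[R]_d, M < `|x| -> f x = 0) ->
  exists2 B : R, 0 < B & forall x, normc (cpartials s f x) <= B.
Proof.
move=> fs f0.
have [B B0 HB] := compact_bound (@compact_ball R d M) (smooth_cpartials s fs).
exists B => // x; have [xM|Mx] := leP `|x| M; first exact: HB.
by rewrite (cpartials_vanish _ f0)// normc0 ltW.
Qed.

(** Leibniz rule by induction on the derivatives; [g] is independent of [e], so it affects the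
    constants but not the rate. *)
Lemma bigO_smoothM d (K : set 'rV[R]_d) (g : 'rV[R]_d -> R[i]) (v : R -> 'rV[R]_d -> R[i])
    (r : R -> R) :
  smooth g -> (forall s, exists2 B : R, 0 < B & forall x, K x -> normc (cpartials s g x) <= B) ->
  smooth_net v -> (forall s, bigO_on K (fun e x => normc (cpartials s (v e) x)) r) ->
  forall s, bigO_on K (fun e x => normc (cpartials s (g * v e) x)) r.
Proof.
move=> gs gb vs vb s; elim/last_ind: s g v gs gb vs vb => [|s j IHs] g v gs gb vs vb.
  have [B B0 HB] := gb [::]; have [C C0 HC] := vb [::].
  exists (B * C); first exact: mulr_gt0.
  apply: filterS HC => e HC x Kx; rewrite /= -[(g * v e) x]/(g x * v e x) normcM -mulrA.
  by apply: ler_pM; rewrite ?normc_ge0 ?HB ?HC.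
apply: (@boundM_rcons R d K s j (fun=> g) v r _ vs); first by move=> e _.
- apply: (IHs (cpartial j g) v (smooth_partial j gs) _ vs vb).
  by move=> s'; have := gb (rcons s' j); rewrite cpartials_rcons.
- apply: (IHs g (partial_net j v) gs gb (smooth_net_partial j vs)).
  by move=> s'; have := vb (rcons s' j); under eq_fun do under eq_fun do rewrite cpartials_rcons.
Qed.

Lemma bigO_on_setT d (M : R) (v : R -> 'rV[R]_d -> R[i]) (r : R -> R) s :
  (forall e, 0 < e <= 1 -> 0 <= r e) ->
  (forall e, 0 < e <= 1 -> forall x : 'rV[R]_d, M < `|x| -> v e x = 0) ->
  bigO_on [set x : 'rV[R]_d | `|x| <= M] (fun e x => normc (cpartials s (v e) x)) r ->
  bigO_on setT (fun e x => normc (cpartials s (v e) x)) r.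
Proof.
move=> r0 v0 [C C0 HC]; exists C => //; apply: filterS (filterI (near0_itv R) HC) => e [e01 He] x _.
have [xM|Mx] := leP `|x| M; first exact: He.
by rewrite (cpartials_vanish _ (v0 e e01))// normc0 mulr_ge0 ?r0// ltW.
Qed.

Lemma compact_norm_bound d (K : set 'rV[R]_d) : compact K ->
  exists2 M : R, 0 < M & forall x, K x -> `|x| <= M.
Proof.
move=> /compact_bounded[B [_ HB]]; exists (`|B| + 1); first by rewrite ltr_wpDl.
by move=> x Kx; apply: (HB (`|B| + 1)) => //; rewrite ltr_pwDr// ler_norm.
Qed.

Lemma gclassM d (a b a' b' : mnet R d) : gclass a = gclass a' -> gclass b = gclass b' ->
  gclass (a * b) = gclass (a' * b').
Proof.
move=> /gclassP ha /gclassP hb; apply/gclassP.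
have -> : a * b - a' * b' = a * (b - b') + b' * (a - a') by ring.
apply: negligible_boundD.
- exact: mnet_smooth (a * (b - b')).
- exact: mnet_smooth (b' * (a - a')).
- exact: negligible_boundM (mnetP a) (@mnet_smooth _ _ (b - b')) hb.
- exact: negligible_boundM (mnetP b') (@mnet_smooth _ _ (a - a')) ha.
Qed.

Lemma bigO_cutoff d (M : R) (phi : 'rV[R]_d -> R[i]) (w : mnet R d) : smooth phi ->
  (forall e, forall x : 'rV[R]_d, M < `|x| -> (phi * w e) x = 0) ->
  exists Q : nat, bigO_on setT (fun e x => normc ((phi * w e) x)) (fun e => e ^- Q).
Proof.
move=> phis f0; have [_ /(_ _ (@compact_ball R d M) [::])[Q [C C0 HC]]] := moderateP _ (mnetP w).
have [B B0 HB] := compact_bound (@compact_ball R d M) phis.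
exists Q; apply: (@bigO_on_setT _ M (fun e => phi * w e) _ [::]) => [e|e _|];
  [exact: exprV_ge0|exact: f0|].
exists (B * C); first exact: mulr_gt0.
apply: filterS HC => e HC x Kx; rewrite /= -[(phi * w e) x]/(phi x * w e x) normcM -mulrA.
by apply: ler_pM; rewrite ?normc_ge0 ?HB ?(HC x).
Qed.

Lemma micro_regularP d (v : colombeau R d) x0 xi0 : micro_regular v x0 xi0 <->
  exists w : mnet R d, exists phi : 'rV[R]_d -> R[i],
  exists Gamma : set 'rV[R]_d, exists N : nat,
  [/\ gclass w = v, test_function phi /\ phi x0 = 1,
      conic Gamma /\ nbhs xi0 Gamma &
      forall q : nat,
        bigO_on Gamma
          (fun e xi => (1 + `|xi|) ^+ q * normc (fourier (phi * w e) xi))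
          (fun e => e ^- N)].
Proof.
have J (G : set 'rV[R]_d) phi (w : mnet R d) N := @bigO_japanese d G
  (fun e xi => normc (fourier (phi * w e) xi)) (fun e => e ^- N) (fun e xi => normc_ge0 _).
split=> -[w [phi [G [N [h1 h2 h3 h4]]]]]; exists w, phi, G, N; split=> //; exact/J.
Qed.

(** The exponent [P] is common to all compact sets and all derivatives, otherwise the exponent of
    the product could grow with the power of [xi]. *)
Lemma micro_regular_mul d (w psi : mnet R d) (P : nat) x0 xi0 :
  (forall K : set 'rV[R]_d, compact K -> forall s,
    bigO_on K (fun e x => normc (cpartials s (psi e) x)) (fun e => e ^- P)) ->
  micro_regular (gclass w) x0 xi0 -> micro_regular (gclass (psi * w)) x0 xi0.
Proof.
move=> psib /micro_regularP[w' [phi [Gamma [N [ww' [[phis [K Kc K0]] phi1] [Gc Gn] Gb]]]]].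
have [M M0 KM] := compact_norm_bound Kc.
have phi0 (x : 'rV[R]_d) : M < `|x| -> phi x = 0.
  by move=> Mx; apply: K0 => /KM; rewrite leNgt Mx.
have MM : 0 < M < M + 1 by rewrite M0 ltrDl ltr01.
(* The product estimate asks for a compactly supported factor. As [chi] is 1 on the support of
   [phi], it can be inserted next to [psi]. *)
have [chi [chis _ chi1 chi0]] := @smooth_bump R d 0 M (M + 1) MM.
pose Psi e := ofreal chi * psi e.
have Psi0 e (x : 'rV[R]_d) : M + 1 < `|x| -> Psi e x = 0.
  move=> Mx; rewrite -[Psi e x]/(ofreal chi x * psi e x) /ofreal.
  by rewrite chi0 ?subr0 ?(ltW Mx)// -[(0 +i* 0)%C]/(0 : R[i]) mul0r.
have psis : smooth_net psi := @mnet_smooth _ _ psi.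
have Psis e : 0 < e <= 1 -> smooth (Psi e) by move=> e01; exact: smoothM chis (psis e e01).
have Psib s : bigO_on setT (fun e x => normc (cpartials s (Psi e) x)) (fun e => e ^- P).
  apply: (@bigO_on_setT _ (M + 1)) => [e||]; first exact: exprV_ge0.
    by move=> e _; exact: Psi0.
  apply: (bigO_smoothM chis _ psis (psib _ (@compact_ball R d (M + 1)))) => s'.
  have [|B B0 HB] := @cpartials_bound d (M + 1) (ofreal chi) s' chis.
    by move=> x Mx; rewrite /ofreal chi0 ?subr0 ?(ltW Mx).
  by exists B.
pose f e := phi * w' e.
have f0 e (x : 'rV[R]_d) : M + 1 < `|x| -> f e x = 0.
  move=> Mx; rewrite -[f e x]/(phi x * w' e x) phi0 ?mul0r//.
  by apply: lt_trans Mx; rewrite ltrDl.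
have fc e : 0 < e <= 1 -> Ccc (M + 1) (f e).
  by move=> e01; apply: smooth_Ccc (f0 e); exact: smoothM phis (@mnet_smooth _ _ w' e e01).
have [Q fb] := bigO_cutoff phis f0.
have M10 : 0 < M + 1 by rewrite addr_gt0.
have [G' [Gc' Gn' Gb']] := fourier_mul_decay M10 Gc Gn Psis (fun e _ => Psi0 e) Psib fc fb Gb.
apply/micro_regularP; exists (psi * w'), phi, G', (P + maxn N Q)%N; split.
- exact: gclassM.
- by split=> //; split=> //; exists K.
- by [].
- move=> q; have [C C0 HC] := Gb' q; exists C => //.
  apply: filterS HC => e HC xi Gxi; have -> : phi * (psi * w') e = Psi e * f e; last exact: HC.
  apply/funext => x.
  rewrite -[LHS]/(phi x * (psi e x * w' e x)) -[RHS]/(ofreal chi x * psi e x * (phi x * w' e x)).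
  have [xM|Mx] := leP `|x| M; last by rewrite phi0// !mul0r mulr0.
  rewrite /ofreal chi1 ?subr0// -[(1 +i* 0)%C]/(1 : R[i]) mul1r; ring.
Qed.

(** Convergence of the shifts keeps the translates of a compact set in one ball for small [e]. *)
Lemma moderate_translation d (u : R -> 'rV[R]_d -> R[i]) (c : R -> 'rV[R]_d) (c0 : 'rV[R]_d) :
  c e @[e --> 0^'+] --> c0 -> u \in moderate R d ->
  (fun e x => u e (x - c e)) \in moderate R d.
Proof.
move=> cc /moderateP[us um]; apply/moderateP; split.
  by move=> e e01; exact: smooth_translation (us e e01).
move=> K Kc s; have [M M0 KM] := compact_norm_bound Kc.
have [N [C C0 HC]] := um _ (@compact_ball R d (M + (`|c0| + 1))) s.
exists N, C => //; near=> e => x Kx.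
rewrite (cpartials_translation s (u e) (- c e)).
have ce : `|c e - c0| <= 1.
  near: e; have /cvgrPdist_le/(_ 1 ltr01) := cc; apply: filterS => e.
  by rewrite distrC.
apply: (near HC e) => //=; rewrite (le_trans (ler_normB _ _))// lerD ?KM//.
by rewrite -(subrK c0 (c e)) (le_trans (ler_normD _ _))// addrC lerD2l.
Unshelve. all: by end_near. Qed.

Lemma negligible_translation d (u : mnet R d) (c : R -> 'rV[R]_d) (c0 : 'rV[R]_d) :
  c e @[e --> 0^'+] --> c0 -> negligible_bound u ->
  negligible_bound (fun e x => u e (x - c e)).
Proof.
move=> cc un K Kc s q; have [M M0 KM] := compact_norm_bound Kc.
have [C C0 HC] := un _ (@compact_ball R d (M + (`|c0| + 1))) s q.
exists C => //; near=> e => x Kx.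
rewrite (cpartials_translation s (u e) (- c e)).
have ce : `|c e - c0| <= 1.
  near: e; have /cvgrPdist_le/(_ 1 ltr01) := cc; apply: filterS => e.
  by rewrite distrC.
apply: (near HC e) => //=; rewrite (le_trans (ler_normB _ _))// lerD ?KM//.
by rewrite -(subrK c0 (c e)) (le_trans (ler_normD _ _))// addrC lerD2l.
Unshelve. all: by end_near. Qed.

Definition mtranslation d (c : R -> 'rV[R]_d) (c0 : 'rV[R]_d) (cc : c e @[e --> 0^'+] --> c0)
  (u : mnet R d) : mnet R d := MNet (moderate_translation cc (mnetP u)).

Lemma gclass_near d (v w : mnet R d) :
  (\forall e \near 0^'+, v e = w e) -> gclass v = gclass w.
Proof.
move=> vw; apply/gclassP => K Kc s q; exists 1 => //.
apply: filterS (filterI (near0_itv R) vw) => e [/andP[e0 _] E] x _.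
have -> : (v - w : mnet R d) e = fun=> 0.
  by apply/funext => y; rewrite -[LHS]/(v e y - w e y) E subrr.
by rewrite cpartials0 normc0 mul1r exprn_ge0// ltW.
Qed.

(* A fixed cut-off chi near x0 + c0 becomes chi (x + c e) after translation, and
   this is phi times a quotient bounded in e with all its derivatives, where phi is
   the cut-off given for w; so the estimate for products applies. *)
Lemma micro_regular_translation d (w tw : mnet R d) (c : R -> 'rV[R]_d) (c0 x0 xi0 : 'rV[R]_d) :
  c e @[e --> 0^'+] --> c0 -> (\forall e \near 0^'+, tw e = fun x => w e (x - c e)) ->
  micro_regular (gclass w) x0 xi0 -> micro_regular (gclass tw) (x0 + c0) xi0.
Proof.
move=> cc twE /micro_regularP[w' [phi [Gamma [N [ww' [[phis [K Kc K0]] phi1] [Gc Gn] Gb]]]]].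
have twE' : gclass (mtranslation cc w') = gclass tw.
  have -> : gclass tw = gclass (mtranslation cc w).
    by apply: gclass_near; apply: filterS twE => e ->.
  by have H := (gclassP _ _).1 ww'; apply/gclassP; exact: (negligible_translation cc H).
have [b b0 phib] : exists2 b : R, 0 < b & forall x, `|x - x0| <= b -> phi x != 0.
  have [phic _ _ _] := smooth_C1 x0 phis.
  have : \forall x \near x0, 0 < Re (phi x).
    move/cvgrPdist_lt : phic => /(_ 1 ltr01); apply: filterS => x.
    rewrite phi1 /= ltr_norml => /andP[_]; lra.
  move=> /nbhs_ballP[r /= r0 Hr]; exists (r / 2); first by rewrite divr_gt0.
  move=> x xr; have : 0 < Re (phi x).
    apply: Hr; rewrite -ball_normE /= distrC (le_lt_trans xr)//.
    by rewrite ltr_pdivrMr// ltr_pMr// ltr1n.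
  by apply: contraTneq => ->; rewrite ltxx.
pose a := b / 2; have a0 : 0 < a by rewrite divr_gt0.
have ab : 0 < a < b by rewrite a0 ltr_pdivrMr// ltr_pMr// ltr1n.
have [iota iotas iotaE] := smooth_local_inverse ab phis phib.
(* [chi] has radius a / 2; the other half of [a] is left for the error of the shift, so the moved
   cut-off stays where [iota] inverts [phi]. *)
have a42 : 0 < a / 4 < a / 2 by rewrite divr_gt0//= ltr_pM2l// ltf_pV2 ?posrE// ltr_nat.
have [chi [chis _ chi1 chi0]] := smooth_bump (x0 + c0) a42.
have chi0' x : a / 2 <= `|x - (x0 + c0)| -> ofreal chi x = 0 by move=> /chi0; rewrite /ofreal => ->.
(* Equal to [c e] for small [e], but close to [c0] for every [e], since the support conditions of
   the product estimate are imposed on all of (0, 1]. *)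
pose ct e := if `|c e - c0| <= a / 2 then c e else c0.
have ctc e : `|ct e - c0| <= a / 2.
  by rewrite /ct; case: ifP => // _; rewrite subrr normr0 divr_ge0// ltW.
pose v e := fun x => ofreal chi (x + ct e).
have vs : smooth_net v by move=> e _; exact: smooth_translation.
pose Psi e := iota * v e.
have [Mp Mp0 KM] := compact_norm_bound Kc.
pose M := `|x0| + a + Mp.
have M0 : 0 < M by rewrite /M -addrA ltr_wpDl// addr_gt0.
have v0 e x : a <= `|x - x0| -> v e x = 0.
  move=> ax; apply: chi0'.
  have := ler_normB (x + ct e - (x0 + c0)) (ct e - c0).
  have -> : x + ct e - (x0 + c0) - (ct e - c0) = x - x0.
    by apply/rowP => i; rewrite !mxE; ring.
  by have := ctc e; move: ax; rewrite {2}[a]splitr; lra.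
have Psi0 e (x : 'rV[R]_d) : M < `|x| -> Psi e x = 0.
  move=> Mx; rewrite -[Psi e x]/(iota x * v e x) v0 ?mulr0//.
  by have := ler_normB x x0; have := lerB_dist x x0; move: Mx; rewrite /M; lra.
have Psis e : 0 < e <= 1 -> smooth (Psi e) by move=> e01; exact: smoothM iotas (vs e e01).
have Psib s : bigO_on setT (fun e x => normc (cpartials s (Psi e) x)) (fun e => e ^- 0).
  apply: (@bigO_on_setT _ M) => [e||]; first exact: exprV_ge0.
    by move=> e _; exact: Psi0.
  apply: (bigO_smoothM iotas _ vs) => s'.
    exact: compact_bound (@compact_ball R d M) (smooth_cpartials s' iotas).
  have [|B B0 HB] := @cpartials_bound d (`|x0 + c0| + a / 2) (ofreal chi) s' chis.
    move=> x Mx; apply: chi0'.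
    by have := lerB_dist x (x0 + c0); move: Mx; lra.
  exists B => //; near=> e => x _.
  by rewrite expr0 invr1 mulr1 /v cpartials_translation.
pose f e := phi * w' e.
have f0 e (x : 'rV[R]_d) : M < `|x| -> f e x = 0.
  move=> Mx; rewrite -[f e x]/(phi x * w' e x) K0 ?mul0r// => /KM.
  by rewrite leNgt (le_lt_trans _ Mx)// /M lerDr addr_ge0// ltW.
have fc e : 0 < e <= 1 -> Ccc M (f e).
  by move=> e01; apply: smooth_Ccc (f0 e); exact: smoothM phis (@mnet_smooth _ _ w' e e01).
have [Q fb] := bigO_cutoff phis f0.
have [G' [Gc' Gn' Gb']] := fourier_mul_decay M0 Gc Gn Psis (fun e _ => Psi0 e) Psib fc fb Gb.
apply/micro_regularP; exists (mtranslation cc w'), (ofreal chi), G', (0 + maxn N Q)%N; split.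
- exact: twE'.
- split; last by rewrite /ofreal chi1// subrr normr0 divr_ge0// ltW.
  split=> //; exists [set x | `|x| <= `|x0 + c0| + a / 2]; first exact: compact_ball.
  move=> x /negP; rewrite -ltNge => Mx; apply: chi0'.
  by have := lerB_dist x (x0 + c0); move: Mx; lra.
- by [].
- move=> q; have [C C0 HC] := Gb' q; exists C => //.
  have a20 : 0 < a / 2 by rewrite divr_gt0.
  near=> e => xi Gxi.
  have e01 : 0 < e <= 1 by near: e; exact: near0_itv.
  have cte : ct e = c e.
    rewrite /ct ifT//; near: e; have /cvgrPdist_le/(_ _ a20) := cc; apply: filterS => e.
    by rewrite distrC.
  pose h := Psi e * f e.
  have hc : Ccc M h.
    have [h1 h2 _] := fc e e01; apply: CccM (fc e e01).
      by move=> x; case: (smooth_C1 x (Psis e e01)).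
    by move=> x; case: (smooth_C1 x (Psis e e01)).
  (* Within distance [a] of x0 the product [iota * phi] is 1, and outside the moved cut-off
     vanishes. The remaining translation multiplies the transform by a factor of modulus 1. *)
  have -> : ofreal chi * mtranslation cc w' e = fun x => h (x - c e).
    apply/funext => x; rewrite -[LHS]/(ofreal chi x * w' e (x - c e)).
    rewrite -[RHS]/(iota (x - c e) * ofreal chi (x - c e + ct e) *
      (phi (x - c e) * w' e (x - c e))) cte subrK.
    have [xa|ax] := leP `|x - c e - x0| a.
      have E := iotaE _ xa; move: (iota _) (ofreal chi x) (phi _) (w' e _) E => p1 p2 p3 p4 E.
      by rewrite mulrACA E mul1r.
    have := v0 e (x - c e) (ltW ax); rewrite /v cte subrK => ->.
    by rewrite mulr0 !mul0r.
  rewrite (fourier_translation _ _ (ltW M0) hc) normcM normc_cis mul1r.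
  by apply: (near HC e).
Unshelve. all: by end_near. Qed.

End Microlocal.

(** * Chain rule, primitives in time, shears and exponentials *)

Section Chain.
Variable R : realType.

(** Mean value inequality for g minus the linear function D x_k. *)
Lemma partial_remainder d (g : 'rV[R]_d -> R) (k : 'I_d) (q : 'rV[R]_d) (s D e : R) :
  (forall y, derivable g y (basis_vec R k)) ->
  (forall s' : R, `|s'| <= `|s| ->
     `|'D_(basis_vec R k) g (s' *: basis_vec R k + q) - D| <= e) ->
  `|g (s *: basis_vec R k + q) - g q - s * D| <= e * `|s|.
Proof.
move=> dg He.
have co y : is_derive y (basis_vec R k) (fun y : 'rV[R]_d => D * y ord0 k) D.
  apply/is_derive_lineP.
  have -> : (fun h : R => D * (h *: basis_vec R k + y) ord0 k) = (fun h : R => h * D + D * y ord0 k).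
    by apply/funext => h; rewrite !mxE !eqxx mulr1 mulrDr mulrC.
  have := is_deriveD (is_deriveM (is_derive_id (0 : R) (1 : R)) (is_derive_cst D (0 : R) 1))
      (is_derive_cst (D * y ord0 k) (0 : R) (1 : R)).
  by rewrite scaler0 add0r addr0 [_ *: _]mulr1.
have dG y : is_derive y (basis_vec R k) (fun y : 'rV[R]_d => g y - D * y ord0 k)
    ('D_(basis_vec R k) g y - D).
  exact: is_deriveB (derivableP (dg y)) (co y).
have := @derivable_le_line R d (fun y => g y - D * y ord0 k) (basis_vec R k) q s e _ _.
have -> : g (s *: basis_vec R k + q) - D * (s *: basis_vec R k + q) ord0 k - (g q - D * q ord0 k) =
   g (s *: basis_vec R k + q) - g q - s * D.
  by rewrite !mxE !eqxx mulr1; ring.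
apply=> [y|s' ss']; first by case: (dG y).
by have [_ ->] := dG (s' *: basis_vec R k + q); exact: He.
Qed.

(** The increment may start at any [q] near [p]; this uniformity is needed when several coordinates
    are changed in turn. *)
Lemma partial_strict d (g : 'rV[R]_d -> R) (k : 'I_d) (p : 'rV[R]_d) (e : R) :
  (forall y, derivable g y (basis_vec R k)) ->
  {for p, continuous (fun y => 'D_(basis_vec R k) g y)} -> 0 < e ->
  exists2 dl : R, 0 < dl & forall q (s : R), `|q - p| < dl -> `|s| < dl ->
    `|g (s *: basis_vec R k + q) - g q - s * 'D_(basis_vec R k) g p| <= e * `|s|.
Proof.
move=> dg cg e0; move/cvgrPdist_le : cg => /(_ _ e0) /nbhs_ballP[r /= r0 Hr].
exists (r / 2); first by rewrite divr_gt0.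
move=> q s qp sr; apply: partial_remainder => // s' ss'.
rewrite distrC; apply: Hr; rewrite -ball_normE /= distrC.
rewrite -addrA (le_lt_trans (ler_normD _ _))// [r]splitr ltr_leD//.
  rewrite normrZ; apply: le_lt_trans (_ : `|s'| * 1 < _); last by rewrite mulr1 (le_lt_trans ss').
  rewrite ler_wpM2l//; apply/rV_norm_leP => // j; rewrite mxE eqxx /=.
  by case: (_ == _); rewrite ?normr0 ?normr1.
exact: ltW.
Qed.

Definition has_C1 d (g : 'rV[R]_d -> R) : Prop := forall k : 'I_d,
  (forall y, derivable g y (basis_vec R k)) /\
  continuous (fun y => 'D_(basis_vec R k) g y).

Lemma C1_expansion d (g : 'rV[R]_d -> R) (p : 'rV[R]_d) (e : R) : has_C1 g -> 0 < e ->
  exists2 dl : R, 0 < dl & forall v : 'rV[R]_d, `|v| < dl ->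
    `|g (p + v) - g p - \sum_k v ord0 k * 'D_(basis_vec R k) g p| <= e * \sum_k `|v ord0 k|.
Proof.
move=> gC e0.
have H k : exists dl : R, 0 < dl /\ forall q (s : R), `|q - p| < dl -> `|s| < dl ->
    `|g (s *: basis_vec R k + q) - g q - s * 'D_(basis_vec R k) g p| <= e * `|s|.
  have [dl dl0 Hd] := partial_strict (gC k).1 ((gC k).2 p) e0; by exists dl.
have [dl Hdl] := choice H.
have [eta eta0 Heta] : exists2 eta : R, 0 < eta & forall k, eta <= dl k.
  exists (\big[Num.min/1]_k dl k).
    by elim/big_ind: _ => // [x y x0 y0|k _]; [rewrite lt_min x0|case: (Hdl k)].
  by move=> k; rewrite (bigD1 k)//= ge_min lexx.
exists eta => // v veta.
(* The path from p to p + v that switches on one coordinate of [v] at a time. *)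
pose w m : 'rV[R]_d := \row_i (if (i < m)%N then v ord0 i else 0).
have wn m : `|w m| < eta.
  apply: le_lt_trans veta; apply/rV_norm_leP => // i; rewrite mxE.
  by case: ifP => _; rewrite ?normr0// coord_le_norm.
have wd : w d = v by apply/rowP => i; rewrite mxE ltn_ord.
suff Hm m : (m <= d)%N -> `|g (p + w m) - g p - \sum_(k < d | (k < m)%N) v ord0 k * 'D_(basis_vec R k) g p|
    <= e * \sum_(k < d | (k < m)%N) `|v ord0 k|.
  have := Hm d (leqnn d); rewrite wd.
  by under eq_bigl do rewrite ltn_ord; under [X in _ <= _ * X]eq_bigl do rewrite ltn_ord.
elim: m => [_|m IHm md].
  rewrite !big_pred0 // subr0 mulr0; have -> : w 0%N = 0 by apply/rowP => i; rewrite !mxE.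
  by rewrite addr0 subrr normr0.
pose k := Ordinal md.
have wS : p + w m.+1 = v ord0 k *: basis_vec R k + (p + w m).
  apply/rowP => i; rewrite !mxE eqxx /=.
  have -> : (i == k) = (i == m :> nat) by [].
  rewrite ltnS leq_eqVlt; case: eqP => [im|_] /=; last by rewrite mulr0 add0r.
  have -> : i = k by apply: val_inj.
  by rewrite /= ltnn mulr1 addr0 addrC.
have sumS (F : 'I_d -> R) : \sum_(i < d | (i < m.+1)%N) F i = F k + \sum_(i < d | (i < m)%N) F i.
  rewrite (bigD1 k)//=; congr (_ + _); apply: eq_bigl => i.
  have -> : (i == k) = (i == m :> nat) by [].
  by rewrite ltnS leq_eqVlt; case: eqP => [->|_]; rewrite ?ltnn ?andbT.
rewrite !sumS wS mulrDr.
have -> : g (v ord0 k *: basis_vec R k + (p + w m)) - g p -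
    (v ord0 k * 'D_(basis_vec R k) g p + \sum_(i < d | (i < m)%N) v ord0 i * 'D_(basis_vec R i) g p) =
    (g (v ord0 k *: basis_vec R k + (p + w m)) - g (p + w m) - v ord0 k * 'D_(basis_vec R k) g p) +
    (g (p + w m) - g p - \sum_(i < d | (i < m)%N) v ord0 i * 'D_(basis_vec R i) g p) by ring.
rewrite (le_trans (ler_normD _ _))// lerD//; last exact: IHm (ltnW md).
apply: (Hdl k).2.
  by rewrite addrC addKr; exact: lt_le_trans (wn m) (Heta k).
by apply: lt_le_trans (Heta k); apply: le_lt_trans veta; exact: coord_le_norm.
Qed.

(** The remainder of [C1_expansion] is a small multiple of the sum of the |V_k|; divided by h it is
    controlled by the difference quotients of the curve, which stay below |gam'_k| + 1. *)
Lemma is_derive_curve d (g : 'rV[R]_d -> R) (gam : R -> 'rV[R]_d) (gam' : 'I_d -> R) :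
  has_C1 g -> (forall k, is_derive (0 : R) 1 (fun h => gam h ord0 k) (gam' k)) ->
  is_derive (0 : R) 1 (fun h => g (gam h)) (\sum_k gam' k * 'D_(basis_vec R k) g (gam 0)).
Proof.
move=> gC dgam; set D := \sum_k _.
have cg k : {for (0 : R), continuous (fun h => gam h ord0 k)}.
  by apply: differentiable_continuous; apply/derivable1_diffP; case: (dgam k).
have qk k : h^-1 * (gam h ord0 k - gam 0 ord0 k) @[h --> (0 : R)^'] --> gam' k.
  have [H1 H2] := dgam k; have := H1; rewrite /derivable => /cvg_ex [l Hl].
  have El : l = gam' k by rewrite -H2; apply/esym/cvg_lim.
  rewrite -El; have := Hl.
  have -> // : (fun h : R => h^-1 *: (((fun h0 : R => gam h0 ord0 k) \o shift 0) (h *: (1 : R)) -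
     gam 0 ord0 k)) = (fun h : R => h^-1 * (gam h ord0 k - gam 0 ord0 k)).
  by apply/funext => h /=; rewrite addr0 [h *: (1 : R)]mulr1.
have H : h^-1 *: (((fun h => g (gam h)) \o shift 0) (h *: (1 : R)) - g (gam 0)) @[h --> (0 : R)^'] --> D.
  have -> : (fun h : R => h^-1 *: (((fun h => g (gam h)) \o shift 0) (h *: (1 : R)) - g (gam 0))) =
     (fun h => h^-1 * (g (gam h) - g (gam 0))).
    by apply/funext => h /=; rewrite addr0 [h *: (1 : R)]mulr1.
  pose V h := gam h - gam 0.
  pose Q h := \sum_k h^-1 * V h ord0 k * 'D_(basis_vec R k) g (gam 0).
  have HQ : Q h @[h --> (0 : R)^'] --> D.
    apply: (@cvg_big R _ _ _ _ add_continuous) => k _.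
    apply: cvgM; last exact: cvg_cst.
    by under eq_fun do rewrite /V !mxE; exact: qk.
  suff HE : h^-1 * (g (gam h) - g (gam 0)) - Q h @[h --> (0 : R)^'] --> (0 : R).
    have -> : (fun h => h^-1 * (g (gam h) - g (gam 0))) =
        (fun h => h^-1 * (g (gam h) - g (gam 0)) - Q h) + Q.
      by apply/funext => h; rewrite -[RHS]/(_ - Q h + Q h) subrK.
    by rewrite -[D]add0r; exact: cvgD.
  pose B := \sum_k (`|gam' k| + 1).
  have B0 : 0 <= B by apply: sumr_ge0 => k _; rewrite addr_ge0.
  apply/cvgrPdist_le => e e0.
  have eB : 0 < e / (B + 1) by rewrite divr_gt0// ltr_wpDl.
  have [dl dl0 Hdl] := C1_expansion (gam 0) gC eB.
  have Vnear : \forall h \near (0 : R), `|V h| < dl.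
    have : \forall h \near (0 : R), forall k, `|gam h ord0 k - gam 0 ord0 k| < dl / 2.
      apply: (@filter_forall _ _ (fun k h => `|gam h ord0 k - gam 0 ord0 k| < dl / 2) _
        (nbhs_filter (0 : R))) => k; move/cvgrPdist_lt : (cg k) => /(_ (dl / 2)).
      by rewrite divr_gt0// => /(_ isT); apply: filterS => y; rewrite distrC.
    apply: filterS => y Hy; apply: (@le_lt_trans _ _ (dl / 2)).
      by apply/rV_norm_leP => [|k]; [rewrite divr_ge0// ltW|rewrite !mxE ltW].
    by rewrite ltr_pdivrMr// ltr_pMr// ltr1n.
  near=> h.
  have h0 : h != 0 by near: h; exact: nbhs_dnbhs_neq.
  have Vd : `|V h| < dl by near: h; exact: nbhs_dnbhs Vnear.
  have Vq : forall k, `|h^-1 * V h ord0 k| <= `|gam' k| + 1.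
    near: h; apply: filter_forall => k; have /cvgrPdist_le/(_ 1 ltr01) := qk k.
    apply: filterS => y; rewrite /V !mxE distrC => Hy.
    move: Hy; set X := y^-1 * _; have := ler_normD (X - gam' k) (gam' k).
    by rewrite subrK; lra.
  rewrite sub0r normrN.
  have -> : h^-1 * (g (gam h) - g (gam 0)) - Q h = h^-1 * (g (gam 0 + V h) - g (gam 0) -
     \sum_k V h ord0 k * 'D_(basis_vec R k) g (gam 0)).
    rewrite /V subrKC [RHS]mulrBr [in RHS]mulr_sumr; congr (_ - _); apply: eq_bigr => k _.
    by rewrite mulrA.
  rewrite normrM; apply: (@le_trans _ _ (`|h^-1| * (e / (B + 1) * \sum_k `|V h ord0 k|))).
    by rewrite ler_wpM2l// Hdl.
  rewrite mulrCA mulr_sumr; apply: (@le_trans _ _ (e / (B + 1) * B)).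
    rewrite ler_wpM2l ?(ltW eB)//; apply: ler_sum => k _.
    by rewrite -normrM Vq.
  by rewrite mulrAC ler_pdivrMr ?ltr_wpDl// ler_wpM2l ?(ltW e0)// lerDl.
by split; [apply/cvg_ex; exists D|exact: cvg_lim].
Unshelve. all: by end_near. Qed.

End Chain.

(** * Primitives in the time variable *)

Section Primitive.
Variables (R : realType) (n : nat).
Implicit Types (g : 'rV[R]_n.+1 -> R) (z : 'rV[R]_n.+1).

Definition space z : 'rV[R]_n := \row_j z ord0 (lift ord0 j).

Lemma spaceE z : spacetime (z ord0 ord0) (space z) = z.
Proof. by rewrite -spacetime_eq. Qed.

Lemma space_continuous : continuous space.
Proof.
apply: rV_continuous => j; under eq_fun do rewrite mxE.
exact: coord_continuous.
Qed.

Lemma spacetime_continuous2 (T : topologicalType) (a : T -> R) (b : T -> 'rV[R]_n) x :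
  {for x, continuous a} -> {for x, continuous b} ->
  {for x, continuous (fun y => spacetime (a y) (b y))}.
Proof.
move=> ca cb; have J : continuous (fun p : R * 'rV[R]_n => spacetime p.1 p.2).
  apply: rV_continuous => i; case: (unliftP ord0 i) => [j ->|->].
    under eq_fun do rewrite spacetime_lift.
    move=> p; apply: (@continuous_comp _ _ _ snd (fun x : 'rV[R]_n => x ord0 j)).
      exact: cvg_snd.
    exact: coord_continuous.
  by under eq_fun do rewrite spacetime0; move=> p; exact: cvg_fst.
apply: (@continuous_comp _ _ _ (fun y => (a y, b y)) (fun p : R * 'rV[R]_n => spacetime p.1 p.2)).
  exact: (@cvg_pair T R 'rV[R]_n (nbhs x) (nbhs (a x)) (nbhs (b x)) _ _ _ a b ca cb).
exact: J.
Qed.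

Definition prim g z : R :=
  integral_from0 (fun s => g (spacetime s (space z))) (z ord0 ord0).

Lemma slice_continuous g x : continuous g -> continuous (fun s : R => g (spacetime s x)).
Proof.
move=> cg s; apply: (@continuous_comp _ _ _ (fun s => spacetime s x) g); last exact: cg.
exact: spacetime_time_continuous.
Qed.

Lemma prim_le g (C : R) z : continuous g ->
  (forall s : R, `|s| <= `|z ord0 ord0| -> `|g (spacetime s (space z))| <= C) ->
  `|prim g z| <= C * `|z ord0 ord0|.
Proof. by move=> cg gC; apply: integral_from0_le => //; exact: slice_continuous. Qed.

Lemma prim_time g z : continuous g -> is_derive z (basis_vec R ord0) (prim g) (g z).
Proof.
move=> cg; apply/is_derive_lineP.
pose F := integral_from0 (fun s => g (spacetime s (space z))).
have -> : (fun h : R => prim g (h *: basis_vec R ord0 + z)) = (fun h => F (shift (z ord0 ord0) h)).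
  apply/funext => h; rewrite /prim /F.
  have -> : space (h *: basis_vec R ord0 + z) = space z.
    by apply/rowP => j; rewrite !mxE !eqxx /= mulr0 add0r.
  by rewrite !mxE eqxx mulr1.
have H : is_derive (shift (z ord0 ord0) (0 : R)) 1 F (g z).
  have := is_derive_integral_from0 (shift (z ord0 ord0) (0 : R)) (@slice_continuous g (space z) cg).
  by rewrite /= add0r spaceE.
have := @is_derive1_comp _ F (shift (z ord0 ord0)) (0 : R) _ _ H (is_derive_shift _ _ _).
by rewrite mulr1.
Qed.

Lemma compact_sym_itv (a : R) : compact [set s : R | `|s| <= a].
Proof.
have -> : [set s : R | `|s| <= a] = `[- a, a]%classic.
  by apply/seteqP; split => s /=; rewrite in_itv/= ler_norml.
exact: segment_compact.
Qed.

Lemma continuous_cstM (T : topologicalType) (f : T -> R) (c : R) :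
  continuous f -> continuous (fun s => c * f s).
Proof. by move=> cf s; apply: continuousM; [exact: cst_continuous|exact: cf]. Qed.

Lemma continuous_subR (T : topologicalType) (f1 f2 : T -> R) :
  continuous f1 -> continuous f2 -> continuous (fun s => f1 s - f2 s).
Proof. by move=> c1 c2 s; apply: continuousB; [exact: c1|exact: c2]. Qed.

(** Differentiation under the integral: the error of the difference quotient is the primitive of the
    pointwise remainders, and these are small uniformly on the compact time interval. *)
Lemma prim_space g z (j : 'I_n) : continuous g ->
  (forall y, derivable g y (basis_vec R (lift ord0 j))) ->
  continuous (fun y => 'D_(basis_vec R (lift ord0 j)) g y) ->
  is_derive z (basis_vec R (lift ord0 j)) (prim g)
    (prim (fun y => 'D_(basis_vec R (lift ord0 j)) g y) z).
Proof.
move=> cg dg cDg; set k := lift ord0 j; pose Dg : 'rV[R]_n.+1 -> R := fun y => 'D_(basis_vec R k) g y.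
rewrite -/Dg.
pose t := z ord0 ord0; pose p s := spacetime s (space z).
have H : h^-1 *: ((prim g \o shift z) (h *: basis_vec R k) - prim g z) @[h --> (0 : R)^'] --> prim Dg z.
  apply/cvgrPdist_le => e e0.
  have eT : 0 < e / (`|t| + 1) by rewrite divr_gt0// ltr_wpDl.
  have U : \forall si \near (0 : R), forall s : R, [set s : R | `|s| <= `|t|] s ->
      `|Dg (si *: basis_vec R k + p s) - Dg (0 *: basis_vec R k + p s)| < e / (`|t| + 1).
    apply: (@unif_continuous_param R _ _ (fun si s : R => Dg (si *: basis_vec R k + p s))) eT.
      exact: compact_sym_itv.
    move=> s _; apply: (@continuous_comp _ _ _ (fun q : R * R => q.1 *: basis_vec R k + p q.2) Dg);
      last exact: cDg.
    apply: continuousD; first by apply: (@continuous_comp _ _ _ fst (fun s : R => s *: basis_vec R k)); [exact: cvg_fst|exact: scalel_continuous].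
    apply: (@continuous_comp _ _ _ snd p); first exact: cvg_snd.
    exact: spacetime_time_continuous.
  move/nbhs_ballP : U => [r /= r0 U].
  near=> h.
  have h0 : h != 0 by near: h; exact: nbhs_dnbhs_neq.
  have hr : `|h| < r by near: h; exact: dnbhs0_lt.
  have sh s : spacetime s (space (h *: basis_vec R k + z)) = h *: basis_vec R k + p s.
    rewrite /p -spacetime_shift; congr spacetime; apply/rowP => i.
    by rewrite !mxE (inj_eq lift_inj).
  have cp s : {for s, continuous (fun s => h *: basis_vec R k + p s)}.
    by apply: continuousD; [exact: cst_continuous|exact: spacetime_time_continuous].
  have c1 : continuous (fun s => g (h *: basis_vec R k + p s)).
    by move=> s; apply: (@continuous_comp _ _ _ (fun s => h *: basis_vec R k + p s) g) => //; exact: cg.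
  have c2 : continuous (fun s => g (p s)) by exact: slice_continuous.
  have c3 : continuous (fun s => Dg (p s)) by exact: slice_continuous.
  have c4 := continuous_subR c1 c2.
  have c5 := @continuous_cstM _ _ h^-1 c4.
  have c6 := continuous_subR c3 c5.
  have E : prim Dg z - h^-1 *: ((prim g \o shift z) (h *: basis_vec R k) - prim g z) =
     integral_from0 (fun s => Dg (p s) - h^-1 * (g (h *: basis_vec R k + p s) - g (p s))) t.
    rewrite (integral_from0B _ c3 c5) (integral_from0Z _ _ c4) (integral_from0B _ c1 c2).
    have -> : (prim g \o shift z) (h *: basis_vec R k) =
        integral_from0 (fun s => g (h *: basis_vec R k + p s)) t.
      have T : (h *: basis_vec R k + z) ord0 ord0 = t by rewrite !mxE /= mulr0 add0r.
      by rewrite /= /prim T; congr integral_from0; apply/funext => s; rewrite sh.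
    by [].
  rewrite E.
  apply: (@le_trans _ _ (e / (`|t| + 1) * `|t|)); last first.
    by rewrite mulrAC ler_pdivrMr ?ltr_wpDl// ler_wpM2l ?(ltW e0)// lerDl.
  apply: (integral_from0_le c6) => s st.
  have := @partial_remainder R _ g k (p s) h (Dg (p s)) (e / (`|t| + 1)) dg.
  move=> H; have {H} : `|g (h *: basis_vec R k + p s) - g (p s) - h * Dg (p s)| <= e / (`|t| + 1) * `|h|.
    apply: H => s' s'h; have := U s' _ s st; rewrite scale0r add0r => H.
    by apply/ltW/H; rewrite -ball_normE /= sub0r normrN (le_lt_trans s'h).
  have -> : Dg (p s) - h^-1 * (g (h *: basis_vec R k + p s) - g (p s)) =
      - (h^-1 * (g (h *: basis_vec R k + p s) - g (p s) - h * Dg (p s))).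
    by field.
  by move=> H'; rewrite normrN normrM normfV mulrC ler_pdivrMr// normr_gt0.
by split; [apply/cvg_ex; exists (prim Dg z)|exact: cvg_lim].
Unshelve. all: by end_near. Qed.

(** The change of the upper limit and the change of the parameter are separated; |t| + 1 bounds all
    nearby upper limits. *)
Lemma prim_continuous g : continuous g -> continuous (prim g).
Proof.
move=> cg; suff H z : {for z, continuous (prim g)} by move=> z; exact: H.
apply/(@cvgrPdist_le R R _ (nbhs z)) => e e0.
pose t : R := z ord0 ord0; pose F := integral_from0 (fun s => g (spacetime s (space z))).
have e2 : 0 < e / 2 by rewrite divr_gt0.
have e3 : 0 < e / 2 / (`|t| + 1) by rewrite divr_gt0// ltr_wpDl.
have cF : {for t, continuous F}.
  apply: differentiable_continuous; apply/derivable1_diffP.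
  by case: (is_derive_integral_from0 t (@slice_continuous g (space z) cg)).
have ct : {for z, continuous (fun z' : 'rV[R]_n.+1 => z' ord0 ord0)} by exact: coord_continuous.
have N1 : \forall z' \near z, let z' : 'rV[R]_n.+1 := z' in `|F t - F (z' ord0 ord0)| <= e / 2.
  have cFt : {for z, continuous (fun z' : 'rV[R]_n.+1 => F (z' ord0 ord0))}.
    exact: (continuous_comp ct cF).
  by move/(@cvgrPdist_le R R _ (nbhs z)) : cFt; apply.
have N2 : \forall z' \near z, let z' : 'rV[R]_n.+1 := z' in `|t - z' ord0 ord0| <= 1.
  by move/(@cvgrPdist_le R R _ (nbhs z)) : ct; apply.
have N3 : \forall z' \near z, let z' : 'rV[R]_n.+1 := z' in forall s : R, [set s : R | `|s| <= `|t| + 1] s ->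
    `|g (spacetime s (space z')) - g (spacetime s (space z))| < e / 2 / (`|t| + 1).
  apply: (@unif_continuous_param R _ _ (fun z' s => g (spacetime s (space z')))) e3.
    exact: compact_sym_itv.
  move=> s _; apply: (@continuous_comp _ _ _
    (fun q : 'rV[R]_n.+1 * R => spacetime q.2 (space q.1)) g); last exact: cg.
  apply: spacetime_continuous2; first exact: cvg_snd.
  apply: (@continuous_comp _ _ _ fst space); first exact: cvg_fst.
  exact: space_continuous.
near=> z'.
have h1 : `|F t - F (z' ord0 ord0)| <= e / 2 by near: z'.
have h2 : `|t - z' ord0 ord0| <= 1 by near: z'.
have h3 : forall s : R, `|s| <= `|t| + 1 ->
    `|g (spacetime s (space z')) - g (spacetime s (space z))| < e / 2 / (`|t| + 1) by near: z'.
have t1 : `|z' ord0 ord0| <= `|t| + 1.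
  have := ler_normB t (t - z' ord0 ord0); rewrite opprB subrKC => H.
  by apply: le_trans H _; rewrite lerD2l.
have -> : prim g z - prim g z' = (F t - F (z' ord0 ord0)) - integral_from0
    (fun s => g (spacetime s (space z')) - g (spacetime s (space z))) (z' ord0 ord0).
  by rewrite integral_from0B; [rewrite /prim /F; ring|exact: slice_continuous|exact: slice_continuous].
rewrite (le_trans (ler_normB _ _))// [e]splitr lerD//.
apply: (@le_trans _ _ (e / 2 / (`|t| + 1) * `|z' ord0 ord0|)).
  apply: integral_from0_le => [s|s sz].
    by apply: continuousB; exact: slice_continuous.
  by apply/ltW/h3; exact: le_trans t1.
by rewrite mulrAC ler_pdivrMr ?ltr_wpDl// ler_wpM2l ?(ltW e2).
Unshelve. all: by end_near. Qed.

End Primitive.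

(** * Complex primitives, shears and the complex exponential *)

Section ComplexCalculus.
Variable R : realType.

Lemma has_C1_ReIm d (f : 'rV[R]_d -> R[i]) : (forall x, C1_at f x) ->
  (forall j x, C1_at (cpartial j f) x) ->
  has_C1 (fun y => Re (f y)) /\ has_C1 (fun y => Im (f y)).
Proof.
move=> f1 f2; split=> k; split=> x.
- by have [_ _ H _] := f1 x.
- by have [H _ _ _] := f2 k x.
- by have [_ _ _ H] := f1 x.
- by have [_ H _ _] := f2 k x.
Qed.

Definition cprim n (f : 'rV[R]_n.+1 -> R[i]) (z : 'rV[R]_n.+1) : R[i] :=
  (prim (fun y => Re (f y)) z +i* prim (fun y => Im (f y)) z)%C.

Lemma C1_continuous d (f : 'rV[R]_d -> R[i]) : (forall x, C1_at f x) ->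
  continuous (fun y => Re (f y)) /\ continuous (fun y => Im (f y)).
Proof. by move=> f1; split=> x; case: (f1 x). Qed.

Lemma C1_at_cprim n (f : 'rV[R]_n.+1 -> R[i]) z : (forall x, C1_at f x) ->
  (forall j x, C1_at (cpartial j f) x) -> C1_at (cprim f) z.
Proof.
move=> f1 f2; have [cr ci] := C1_continuous f1; have [hr hi] := has_C1_ReIm f1 f2.
split; [exact: prim_continuous cr z|exact: prim_continuous ci z|move=> k|move=> k].
- case: (unliftP ord0 k) => [j ->|->]; last by case: (prim_time z cr).
  by have [H _] := prim_space z cr (hr (lift ord0 j)).1 (hr (lift ord0 j)).2.
- case: (unliftP ord0 k) => [j ->|->]; last by case: (prim_time z ci).
  by have [H _] := prim_space z ci (hi (lift ord0 j)).1 (hi (lift ord0 j)).2.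
Qed.

Lemma cpartial_cprim_time n (f : 'rV[R]_n.+1 -> R[i]) : (forall x, C1_at f x) ->
  cpartial ord0 (cprim f) = f.
Proof.
move=> f1; have [cr ci] := C1_continuous f1; apply/funext => z; rewrite /cpartial.
have [_ ->] := prim_time z cr; have [_ ->] := prim_time z ci.
by case: (f z).
Qed.

Lemma cpartial_cprim_space n (f : 'rV[R]_n.+1 -> R[i]) j : (forall x, C1_at f x) ->
  (forall j x, C1_at (cpartial j f) x) ->
  cpartial (lift ord0 j) (cprim f) = cprim (cpartial (lift ord0 j) f).
Proof.
move=> f1 f2; have [cr ci] := C1_continuous f1; have [hr hi] := has_C1_ReIm f1 f2.
apply/funext => z; rewrite {1}/cpartial.
have [_ ->] := prim_space z cr (hr (lift ord0 j)).1 (hr (lift ord0 j)).2.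
by have [_ ->] := prim_space z ci (hi (lift ord0 j)).1 (hi (lift ord0 j)).2.
Qed.

Lemma normc_cprim n (f : 'rV[R]_n.+1 -> R[i]) (z : 'rV[R]_n.+1) (C : R) : (forall x, C1_at f x) ->
  (forall s : R, `|s| <= `|z ord0 ord0| -> normc (f (spacetime s (space z))) <= C) ->
  normc (cprim f z) <= 2 * C * `|z ord0 ord0| /\
  `|Im (cprim f z)| <= C * `|z ord0 ord0|.
Proof.
move=> f1 fC; have [cr ci] := C1_continuous f1.
have I : `|Im (cprim f z)| <= C * `|z ord0 ord0|.
  by apply: prim_le => // s sz; exact: le_trans (normc_ge_Im _) (fC s sz).
split=> //; apply: le_trans (normc_le _) _.
rewrite -mulrA mulrDl mul1r lerD//; apply: prim_le => // s sz; exact: le_trans (normc_ge_Re _) (fC s sz).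
Qed.

(** The change of coordinates (t, x) -> (t, x + L(t)) that straightens the characteristics, or bends
    them back for the opposite sign of L. *)
Definition shear n (L : 'I_n -> R -> R) (z : 'rV[R]_n.+1) : 'rV[R]_n.+1 :=
  z + spacetime 0 (\row_j L j (z ord0 ord0)).

Lemma shear0 n (L : 'I_n -> R -> R) z : shear L z ord0 ord0 = z ord0 ord0.
Proof. by rewrite mxE spacetime0 addr0. Qed.

Lemma shear_lift n (L : 'I_n -> R -> R) z j :
  shear L z ord0 (lift ord0 j) = z ord0 (lift ord0 j) + L j (z ord0 ord0).
Proof. by rewrite mxE spacetime_lift mxE. Qed.

Lemma shearK n (L : 'I_n -> R -> R) z : shear L (shear (fun j t => - L j t) z) = z.
Proof.
apply/rowP => k; case: (unliftP ord0 k) => [j ->|->]; last by rewrite !shear0.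
by rewrite !shear_lift shear0 addrNK.
Qed.

Section Shear.
Variables (n : nat) (L L' : 'I_n -> R -> R).
Hypothesis dL : forall j (t : R), is_derive t 1 (L j) (L' j t).

Lemma shear_continuous : continuous (shear L).
Proof.
apply: rV_continuous => k; case: (unliftP ord0 k) => [j ->|->].
  under eq_fun do rewrite shear_lift.
  move=> z; apply: continuousD; first exact: coord_continuous.
  apply: (@continuous_comp _ _ _ (fun z : 'rV[R]_n.+1 => z ord0 ord0) (L j)).
    exact: coord_continuous.
  by apply: differentiable_continuous; apply/derivable1_diffP; case: (dL j (z ord0 ord0)).
by under eq_fun do rewrite shear0; exact: coord_continuous.
Qed.

Lemma is_derive_shear_time (g : 'rV[R]_n.+1 -> R) z : has_C1 g ->
  is_derive z (basis_vec R ord0) (fun y => g (shear L y))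
    ('D_(basis_vec R ord0) g (shear L z) +
     \sum_j L' j (z ord0 ord0) * 'D_(basis_vec R (lift ord0 j)) g (shear L z)).
Proof.
move=> gC; apply/is_derive_lineP.
pose gam (h : R) := shear L (h *: basis_vec R ord0 + z).
(* Velocity of the sheared time line: 1 in time and L'_j in space. *)
pose gam' (k : 'I_n.+1) := oapp (fun j => L' j (z ord0 ord0)) 1 (unlift ord0 k).
have T h : (h *: basis_vec R ord0 + z) ord0 ord0 = h + z ord0 ord0.
  by rewrite !mxE eqxx mulr1.
have D k : is_derive (0 : R) 1 (fun h => gam h ord0 k) (gam' k).
  rewrite /gam /gam'; case: (unliftP ord0 k) => [j ->|->] /=.
    under eq_fun do rewrite shear_lift T.
    have -> : (fun h : R => (h *: basis_vec R ord0 + z) ord0 (lift ord0 j) + L j (h + z ord0 ord0)) =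
       (fun h : R => z ord0 (lift ord0 j) + L j (shift (z ord0 ord0) h)).
      by apply/funext => h; rewrite !mxE /= mulr0 add0r.
    have H : is_derive (shift (z ord0 ord0) (0 : R)) 1 (L j) (L' j (z ord0 ord0)).
      by rewrite /= add0r; exact: dL.
    have := @is_derive1_comp _ (L j) (shift (z ord0 ord0)) (0 : R) _ _ H (is_derive_shift _ _ _).
    rewrite mulr1 => H2.
    have := is_deriveD (is_derive_cst (z ord0 (lift ord0 j)) (0 : R) (1 : R)) H2.
    by rewrite add0r.
  under eq_fun do rewrite shear0 T.
  exact: is_derive_shift.
have := is_derive_curve gC D.
rewrite {2}/gam scale0r add0r big_ord_recl /gam' unlift_none /= mul1r.
by under eq_bigr do rewrite liftK /=.
Qed.

Lemma is_derive_shear_space (g : 'rV[R]_n.+1 -> R) z j : has_C1 g ->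
  is_derive z (basis_vec R (lift ord0 j)) (fun y => g (shear L y))
    ('D_(basis_vec R (lift ord0 j)) g (shear L z)).
Proof.
move=> gC; apply/is_derive_lineP.
have -> : (fun h : R => g (shear L (h *: basis_vec R (lift ord0 j) + z))) =
   (fun h : R => g (h *: basis_vec R (lift ord0 j) + shear L z)).
  apply/funext => h; congr g; apply/rowP => k; rewrite /shear !mxE /=.
  by rewrite mulr0 add0r addrA.
by apply/is_derive_lineP; apply: derivableP; exact: (gC _).1.
Qed.

Variable f : 'rV[R]_n.+1 -> R[i].
Hypothesis f1 : forall x, C1_at f x.
Hypothesis f2 : forall j x, C1_at (cpartial j f) x.

Lemma C1_at_shear z : C1_at (f \o shear L) z.
Proof.
have [cr ci] := C1_continuous f1; have [hr hi] := has_C1_ReIm f1 f2.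
split.
- exact: (continuous_comp (@shear_continuous z) (cr _)).
- exact: (continuous_comp (@shear_continuous z) (ci _)).
- move=> k; case: (unliftP ord0 k) => [j ->|->].
    by case: (is_derive_shear_space z j hr).
  by case: (is_derive_shear_time z hr).
- move=> k; case: (unliftP ord0 k) => [j ->|->].
    by case: (is_derive_shear_space z j hi).
  by case: (is_derive_shear_time z hi).
Qed.

Lemma cpartial_shear_space j :
  cpartial (lift ord0 j) (f \o shear L) = cpartial (lift ord0 j) f \o shear L.
Proof.
have [hr hi] := has_C1_ReIm f1 f2; apply/funext => z; rewrite {1}/cpartial.
have [_ ->] := is_derive_shear_space z j hr.
by have [_ ->] := is_derive_shear_space z j hi.
Qed.

Lemma cpartial_shear_time z :
  cpartial ord0 (f \o shear L) z = cpartial ord0 f (shear L z) +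
   \sum_j (L' j (z ord0 ord0) +i* 0)%C * cpartial (lift ord0 j) f (shear L z).
Proof.
have [hr hi] := has_C1_ReIm f1 f2; rewrite {1}/cpartial.
have [_ ->] := is_derive_shear_time z hr.
have [_ ->] := is_derive_shear_time z hi.
have Rs (F : 'I_n -> R[i]) : Re (\sum_j F j) = \sum_j Re (F j).
  by apply: (big_ind2 (fun (a : R[i]) (b : R) => Re a = b)) => // x1 x2 y1 y2 <- <-; rewrite ReD.
have Is (F : 'I_n -> R[i]) : Im (\sum_j F j) = \sum_j Im (F j).
  by apply: (big_ind2 (fun (a : R[i]) (b : R) => Im a = b)) => // x1 x2 y1 y2 <- <-; rewrite ImD.
apply: complexP; rewrite ?ReD ?ImD ?Rs ?Is /=; congr (_ + _); apply: eq_bigr => j _.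
  by rewrite mul0r subr0.
by rewrite mul0r addr0.
Qed.

End Shear.

Definition cexp (z : R[i]) : R[i] := ((expR (Re z) * cos (Im z)) +i* (expR (Re z) * sin (Im z)))%C.

Lemma cexpE (z : R[i]) : cexp z = (expR (Re z) +i* 0)%C * cis (Im z).
Proof. by apply: complexP; rewrite ?ReM ?ImM /= mul0r ?subr0 ?addr0. Qed.

Lemma normc_cexp (z : R[i]) : normc (cexp z) = expR (Re z).
Proof.
rewrite cexpE normcM normc_cis mulr1 /normc expr0n addr0 sqrtr_sqr ger0_norm// expR_ge0.
Qed.

Lemma cexpN (z : R[i]) : cexp z * cexp (- z) = 1.
Proof.
have E : cexp (- z) = (expR (- Re z) +i* 0)%C * cis (- Im z).
  by rewrite cexpE; case: z.
rewrite E cexpE mulrACA -cisD subrr cis0 mulr1.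
apply: complexP; rewrite ?ReM ?ImM /= ?mulr0 ?mul0r ?subr0 ?addr0//.
by rewrite -expRD subrr expR0.
Qed.

Lemma cexp0 : cexp 0 = 1.
Proof. by rewrite /cexp /= expR0 cos0 sin0 !mul1r. Qed.

Lemma is_derive_cexp d (f : 'rV[R]_d -> R[i]) j x : C1_at f x ->
  is_derive x (basis_vec R j) (fun y => Re (cexp (f y))) (Re (cpartial j f x * cexp (f x))) /\
  is_derive x (basis_vec R j) (fun y => Im (cexp (f y))) (Im (cpartial j f x * cexp (f x))).
Proof.
move=> [_ _ dr di].
have E := is_derive_comp_line (is_derive_expR (Re (f x))) (derivableP (dr j)).
have Cc := is_derive_comp_line (is_derive_cos (Im (f x))) (derivableP (di j)).
have Ss := is_derive_comp_line (is_derive_sin (Im (f x))) (derivableP (di j)).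
split.
- apply: (is_derive_eq (is_deriveM E Cc)).
  by rewrite ReM /cpartial /= -[_ *: _]/(_ * _) -[X in _ + X]/(_ * _); ring.
- apply: (is_derive_eq (is_deriveM E Ss)).
  by rewrite ImM /cpartial /= -[_ *: _]/(_ * _) -[X in _ + X]/(_ * _); ring.
Qed.

Lemma C1_at_cexp d (f : 'rV[R]_d -> R[i]) x : C1_at f x -> C1_at (cexp \o f) x.
Proof.
move=> fx; have [cr ci dr di] := fx; split.
- apply: continuousM; first by apply: (continuous_comp cr); exact: continuous_expR.
  by apply: (continuous_comp ci); exact: continuous_cos.
- apply: continuousM; first by apply: (continuous_comp cr); exact: continuous_expR.
  by apply: (continuous_comp ci); exact: continuous_sin.
- by move=> j; case: (is_derive_cexp j fx) => -[].
- by move=> j; case: (is_derive_cexp j fx) => _ [].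
Qed.

Lemma cpartial_cexp d (f : 'rV[R]_d -> R[i]) j x : C1_at f x ->
  cpartial j (cexp \o f) x = cpartial j f x * cexp (f x).
Proof.
move=> fx; have [[_ H1] [_ H2]] := is_derive_cexp j fx.
by rewrite {1}/cpartial; apply: complexP; [exact: H1|exact: H2].
Qed.

End ComplexCalculus.

(** * Growth rates and regular nets *)

Section RateClasses.
Variable R : realType.

(** What product rule, primitives and shears need from a growth rate; slow scale and moderate nets
    are then treated at once. *)
Record rate_class (F : set (R -> R)) : Prop := RateClass {
  rate_ge0 : forall g e, F g -> 0 <= g e ;
  rate_cst : forall c : R, 0 <= c -> F (fun=> c) ;
  rateD : forall f g, F f -> F g -> F (fun e => f e + g e) ;
  rateM : forall f g, F f -> F g -> F (fun e => f e * g e) }.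

Definition slow_rate : set (R -> R) := [set g | (forall e, 0 <= g e) /\
  forall q : nat, exists2 C : R, 0 <= C & \forall e \near 0^'+, g e ^+ q <= C * e^-1].

Definition moderate_rate : set (R -> R) := [set g | (forall e, 0 <= g e) /\
  exists N : nat, exists2 C : R, 0 <= C & \forall e \near 0^'+, g e <= C * e ^- N].

Lemma nearV_ge1 : \forall e \near (0 : R)^'+, 1 <= e^-1.
Proof.
have := near0_itv R; apply: filterS => e /andP[e0 e1].
by rewrite -invr1 lef_pV2 ?posrE.
Qed.

Lemma expr_addr_le (a b : R) q : 0 <= a -> 0 <= b ->
  (a + b) ^+ q <= 2 ^+ q * (a ^+ q + b ^+ q).
Proof.
move=> a0 b0; wlog ab : a b a0 b0 / a <= b => [H|].
  by case/orP: (le_total a b) => ab; [exact: H|rewrite addrC [a ^+ q + _]addrC; exact: H].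
apply: (@le_trans _ _ ((2 * b) ^+ q)).
  by rewrite lerXn2r ?nnegrE ?addr_ge0 ?mulr_ge0// mulrDl mul1r lerD2r.
by rewrite exprMn ler_wpM2l ?exprn_ge0// lerDr exprn_ge0.
Qed.

Lemma slow_rate_class : rate_class slow_rate.
Proof.
split=> [g e [g0 _] //|c c0|f g [f0 fs] [g0 gs]|f g [f0 fs] [g0 gs]].
- split=> // q; exists (c ^+ q); first exact: exprn_ge0.
  apply: filterS nearV_ge1 => e He.
  by rewrite ler_peMr// exprn_ge0.
- split=> [e|q]; first exact: addr_ge0.
  have [C1 C10 H1] := fs q; have [C2 C20 H2] := gs q.
  exists (2 ^+ q * (C1 + C2)); first by rewrite mulr_ge0 ?addr_ge0 ?exprn_ge0.
  apply: filterS (filterI H1 H2) => e [h1 h2].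
  apply: le_trans (expr_addr_le q (f0 e) (g0 e)) _.
  by rewrite -mulrA ler_wpM2l ?exprn_ge0// mulrDl lerD.
- split=> [e|q]; first exact: mulr_ge0.
  (* The doubled exponent allows the product to be bounded by the sum of the squares. *)
  have [C1 C10 H1] := fs (q + q)%N; have [C2 C20 H2] := gs (q + q)%N.
  exists (C1 + C2); first by rewrite addr_ge0.
  apply: filterS (filterI H1 H2) => e [h1 h2].
  apply: (@le_trans _ _ (f e ^+ (q + q) + g e ^+ (q + q))); last by rewrite mulrDl lerD.
  rewrite exprMn !exprD; set a := f e ^+ q; set b := g e ^+ q.
  have := sqr_ge0 (a - b); have : 0 <= a * b by rewrite mulr_ge0 ?exprn_ge0.
  by rewrite expr2; lra.
Qed.

Lemma moderate_rate_class : rate_class moderate_rate.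
Proof.
split=> [g e [g0 _] //|c c0|f g [f0 [M [C C0 fs]]] [g0 [N [D D0 gs]]]|f g [f0 [M [C C0 fs]]] [g0 [N [D D0 gs]]]].
- split=> //; exists 0%N, c => //; near=> e; by rewrite expr0 invr1 mulr1.
- split=> [e|]; first exact: addr_ge0.
  exists (maxn M N), (C + D); first exact: addr_ge0.
  apply: filterS (filterI (near0_itv R) (filterI fs gs)) => e [e01 [h1 h2]].
  rewrite mulrDl lerD//; [apply: le_trans h1 _|apply: le_trans h2 _].
    by apply: ler_wpM2l => //; apply: exprV_le_mono e01 _; exact: leq_maxl.
  by apply: ler_wpM2l => //; apply: exprV_le_mono e01 _; exact: leq_maxr.
- split=> [e|]; first exact: mulr_ge0.
  exists (M + N)%N, (C * D); first exact: mulr_ge0.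
  apply: filterS (filterI fs gs) => e [h1 h2].
  by rewrite exprD invfM mulrACA ler_pM.
Unshelve. all: by end_near. Qed.

Lemma slow_moderate g : slow_rate g -> moderate_rate g.
Proof.
by move=> [g0 /(_ 1%N) [C C0 gC]]; split=> //; exists 1%N, C.
Qed.

Definition bounded_rate T (F : set (R -> R)) (X : set T) (f : R -> T -> R[i]) : Prop :=
  exists2 g, F g & \forall e \near 0^'+, forall x, X x -> normc (f e x) <= g e.

Lemma bounded_rateW T (F G : set (R -> R)) (X : set T) (f : R -> T -> R[i]) : F `<=` G ->
  bounded_rate F X f -> bounded_rate G X f.
Proof. by move=> FG [g Fg H]; exists g => //; exact: FG. Qed.

Section Reg.
Variables (F : set (R -> R)) (rF : rate_class F).

Lemma bounded_rateD T (X : set T) (f g : R -> T -> R[i]) : bounded_rate F X f ->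
  bounded_rate F X g -> bounded_rate F X (fun e x => f e x + g e x).
Proof.
move=> [a Fa Ha] [b Fb Hb]; exists (fun e => a e + b e); first exact: rateD.
apply: filterS (filterI Ha Hb) => e [h1 h2] x Xx.
by apply: le_trans (le_normcD _ _) _; rewrite lerD ?h1 ?h2.
Qed.

Lemma bounded_rateM T (X : set T) (f g : R -> T -> R[i]) : bounded_rate F X f ->
  bounded_rate F X g -> bounded_rate F X (fun e x => f e x * g e x).
Proof.
move=> [a Fa Ha] [b Fb Hb]; exists (fun e => a e * b e); first exact: rateM.
apply: filterS (filterI Ha Hb) => e [h1 h2] x Xx.
by rewrite normcM ler_pM ?normc_ge0 ?h1 ?h2.
Qed.

Lemma bounded_rate_cst T (X : set T) (c : R[i]) : bounded_rate F X (fun _ _ => c).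
Proof.
exists (fun=> normc c); first by apply: rate_cst rF _ (normc_ge0 c).
by near=> e => x _.
Unshelve. all: by end_near. Qed.

Variables (d : nat) (S : set (set 'rV[R]_d)).
Implicit Types f g : R -> 'rV[R]_d -> R[i].

(* F is the admitted rate of growth in e; the estimates are uniform on each of the
   sets of S, which are strips |t| <= T or compact sets below. *)
Definition regn k f : Prop := forall s : seq 'I_d, (size s <= k)%N ->
  (forall e : R, 0 < e <= 1 -> forall x, C1_at (cpartials s (f e)) x) /\
  (forall X, S X -> bounded_rate F X (fun e => cpartials s (f e))).

Lemma regn_eq k f g : (forall e : R, 0 < e <= 1 -> f e = g e) -> regn k g -> regn k f.
Proof.
move=> fg H s sk; have [H1 H2] := H s sk; split.
  by move=> e e01 x; rewrite fg//; exact: H1.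
move=> X SX; have [a Fa Ha] := H2 X SX; exists a => //.
by apply: filterS (filterI (near0_itv R) Ha) => e [e01 h]; rewrite fg.
Qed.

Lemma regnW m k f : (m <= k)%N -> regn k f -> regn m f.
Proof. by move=> mk H s sm; apply: H; exact: leq_trans mk. Qed.

Lemma regn_C1 k f (e : R) x : regn k f -> 0 < e <= 1 -> C1_at (f e) x.
Proof. by move=> /(_ [::] isT)[H _] e01; exact: H. Qed.

Lemma regn_C1_partial k f (e : R) j x : regn k.+1 f -> 0 < e <= 1 -> C1_at (cpartial j (f e)) x.
Proof. by move=> /(_ [:: j] isT)[H _] e01; exact: H. Qed.

Lemma regn_bounded k f X : regn k f -> S X -> bounded_rate F X f.
Proof. by move=> /(_ [::] isT)[_ H]; exact: H. Qed.

Lemma regn0 f : (forall e : R, 0 < e <= 1 -> forall x, C1_at (f e) x) ->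
  (forall X, S X -> bounded_rate F X f) -> regn 0 f.
Proof. by move=> f1 fb s; rewrite leqn0 => /nilP ->. Qed.

Lemma regnS k f : regn 0 f -> (forall j, regn k (fun e => cpartial j (f e))) ->
  regn k.+1 f.
Proof.
move=> f0 fp s; case/lastP: s => [_|s j]; first exact: f0.
rewrite size_rcons ltnS => sk; have [H1 H2] := fp j s sk.
split=> [e e01|X SX]; first by rewrite cpartials_rcons; exact: H1.
have [a Fa Ha] := H2 X SX; exists a => //.
by apply: filterS Ha => e h; rewrite cpartials_rcons.
Qed.

Lemma regn_partial k f j : regn k.+1 f -> regn k (fun e => cpartial j (f e)).
Proof.
move=> H s sk; have := H (rcons s j); rewrite size_rcons => /(_ sk) [H1 H2].
split=> [e e01|X SX]; first by rewrite -cpartials_rcons; exact: H1.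
have [a Fa Ha] := H2 X SX; exists a => //.
by apply: filterS Ha => e h; rewrite -cpartials_rcons.
Qed.

Lemma regnD k f g : regn k f -> regn k g -> regn k (fun e x => f e x + g e x).
Proof.
have R0 m f' g' : regn m f' -> regn m g' -> regn 0 (fun e x => f' e x + g' e x).
  move=> fm gm; apply: regn0 => [e e01 x|X SX].
    by apply: (@C1_atD _ _ (f' e) (g' e)); [exact: regn_C1 fm e01|exact: regn_C1 gm e01].
  by apply: bounded_rateD; [exact: regn_bounded fm SX|exact: regn_bounded gm SX].
elim: k f g => [|k IHk] f g fk gk; first exact: R0 fk gk.
apply: regnS => [|j]; first exact: R0 fk gk.
apply: regn_eq (IHk _ _ (regn_partial j fk) (regn_partial j gk)) => e e01.
apply/funext => x; apply: (@cpartialD _ _ j (f e) (g e)).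
  exact: regn_C1 fk e01.
exact: regn_C1 gk e01.
Qed.

Lemma regnM k f g : regn k f -> regn k g -> regn k (fun e x => f e x * g e x).
Proof.
have R0 m f' g' : regn m f' -> regn m g' -> regn 0 (fun e x => f' e x * g' e x).
  move=> fm gm; apply: regn0 => [e e01 x|X SX].
    by apply: (@C1_atM _ _ (f' e) (g' e)); [exact: regn_C1 fm e01|exact: regn_C1 gm e01].
  by apply: bounded_rateM; [exact: regn_bounded fm SX|exact: regn_bounded gm SX].
elim: k f g => [|k IHk] f g fk gk; first exact: R0 fk gk.
apply: regnS => [|j]; first exact: R0 fk gk.
apply: regn_eq (regnD (IHk _ _ (regn_partial j fk) (regnW (leqnSn k) gk))
   (IHk _ _ (regnW (leqnSn k) fk) (regn_partial j gk))) => e e01.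
apply/funext => x; apply: (@cpartialM _ _ j (f e) (g e)).
  exact: regn_C1 fk e01.
exact: regn_C1 gk e01.
Qed.

Lemma regn_cst k (c : R[i]) : regn k (fun _ _ => c).
Proof.
move=> s sk; split=> [e e01 x|X SX]; first exact: (@smooth_cst _ _ c s).
have := bounded_rate_cst X (if nilp s then c else 0); case=> a Fa Ha; exists a => //.
apply: filterS Ha => e Ha x Xx; rewrite -[X in cpartials s X]/(cst c) cpartials_cst.
exact: (Ha x Xx).
Qed.

Lemma regn_sum k (I : Type) (r : seq I) (f : I -> R -> 'rV[R]_d -> R[i]) :
  (forall i, regn k (f i)) -> regn k (fun e x => \sum_(i <- r) f i e x).
Proof.
move=> H; elim: r => [|i r IHr].
  by apply: regn_eq (@regn_cst k 0) => e e01; apply/funext => x; rewrite big_nil.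
by apply: regn_eq (regnD (H i) IHr) => e e01; apply/funext => x; rewrite big_cons.
Qed.

(** The exponential of a net of rate F need not have rate F, so its size is assumed; its derivatives
    then follow from the chain rule. *)
Lemma regn_cexp k f : (forall X, S X -> bounded_rate F X (fun e x => cexp (f e x))) ->
  regn k f -> regn k (fun e x => cexp (f e x)).
Proof.
move=> cb; have R0 m (fm : regn m f) : regn 0 (fun e x => cexp (f e x)).
  apply: regn0 => [e e01 x|//]; apply: (@C1_at_cexp _ _ (f e)); exact: regn_C1 fm e01.
elim: k => [|k IHk] fk; first exact: R0 fk.
apply: regnS => [|j]; first exact: R0 fk.
apply: regn_eq (regnM (regn_partial j fk) (IHk (regnW (leqnSn k) fk))) => e e01.
apply/funext => x; apply: (@cpartial_cexp _ _ (f e)); exact: regn_C1 fk e01.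
Qed.

End Reg.

(** * Nets on strips under primitives and shears *)

Section RegStrip.
Variables (F : set (R -> R)) (rF : rate_class F) (n : nat).

(** Unbounded in x and therefore mapped into itself by every shear, whatever the size of the
    shift. *)
Definition strip (T : R) : set 'rV[R]_n.+1 := [set z | `|z ord0 ord0| <= T].
Definition strips : set (set 'rV[R]_n.+1) := [set strip T | T in [set: R]].
Implicit Types f : R -> 'rV[R]_n.+1 -> R[i].

Lemma bounded_rate_prim T f : (forall e : R, 0 < e <= 1 -> forall x, C1_at (f e) x) ->
  bounded_rate F (strip T) f -> bounded_rate F (strip T) (fun e => cprim (f e)).
Proof.
move=> f1 [a Fa Ha]; exists (fun e => 2 * a e * `|T|).
  by apply: rateM (rate_cst rF _) => //; apply: rateM (rate_cst rF _) Fa.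
apply: filterS (filterI (near0_itv R) Ha) => e [e01 h] z zT.
have [|H _] := @normc_cprim _ _ (f e) z (a e) (f1 e e01).
  by move=> s sz; apply: h; rewrite /strip /= spacetime0 (le_trans sz).
apply: le_trans H _; apply: ler_wpM2l; first by rewrite mulr_ge0 ?(rate_ge0 rF e Fa).
exact: le_trans zT (ler_norm _).
Qed.

(** One order is lost, since the x-derivatives of a primitive are taken under the integral; the time
    derivative gives back [f]. *)
Lemma regn_prim k f : regn F strips k.+1 f -> regn F strips k (fun e => cprim (f e)).
Proof.
have R0 m f' : regn F strips m.+1 f' -> regn F strips 0 (fun e => cprim (f' e)).
  move=> fm; apply: regn0 => [e e01 x|X [T _ <-]].
    by apply: C1_at_cprim => [y|j y]; [exact: regn_C1 fm e01|exact: regn_C1_partial fm e01].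
  apply: bounded_rate_prim => [e e01 x|]; first exact: regn_C1 fm e01.
  by apply: regn_bounded fm _; exists T.
elim: k f => [|k IHk] f fk; first exact: R0 fk.
apply: regnS => [|j]; first exact: R0 fk.
case: (unliftP ord0 j) => [i ->|->].
  apply: regn_eq (IHk _ (regn_partial (lift ord0 i) fk)) => e e01.
  by apply: cpartial_cprim_space => [y|l y]; [exact: regn_C1 fk e01|exact: regn_C1_partial fk e01].
apply: regn_eq (regnW _ fk) => [e e01|]; last by rewrite ltnW.
by apply: cpartial_cprim_time => y; exact: regn_C1 fk e01.
Qed.

Section RegShear.
Variables (L L' : R -> 'I_n -> R -> R).
Hypothesis dL : forall e : R, 0 < e <= 1 -> forall j (t : R), is_derive t 1 (L e j) (L' e j t).
Hypothesis rL : forall k j, regn F strips k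
  (fun e (z : 'rV[R]_n.+1) => (L' e j (z ord0 ord0) +i* 0)%C).

Lemma bounded_rate_shear T f : bounded_rate F (strip T) f ->
  bounded_rate F (strip T) (fun e z => f e (shear (L e) z)).
Proof.
move=> [a Fa Ha]; exists a => //; apply: filterS Ha => e Ha z zT; apply: Ha.
by rewrite /strip /= shear0.
Qed.

(** A time derivative also falls on the shift and brings in its velocity, whose rate is the
    assumption [rL]; the shift itself needs no bound on strips. *)
Lemma regn_shear k f : regn F strips k.+1 f ->
  regn F strips k (fun e z => f e (shear (L e) z)).
Proof.
have R0 m f' : regn F strips m.+1 f' -> regn F strips 0 (fun e z => f' e (shear (L e) z)).
  move=> fm; apply: regn0 => [e e01 x|X [T _ <-]].
    apply: (@C1_at_shear _ _ _ _ (dL e01) (f' e)) => [y|j y]; first exact: regn_C1 fm e01.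
    exact: regn_C1_partial fm e01.
  by apply: bounded_rate_shear; apply: regn_bounded fm _; exists T.
elim: k f => [|k IHk] f fk; first exact: R0 fk.
apply: regnS => [|j]; first exact: R0 fk.
have f1 (e : R) y : 0 < e <= 1 -> C1_at (f e) y by move=> e01; exact: regn_C1 fk e01.
have f2 (e : R) l y : 0 < e <= 1 -> C1_at (cpartial l (f e)) y.
  by move=> e01; exact: regn_C1_partial fk e01.
case: (unliftP ord0 j) => [i ->|->].
  apply: regn_eq (IHk _ (regn_partial (lift ord0 i) fk)) => e e01.
  by apply: cpartial_shear_space => *; [exact: f1|exact: f2].
have H1 := IHk _ (regn_partial ord0 fk).
have H2 i := regnM rF (@rL k i) (IHk _ (regn_partial (lift ord0 i) fk)).
apply: regn_eq (regnD rF H1 (regn_sum rF (index_enum 'I_n) H2)) => e e01.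
by apply/funext => z; apply: (cpartial_shear_time (dL e01)) => *; [exact: f1|exact: f2].
Qed.

End RegShear.
End RegStrip.
End RateClasses.

(** * Representatives and cut-offs *)

Section SlowScale.
Variable R : realType.

Lemma slow_scale_rate (mu : R -> R[i]) : slow_scale mu -> slow_rate (fun e => normc (mu e)).
Proof.
move=> H; split=> [e|q]; first exact: normc_ge0.
have [C C0 HC] := H q%:R (ler0n _ _); exists C; first exact: ltW.
by apply: filterS HC => e; rewrite powR_mulrn// normc_ge0.
Qed.

Lemma slow_scale_expR (mu : R -> R[i]) (c : R) : slow_scale mu -> 0 <= c ->
  slow_rate (fun e => expR (c * ln (normc (mu e)))).
Proof.
move=> H c0; split=> [e|q]; first exact: expR_ge0.
have [C C0 HC] := H (q%:R * c) (mulr_ge0 (ler0n _ _) c0).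
exists (C + 1); first by rewrite addr_ge0// ltW.
apply: filterS (filterI (nearV_ge1 R) HC) => e [e1 h].
rewrite -expRM_natl mulrA mulrDl mul1r.
apply: (@le_trans _ _ (normc (mu e) `^ (q%:R * c) + 1)); last exact: lerD.
(* Where [mu e] vanishes the logarithm is 0 by convention and the exponential is 1; the summand 1
   covers this. *)
rewrite /powR; case: eqP => [->|_]; last by rewrite lerDl.
by rewrite ln0// mulr0 expR0 lerDr; case: (_ == _).
Qed.

Lemma moderate_bounded_rate d (w : mnet R d) (K : set 'rV[R]_d) s : compact K ->
  bounded_rate (@moderate_rate R) K (fun e => cpartials s (w e)).
Proof.
move=> Kc; have [_ /(_ K Kc s) [N [C C0 HC]]] := moderateP _ (mnetP w).
(* The absolute value makes the rate nonnegative for all real [e], not only for e > 0. *)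
exists (fun e => C * `|e ^- N|).
  split=> [e|]; first by rewrite mulr_ge0// ltW.
  exists N, C; first exact: ltW.
  apply: filterS (near0_itv R) => e e01; rewrite ger0_norm// exprV_ge0//.
apply: filterS (filterI (near0_itv R) HC) => e [e01 h] x Kx.
by rewrite ger0_norm ?exprV_ge0// h.
Qed.

Lemma cpartials_repr d (v w : mnet R d) (e : R) s x : 0 < e <= 1 ->
  normc (cpartials s (w e) x) <=
    normc (cpartials s (v e) x) + normc (cpartials s ((w - v : mnet R d) e) x).
Proof.
move=> e01; have -> : mnet_val w e = v e + (w - v : mnet R d) e.
  by apply/funext => y; rewrite -[RHS]/(v e y + (w e y - v e y)) subrKC.
rewrite cpartialsD; [exact: le_normcD|exact: (mnet_smooth v)|exact: (mnet_smooth (w - v))].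
Qed.

(** The assumption concerns some representative. It passes to every other one, because the
    difference is negligible, in particular O(1), and constants are slow rates. *)
Lemma slow_regular_bounded_rate d (w : mnet R d) (K : set 'rV[R]_d) s :
  slow_scale_regular (gclass w) -> compact K ->
  bounded_rate (@slow_rate R) K (fun e => cpartials s (w e)).
Proof.
move=> [v vw Hv] Kc; have [mu /slow_scale_rate smu [C C0 HC]] := Hv K Kc s.
have /gclassP/(_ K Kc s 0%N)[D D0 HD] := esym vw.
exists (fun e => C * normc (mu e) + D).
  have rF := slow_rate_class R; apply: (rateD rF); last exact: (rate_cst rF (ltW D0)).
  exact: (rateM rF (rate_cst rF (ltW C0)) smu).
apply: filterS (filterI (near0_itv R) (filterI HC HD)) => e [e01 [h1 h2]] x Kx.
apply: le_trans (cpartials_repr v w s x e01) _; apply: lerD; first exact: h1.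
by have := h2 x Kx; rewrite expr0 mulr1.
Qed.

(** With b = C ln |mu| + D, exp (T b) is a constant times |mu|^(T C), and powers of slow scale nets
    are slow scale. Change of representative only adds the constant D. *)
Lemma slow_log_expR d (w : mnet R d) (K : set 'rV[R]_d) (T : R) :
  slow_scale_log (gclass w) -> compact K -> 0 <= T ->
  exists2 g, slow_rate g & exists2 b : R -> R, (forall e, expR (T * b e) <= g e) &
    \forall e \near 0^'+, forall x, K x -> normc (w e x) <= b e.
Proof.
move=> [v vw Hv] Kc T0; have [mu smu [C C0 HC]] := Hv K Kc.
have /gclassP/(_ K Kc [::] 0%N)[D D0 HD] := esym vw.
exists (fun e => expR (T * C * ln (normc (mu e))) * expR (T * D)).
  have rF := slow_rate_class R; apply: (rateM rF); last exact: (rate_cst rF (expR_ge0 _)).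
  by apply: slow_scale_expR => //; rewrite mulr_ge0// ltW.
exists (fun e => C * ln (normc (mu e)) + D); first by move=> e; rewrite -expRD mulrDr mulrA.
apply: filterS (filterI (near0_itv R) (filterI HC HD)) => e [e01 [h1 h2]] x Kx.
apply: le_trans (cpartials_repr v w [::] x e01) _; apply: lerD; first exact: h1.
by have := h2 x Kx; rewrite expr0 mulr1.
Qed.

End SlowScale.

(** * Supports and cut-off representatives *)

Section Cutoff.
Variable R : realType.

Lemma moderate_smooth d (chi : 'rV[R]_d -> R[i]) : smooth chi ->
  (fun _ : R => chi) \in moderate R d.
Proof.
move=> cs; apply/moderateP; split=> // K Kc s; exists 0%N.
have [B B0 HB] := compact_bound Kc (smooth_cpartials s cs); exists B => //.
by near=> e => x Kx; rewrite expr0 invr1 mulr1 HB.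
Unshelve. all: by end_near. Qed.

Definition msmooth d (chi : 'rV[R]_d -> R[i]) (cs : smooth chi) : mnet R d :=
  MNet (moderate_smooth cs).

Lemma compact_cball d (x : 'rV[R]_d) (r : R) : compact [set y | `|y - x| <= r].
Proof.
have -> : [set y | `|y - x| <= r] = (fun y => y + x) @` [set y : 'rV[R]_d | `|y| <= r].
  apply/seteqP; split=> [y yr|_ [y yr <-]] /=; last by rewrite addrK.
  by exists (y - x); rewrite ?subrK.
apply: continuous_compact; last exact: compact_ball.
by apply: continuous_subspaceT => y; apply: continuousD => //; exact: cst_continuous.
Qed.

(** Every point of [K] has a ball on which some representative is negligible; compactness merges
    these local statements into one for small [e]. *)
Lemma negligible_off_gsupp d (w : mnet R d) (K : set 'rV[R]_d) : compact K ->
  K `<=` ~` gsupp (gclass w) -> forall s q,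
  bigO_on K (fun e x => normc (cpartials s (w e) x)) (fun e => e ^+ q).
Proof.
move=> Kc Ks s q; exists 1 => //.
move/(@compact_near_coveringP 'rV[R]_d) : Kc => Kc.
apply: (Kc R 0^'+ (fun e x => normc (cpartials s (w e) x) <= 1 * e ^+ q) _) => x Kx.
have /contrapT [V [Vo [v vw Hv]] Vx] := Ks x Kx.
have /nbhs_ballP[r /= r0 rV] : nbhs x V by exact: open_nbhs_nbhs.
have r2 : 0 < r / 2 by rewrite divr_gt0.
have BV : [set y | `|y - x| <= r / 2] `<=` V.
  move=> y /= yx; apply: rV; rewrite -ball_normE /= distrC; apply: le_lt_trans yx _.
  by rewrite ltr_pdivrMr// ltr_pMr// ltr1n.
have Bc := @compact_cball d x (r / 2).
(* The constants depend on the ball. The extra power of [e] absorbs them, so that the bound with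
   constant 1 can be passed through the covering. *)
have [C C0 HC] := Hv _ Bc BV s q.+1.
have /gclassP/(_ _ Bc s q.+1)[D D0 HD] := esym vw.
exists ([set y | `|y - x| <= r / 2],
        [set e | forall y, `|y - x| <= r / 2 -> normc (cpartials s (w e) y) <= 1 * e ^+ q]) => /=.
  split.
    by apply/nbhs_ballP; exists (r / 2) => // y; rewrite -ball_normE /= distrC => /ltW.
  have sm : \forall e \near (0 : R)^'+, e <= (C + D)^-1.
    by apply: nbhs_right_le; rewrite invr_gt0 addr_gt0.
  apply: filterS (filterI sm (filterI (near0_itv R) (filterI HC HD))) => e [es [e01 [h1 h2]]] y yx.
  have /andP[e0 _] := e01; apply: le_trans (cpartials_repr v w s y e01) _.
  apply: le_trans (lerD (h1 y yx) (h2 y yx)) _.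
  rewrite -mulrDl mul1r exprS mulrA ler_piMl ?exprn_ge0 ?(ltW e0)//.
  by rewrite -ler_pdivlMl ?addr_gt0// mulr1.
by move=> [y e] /= [h1 h2]; exact: h2.
Qed.

(** The error is (chi - 1) w: it vanishes with all derivatives on the open set [V], and on the
    compact set K minus V, which misses the support, [w] is negligible. *)
Lemma gclass_cutoff d (chi : 'rV[R]_d -> R[i]) (cs : smooth chi) (w : mnet R d)
  (V : set 'rV[R]_d) : open V -> (forall x, V x -> chi x = 1) ->
  gsupp (gclass w) `<=` V -> gclass (msmooth cs * w) = gclass w.
Proof.
move=> Vo V1 wV; apply/gclassP => K Kc s q.
pose g := chi + cst (-1).
have gs : smooth g := smoothD cs (@smooth_cst _ _ _).
have E e : (msmooth cs * w - w : mnet R d) e = g * w e.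
  apply/funext => x; rewrite -[LHS]/(chi x * w e x - w e x) -[RHS]/((chi x - 1) * w e x).
  by rewrite mulrBl mul1r.
have K'c : compact (K `&` ~` V) by apply: compact_closedI => //; exact: open_closedC.
have wK : forall s, bigO_on (K `&` ~` V) (fun e x => normc (cpartials s (w e) x)) (fun e => e ^+ q).
  move=> s'; apply: negligible_off_gsupp => // x [_ nV] /wV; exact: nV.
have gK s' : exists2 B : R, 0 < B & forall x, (K `&` ~` V) x -> normc (cpartials s' g x) <= B.
  exact: compact_bound (smooth_cpartials s' gs).
have [C C0 HC] := bigO_smoothM gs gK (mnet_smooth w) wK s.
exists C => //; apply: filterS (filterI (near0_itv R) HC) => e [/andP[e0 _] h] x Kx.
rewrite E; have [Vx|nVx] := pselect (V x); last exact: h.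
have gV y : V y -> (g * w e) y = (fun=> 0) y.
  by move=> /V1 y1; rewrite -[LHS]/((chi y - 1) * w e y) y1 subrr mul0r.
rewrite (cpartials_eq_open s Vo gV Vx).
by rewrite cpartials0 normc0 mulr_ge0 ?exprn_ge0 ?ltW.
Qed.

End Cutoff.

Section SpaceFunctions.
Variables (R : realType) (n : nat).
Implicit Types f : 'rV[R]_n -> R[i].

Lemma space_shift (z : 'rV[R]_n.+1) h k :
  space (h *: basis_vec R k + z) =
  h *: (if unlift ord0 k is Some j then basis_vec R j else 0) + space z.
Proof.
apply/rowP => i; case: (unliftP ord0 k) => [j ->|->]; rewrite !mxE /=.
  by rewrite (inj_eq lift_inj).
by rewrite mulr0 add0r.
Qed.

Lemma C1_at_space f z : C1_at f (space z) -> C1_at (f \o @space R n) z.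
Proof.
move=> [f1 f2 f3 f4]; split.
- exact: (continuous_comp (@space_continuous R n z) f1).
- exact: (continuous_comp (@space_continuous R n z) f2).
- move=> k; rewrite /derivable; under eq_fun do rewrite /= space_shift.
  case: (unlift ord0 k) => [j|]; first exact: f3.
  by under eq_fun do rewrite scaler0 add0r subrr scaler0; exact: is_cvg_cst.
- move=> k; rewrite /derivable; under eq_fun do rewrite /= space_shift.
  case: (unlift ord0 k) => [j|]; first exact: f4.
  by under eq_fun do rewrite scaler0 add0r subrr scaler0; exact: is_cvg_cst.
Qed.

Lemma derive_space (g : 'rV[R]_n -> R) (z : 'rV[R]_n.+1) k :
  'D_(basis_vec R k) (fun z : 'rV[R]_n.+1 => g (space z)) z =
  if unlift ord0 k is Some j then 'D_(basis_vec R j) g (space z) else 0.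
Proof.
rewrite /derive; under eq_fun do rewrite /= space_shift.
case: (unlift ord0 k) => [//|].
under eq_fun do rewrite scaler0 add0r subrr scaler0.
exact: lim_cst.
Qed.

Lemma cpartial_space k f : cpartial k (f \o @space R n) =
  if unlift ord0 k is Some j then cpartial j f \o @space R n else cst 0.
Proof.
apply/funext => z; rewrite /cpartial /=.
rewrite (derive_space (fun z => Re (f z))) (derive_space (fun z => Im (f z))).
by case: (unlift ord0 k).
Qed.

(** Either all derivatives are in space, or one is in time and annihilates the function. *)
Lemma cpartials_space (s : seq 'I_n.+1) :
  (exists s', forall f, cpartials s (f \o @space R n) = cpartials s' f \o @space R n) \/
  (forall f, cpartials s (f \o @space R n) = cst 0).
Proof.
elim: s => [|k s [[s' IH]|IH]]; first by left; exists [::].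
- case E : (unlift ord0 k) => [j|].
    by left; exists (j :: s') => f; rewrite /= IH cpartial_space E.
  by right=> f; rewrite /= IH cpartial_space E.
- by right=> f; rewrite /= IH cpartial_cst.
Qed.

Lemma smooth_space f : smooth f -> smooth (f \o @space R n).
Proof.
move=> fs s z; have [[s' ->]|->] := cpartials_space s; first exact/C1_at_space/fs.
exact: (@smooth_cst _ _ 0 [::]).
Qed.

End SpaceFunctions.

(** * Estimates on strips from estimates on compact sets *)

Section StripBounds.
Variables (R : realType) (F : set (R -> R)) (rF : rate_class F) (n : nat).

Lemma regn_compact d (f : R -> 'rV[R]_d -> R[i]) k : smooth_net f ->
  (forall K s, compact K -> bounded_rate F K (fun e => cpartials s (f e))) ->
  regn F compact k f.
Proof. by move=> fs fb s sk; split=> [e e01 x|X Xc]; [exact: fs|exact: fb]. Qed.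

Lemma open_space_gt (b : R) : open [set z : 'rV[R]_n.+1 | b < `|space z|].
Proof.
rewrite -[X in open X]/(@space R n @^-1` [set x | b < `|x|]).
by apply: open_comp; [move=> z _; exact: space_continuous|exact: open_norm_gt].
Qed.

(** Off |x| <= b all derivatives vanish, and the rest of a strip lies in a ball. *)
Lemma regn_strip_compact k (b : R) (f : R -> 'rV[R]_n.+1 -> R[i]) :
  (forall e : R, 0 < e <= 1 -> forall z, b < `|space z| -> f e z = 0) ->
  regn F compact k f -> regn F (@strips R n) k f.
Proof.
move=> f0 fk s sk; have [H1 H2] := fk s sk; split=> // X [T _ <-].
have [a Fa Ha] := H2 _ (@compact_ball R n.+1 (Num.max (Num.max T b) 0)).
exists a => //; apply: filterS (filterI (near0_itv R) Ha) => e [e01 h] z zT.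
have [zb|bz] := leP `|space z| b.
  apply: h => /=; apply/rV_norm_leP => [|k']; first by rewrite le_max lexx orbT.
  rewrite !le_max; case: (unliftP ord0 k') => [j ->|->]; last by rewrite zT.
  have := coord_le_norm (space z) j; rewrite mxE => H.
  by rewrite (le_trans H zb) orbT.
rewrite (@cpartials_eq_open _ _ _ (f e) (fun=> 0) s (@open_space_gt b) (f0 e e01) _ bz).
by rewrite cpartials0 normc0 (rate_ge0 rF).
Qed.

Lemma regn_space k (b : R) (f : R -> 'rV[R]_n -> R[i]) :
  (forall e : R, 0 < e <= 1 -> forall x, b < `|x| -> f e x = 0) ->
  smooth_net f -> (forall K s, compact K -> bounded_rate F K (fun e => cpartials s (f e))) ->
  regn F (@strips R n) k (fun e z => f e (space z)).
Proof.
move=> f0 fs fb; apply: (@regn_strip_compact _ b) => [e e01 z|]; first exact: f0.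
apply: regn_compact => [e e01|K s Kc]; first exact: smooth_space (fs e e01).
have Kc' : compact (@space R n @` K).
  by apply: continuous_compact => //; apply: continuous_subspaceT; exact: space_continuous.
have [[s' Es]|Es] := cpartials_space R s.
  have [a Fa Ha] := fb _ s' Kc'; exists a => //; apply: filterS Ha => e h x Kx.
  by rewrite -[X in cpartials s X]/(f e \o @space R n) Es; apply: h; exists x.
exists (fun=> 0); first exact: rate_cst.
by near=> e => x _; rewrite -[X in cpartials s X]/(f e \o @space R n) Es normc0.
Unshelve. all: by end_near. Qed.

(** Strip bounds are uniform in x, hence the slice is bounded on the whole space. *)
Lemma bounded_rate_slice (f : R -> 'rV[R]_n.+1 -> R[i]) t s :
  (forall k, regn F (@strips R n) k f) ->
  bounded_rate F setT (fun e => cpartials s (fun x : 'rV[R]_n => f e (spacetime t x))).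
Proof.
move=> fk; have [_ H] := fk (size s) (map (lift ord0) s) (eq_leq (size_map _ _)).
have [|a Fa Ha] := H (strip `|t|); first by exists `|t|.
exists a => //; apply: filterS Ha => e h x _.
rewrite -[X in cpartials s X]/(f e \o spacetime t) cpartials_slice /=.
by apply: h; rewrite /strip /= spacetime0.
Qed.

Lemma regn_pull k (a : R -> 'rV[R]_1 -> R[i]) : smooth_net a ->
  (forall K s, compact K -> bounded_rate F K (fun e => cpartials s (a e))) ->
  regn F (@strips R n) k (fun e z => a e (const_mx (z ord0 ord0))).
Proof.
move=> as_ ab s sk; split=> [e e01 x|X [T _ <-]].
  rewrite cpartials_pull; case: ifP => _; last exact: (@smooth_cst _ _ 0 [::]).
  by apply: C1_at_pull; exact: as_.
have [g Fg Hg] := ab _ (nseq (size s) ord0) (@compact_ball R 1 (Num.max T 0)).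
exists g => //; apply: filterS Hg => e h z zT; rewrite cpartials_pull; case: ifP => _.
  apply: h => /=; apply/rV_norm_leP => [|k']; first by rewrite le_max lexx orbT.
  by rewrite mxE le_max zT.
by rewrite normc0 (rate_ge0 rF).
Qed.

End StripBounds.

Lemma moderate_regn (R : realType) n (f : R -> 'rV[R]_n.+1 -> R[i]) :
  (forall k, regn (@moderate_rate R) (@strips R n) k f) -> f \in moderate R n.+1.
Proof.
move=> fk; apply/moderateP; split=> [e e01 s x|K Kc s].
  by have [H _] := fk (size s) s (leqnn _); exact: H.
have [M M0 KM] := compact_norm_bound Kc.
have [_ H] := fk (size s) s (leqnn _).
have [|g [_ [N [C C0 HC]]] Hg] := H (strip M); first by exists M.
exists N, (C + 1); first by rewrite ltr_wpDl.
apply: filterS (filterI (near0_itv R) (filterI HC Hg)) => e [e01 [h1 h2]] x Kx.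
have xM : strip M x by rewrite /strip /=; exact: le_trans (coord_le_norm x ord0) (KM x Kx).
apply: le_trans (h2 x xM) _; apply: le_trans h1 _.
by rewrite mulrDl lerDl mul1r exprV_ge0.
Qed.

(** * The solution of the Cauchy problem *)

Lemma cpartial_shear_transport (R : realType) n (L L' : 'I_n -> R -> R) (f : 'rV[R]_n.+1 -> R[i])
  (z : 'rV[R]_n.+1) : (forall j (t : R), is_derive t 1 (L j) (L' j t)) ->
  (forall x, C1_at f x) -> (forall j x, C1_at (cpartial j f) x) ->
  cpartial ord0 (f \o shear L) z = cpartial ord0 f (shear L z) +
   \sum_j (L' j (z ord0 ord0) +i* 0)%C * cpartial (lift ord0 j) (f \o shear L) z.
Proof.
move=> dL f1 f2; rewrite (cpartial_shear_time dL f1 f2); congr (_ + _).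
by apply: eq_bigr => j _; rewrite (cpartial_shear_space L f1 f2).
Qed.

Section Solution.
Variables (R : realType) (n : nat).
Variables (a : 'I_n -> mnet R 1) (A : mnet R n.+1) (U : mnet R n) (b b' : R).
Hypothesis a_real : forall j, real_net (a j).
Hypothesis a_slow : forall j, slow_scale_regular (gclass (a j)).
Hypothesis A_slow : slow_scale_regular (gclass A).
Hypothesis A_log : slow_scale_log (gclass A).
Hypothesis A_cut : forall e : R, 0 < e <= 1 -> forall z, b < `|space z| -> A e z = 0.
Hypothesis U_cut : forall e : R, 0 < e <= 1 -> forall x, b' < `|x| -> U e x = 0.
Local Notation slow := (@slow_rate R).
Local Notation rslow := (slow_rate_class R).
Local Notation rmod := (moderate_rate_class R).
Local Notation str := (@strips R n).

Let L (e : R) (j : 'I_n) (t : R) : R := Lambda_net (a j) e t.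
Let L' (e : R) (j : 'I_n) (t : R) : R := - Re (a j e (const_mx t)).
Let Lm (e : R) (j : 'I_n) (t : R) : R := - L e j t.

Lemma is_derive_Lambda_net (e : R) j (t : R) : 0 < e <= 1 -> is_derive t 1 (L e j) (L' e j t).
Proof.
move=> e01; have ac : continuous (fun z : R => Re (a j e (const_mx z))).
  move=> z; apply: (@continuous_comp _ _ _ (fun z : R => const_mx z : 'rV[R]_1)
     (fun x => Re (a j e x))).
    by apply: rV_continuous => i; under eq_fun do rewrite mxE; move=> x; exact: cvg_id.
  by have [H _ _ _] := smooth_C1 (const_mx z) (mnet_smooth (a j) e01).
exact: is_deriveN (is_derive_integral_from0 t ac).
Qed.

Lemma is_derive_opp_Lambda_net (e : R) : 0 < e <= 1 ->
  forall j (t : R), is_derive t 1 (Lm e j) (- L' e j t).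
Proof. by move=> e01 j t; exact: is_deriveN (is_derive_Lambda_net j t e01). Qed.

(** Since [a j] is real valued, - L' is [a j] itself, not only its real part. *)
Lemma regn_velocity k j : regn slow str k (fun e z => (- L' e j (z ord0 ord0) +i* 0)%C).
Proof.
have H : regn slow str k (fun e z => a j e (const_mx (z ord0 ord0))).
  apply: (regn_pull rslow (mnet_smooth (a j))) => K s Kc.
  exact: slow_regular_bounded_rate.
apply: regn_eq H => e e01.
apply/funext => z; have := a_real j (const_mx (z ord0 ord0)) e01.
by rewrite /L' opprK; case: (a j e _) => x y /= ->.
Qed.

Lemma regn_velocity_opp k j : regn slow str k (fun e z => (L' e j (z ord0 ord0) +i* 0)%C).
Proof.
have H := regnM rslow (@regn_cst _ _ rslow _ str k (-1)) (@regn_velocity k j).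
apply: regn_eq H => e e01.
by apply/funext => z; rewrite mulN1r; apply: complexP; rewrite /= ?opprK ?oppr0.
Qed.

(* In the coordinates (t, x - Lambda_e(t)) the equation is the linear ordinary
   differential equation d/dt w = i B w, with B the potential A in the shifted
   coordinates; hence w = E U with E = exp (i int_0^t B). *)
Let B (e : R) z : R[i] := A e (shear (L e) z).
Let iC (e : R) z : R[i] := (0 +i* 1)%C * cprim (B e) z.
Let E (e : R) z : R[i] := cexp (iC e z).
Let Em (e : R) z : R[i] := cexp (- iC e z).

Lemma regn_potential k : regn slow str k (A : R -> _ -> _).
Proof.
apply: (@regn_strip_compact _ _ rslow _ _ b) => //.
apply: regn_compact => [|K s Kc]; first exact: mnet_smooth.
exact: slow_regular_bounded_rate.
Qed.

Lemma regn_shifted_potential k : regn slow str k B.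
Proof.
have dL (e : R) : 0 < e <= 1 -> forall j (t : R), is_derive t 1 (L e j) (L' e j t).
  by move=> e01 j t; exact: is_derive_Lambda_net.
exact: (regn_shear rslow dL (@regn_velocity_opp) (@regn_potential k.+1)).
Qed.

Lemma regn_phase k : regn slow str k iC.
Proof.
exact: (regnM rslow (@regn_cst _ _ rslow _ str k _) (regn_prim rslow (@regn_shifted_potential k.+1))).
Qed.

(* The logarithmic type of A makes the exponential of its primitive a slow scale net. *)
Lemma bounded_rate_phase (T : R) : exists2 g, slow g &
  \forall e \near 0^'+, forall z, strip T z -> expR `|Re (iC e z)| <= g e.
Proof.
pose M := Num.max (Num.max `|T| b) 0.
have [g Fg [h hg Hh]] := slow_log_expR A_log (@compact_ball R n.+1 M) (normr_ge0 T).
exists g => //; apply: filterS (filterI (near0_itv R) Hh) => e [e01 He] z zT.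
apply: le_trans (hg e); rewrite ler_expR.
(* The size of the exponential is governed by the imaginary part of the primitive, whose bound
   carries no factor 2. *)
have -> : Re (iC e z) = - Im (cprim (B e) z).
  by rewrite /iC ReM /= mul0r mul1r sub0r.
have M0 : 0 <= M by rewrite le_max lexx orbT.
have h0 : 0 <= h e.
  by apply: le_trans (normc_ge0 (A e 0)) _; apply: He; rewrite /= normr0.
have zT' : `|z ord0 ord0| <= `|T| := le_trans zT (ler_norm T).
have [y|s sz|_ H] := @normc_cprim _ _ (B e) z (h e).
- exact: regn_C1 (@regn_shifted_potential 0) e01.
(* The sheared point may lie far out, but there [A] is cut off; otherwise it lies in the fixed ball
   of radius [M]. *)
- rewrite /B; set y := shear _ _.
  have [yb|by_] := leP `|space y| b; last by rewrite (A_cut e01 by_) normc0.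
  apply: He => /=; apply/rV_norm_leP => // k'.
  rewrite !le_max; case: (unliftP ord0 k') => [j ->|->].
    have := coord_le_norm (space y) j; rewrite mxE => H.
    by rewrite (le_trans H yb) orbT.
  by rewrite /y shear0 spacetime0 (le_trans sz zT').
by rewrite normrN [`|T| * _]mulrC; apply: le_trans H _; exact: ler_wpM2l.
Qed.

Lemma regn_evolution k : regn slow str k E.
Proof.
apply: (regn_cexp rslow _ (@regn_phase k)) => X [T _ <-].
have [g Fg Hg] := bounded_rate_phase T; exists g => //.
apply: filterS Hg => e Hg z zT; rewrite normc_cexp; apply: le_trans (Hg z zT).
by rewrite ler_expR ler_norm.
Qed.

Lemma regn_evolution_inv k : regn slow str k Em.
Proof.
have H := regnM rslow (@regn_cst _ _ rslow _ str k (-1)) (@regn_phase k).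
have H' : regn slow str k (fun e z => - iC e z).
  by apply: regn_eq H => e e01; apply/funext => z; rewrite mulN1r.
apply: (regn_cexp rslow _ H') => X [T _ <-].
have [g Fg Hg] := bounded_rate_phase T; exists g => //.
apply: filterS Hg => e Hg z zT; rewrite normc_cexp; apply: le_trans (Hg z zT).
rewrite ler_expR; have -> : Re (- iC e z) = - Re (iC e z) by case: (iC e z).
by rewrite -normrN ler_norm.
Qed.

Lemma regn_slow_moderate k f : regn slow str k f -> regn (@moderate_rate R) str k f.
Proof.
move=> H s sk; have [H1 H2] := H s sk; split=> // X SX.
exact: (bounded_rateW (@slow_moderate R) (H2 X SX)).
Qed.

Lemma regn_initial k : regn (@moderate_rate R) str k (fun e z => U e (space z)).
Proof.
apply: (@regn_space _ _ rmod _ _ b') => //; first exact: mnet_smooth.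
by move=> K s; exact: moderate_bounded_rate.
Qed.

Let W (e : R) z : R[i] := U e (space z) * E e z.
Let V (e : R) z : R[i] := W e (shear (Lm e) z).

Lemma regn_transported k : regn (@moderate_rate R) str k W.
Proof. exact: (regnM rmod (@regn_initial k) (regn_slow_moderate (@regn_evolution k))). Qed.

Lemma regn_solution k : regn (@moderate_rate R) str k V.
Proof.
exact: (regn_shear rmod is_derive_opp_Lambda_net
  (fun k' j => regn_slow_moderate (@regn_velocity k' j)) (@regn_transported k.+1)).
Qed.

Definition solution_net : mnet R n.+1 := MNet (moderate_regn (@regn_solution)).
Definition evolution_net : mnet R n.+1 :=
  MNet (moderate_regn (fun k => regn_slow_moderate (@regn_evolution k))).
Definition evolution_inv_net : mnet R n.+1 :=
  MNet (moderate_regn (fun k => regn_slow_moderate (@regn_evolution_inv k))).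

(* A slow scale net is O(1/e); hence a single power of e serves for all the
   derivatives. *)
Lemma bigO_on_slice (f : mnet R n.+1) t K s : (forall k, regn slow str k f) ->
  bigO_on K (fun e x => normc (cpartials s (mslice t f e) x)) (fun e => e ^- 1).
Proof.
move=> fk; have [g [_ Fg] Hg] := bounded_rate_slice t s fk.
have [C C0 HC] := Fg 1%N; exists (C + 1); first by rewrite ltr_wpDl.
apply: filterS (filterI (near0_itv R) (filterI Hg HC)) => e [e01 [h1 h2]] x _.
apply: le_trans (h1 x I) _; apply: le_trans h2 _.
by rewrite mulrDl lerDl mul1r exprV_ge0.
Qed.

Lemma evolution_netK (e : R) z : evolution_inv_net e z * evolution_net e z = 1.
Proof. by rewrite mulrC; exact: cexpN. Qed.

Lemma space_spacetime t (x : 'rV[R]_n) : space (spacetime t x) = x.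
Proof. by apply/rowP => j; rewrite mxE spacetime_lift. Qed.

(** The form used for the wave front set: at time t the solution is the translate by [Lambda_e(t)]
    of the initial net times the evolution factor. *)
Lemma solution_net_slice t (e : R) (x : 'rV[R]_n) : solution_net e (spacetime t x) =
  (mslice t evolution_net * U : mnet R n) e (x - \row_j Lambda_net (a j) e t).
Proof.
have -> : solution_net e (spacetime t x) = W e (shear (Lm e) (spacetime t x)) by [].
have -> : shear (Lm e) (spacetime t x) = spacetime t (x - \row_j Lambda_net (a j) e t).
  apply/rowP => k; case: (unliftP ord0 k) => [j ->|->]; last by rewrite shear0 !spacetime0.
  by rewrite shear_lift !spacetime_lift spacetime0 !mxE.
by rewrite /W space_spacetime mulrC.
Qed.

Lemma cpartial_transported_time (e : R) (z : 'rV[R]_n.+1) : 0 < e <= 1 ->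
  cpartial ord0 (W e) z = (0 +i* 1)%C * B e z * W e z.
Proof.
move=> e01; have Cx x : C1_at (iC e) x by exact: regn_C1 (@regn_phase 0) e01.
have Bx x : C1_at (B e) x by exact: regn_C1 (@regn_shifted_potential 0) e01.
have Px x : C1_at (cprim (B e)) x.
  by exact: regn_C1 (regn_prim rslow (@regn_shifted_potential 1)) e01.
have Ux x : C1_at (U e \o @space R n) x by exact: regn_C1 (@regn_initial 0) e01.
have dC : cpartial ord0 (iC e) z = (0 +i* 1)%C * B e z.
  have := @cpartialM R _ ord0 (cst (0 +i* 1)%C) (cprim (B e)) z (smooth_C1 z (@smooth_cst _ _ _)) (Px z).
  by rewrite cpartial_cst cpartial_cprim_time// mul0r add0r.
have dE : cpartial ord0 (E e) z = (0 +i* 1)%C * B e z * E e z.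
  by rewrite -dC; exact: cpartial_cexp.
have := @cpartialM R _ ord0 (U e \o @space R n) (E e) z (Ux z) (C1_at_cexp (Cx z)).
rewrite dE cpartial_space unlift_none mul0r add0r => H.
by rewrite -[LHS]/(cpartial ord0 ((U e \o @space R n) * E e) z) H /W /=; ring.
Qed.

Lemma solution_net_time (e : R) (z : 'rV[R]_n.+1) : 0 < e <= 1 ->
  cpartial ord0 (solution_net e) z = (0 +i* 1)%C * A e z * solution_net e z +
    \sum_j a j e (const_mx (z ord0 ord0)) * cpartial (lift ord0 j) (solution_net e) z.
Proof.
move=> e01; have W1 x : C1_at (W e) x by exact: regn_C1 (@regn_transported 0) e01.
have W2 j x : C1_at (cpartial j (W e)) x by exact: regn_C1_partial (@regn_transported 1) e01.
have Ve : mnet_val solution_net e = W e \o shear (Lm e) by [].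
(* [B] is the potential along the shear by [L]; composing with the opposite shear returns to the
   original point. *)
have BK : B e (shear (Lm e) z) = A e z := congr1 (A e) (shearK (L e) z).
rewrite Ve (cpartial_shear_transport z (is_derive_opp_Lambda_net e01) W1 W2).
rewrite (cpartial_transported_time _ e01) BK; apply: congr1; apply: eq_bigr => j _.
have -> : (- L' e j (z ord0 ord0) +i* 0)%C = a j e (const_mx (z ord0 ord0)).
  have := a_real j (const_mx (z ord0 ord0)) e01.
  by rewrite /L' opprK; case: (a j e _) => x y /= ->.
by [].
Qed.

Lemma solution_net_initial (e : R) (x : 'rV[R]_n) : solution_net e (spacetime 0 x) = U e x.
Proof.
rewrite solution_net_slice; have -> : \row_j Lambda_net (a j) e 0 = 0 :> 'rV[R]_n.
  by apply/rowP => j; rewrite !mxE /Lambda_net integral_from0_0 oppr0.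
rewrite subr0 -[LHS]/(E e (spacetime 0 x) * U e x).
have -> : E e (spacetime 0 x) = 1; last by rewrite mul1r.
rewrite /E /iC; have -> : cprim (B e) (spacetime 0 x) = 0.
  by rewrite /cprim /prim spacetime0 !integral_from0_0.
by rewrite mulr0 cexp0.
Qed.

Lemma mnet_sum d (I : finType) (f : I -> mnet R d) (e : R) x :
  (\sum_i f i : mnet R d) e x = \sum_i f i e x.
Proof.
exact: (big_morph (fun g : mnet R d => g e x) (fun _ _ => erefl) erefl).
Qed.

(** Both identities hold exactly for every 0 < e <= 1, so the nets on the two sides agree near 0 and
    define the same class. *)
Lemma solution_net_cauchy :
  cauchy_solution (fun j => gclass (a j)) (gclass A) (gclass U) (gclass solution_net).
Proof.
split; last first.
  rewrite grestrE; apply: gclass_near; near=> e; apply/funext => x.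
  exact: solution_net_initial.
pose mi := mcst n.+1 (0 -i* 1 : R[i])%C.
have gDE j : gD j (gclass solution_net) = gclass (mi * mpartial j solution_net).
  by rewrite /gD gpartialE /gcst /gclass rmorphM.
rewrite gDE; under eq_bigr do rewrite gDE gpullE -rmorphM.
rewrite -rmorph_sum -rmorphM -rmorphD; apply: gclass_near.
apply: filterS (near0_itv R) => e e01; apply/funext => z.
rewrite -[RHS]/((\sum_j mpull n (a j) * (mi * mpartial (lift ord0 j) solution_net) : mnet R n.+1) e z +
  A e z * solution_net e z) mnet_sum.
rewrite -[LHS]/((0 -i* 1)%C * cpartial ord0 (solution_net e) z) solution_net_time// mulrDr.
rewrite addrC mulr_sumr; congr (_ + _).
  apply: eq_bigr => j _; rewrite mulrCA; by [].
rewrite !mulrA; have -> : (0 -i* 1)%C * (0 +i* 1)%C = 1 :> R[i].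
  by apply: complexP; rewrite ?ReM ?ImM /=; ring.
by rewrite mul1r.
Unshelve. all: by end_near. Qed.

End Solution.

(** * Choice of representatives and the wave front set identity *)

Section Conclusion.
Variable R : realType.

Lemma exists_bump d (M : R) : 0 < M -> exists2 chi : 'rV[R]_d -> R[i], smooth chi &
  (forall x, `|x| < M -> chi x = 1) /\ (forall x, M + 1 < `|x| -> chi x = 0).
Proof.
move=> M0; have M1 : 0 < M < M + 1 by rewrite M0 ltrDl ltr01.
have [chi [cs _ c1 c0]] := @smooth_bump R d 0 _ _ M1.
exists (ofreal chi) => //; split=> x xM; rewrite /ofreal.
  by rewrite c1 ?subr0 ?ltW.
by rewrite c0 ?subr0 ?ltW.
Qed.

(** The map [sigma] is [space] for the potential and the identity for the initial value. The cut-off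
    is 1 on an open neighbourhood of the support, hence the radius M + 1. *)
Lemma cutoff_repr d n (sigma : 'rV[R]_d -> 'rV[R]_n) (K : set 'rV[R]_n) (u : colombeau R d) :
  continuous sigma -> (forall chi, smooth chi -> smooth (chi \o sigma)) -> compact K ->
  gsupp u `<=` sigma @^-1` K ->
  exists2 w : mnet R d, gclass w = u &
  exists b : R, forall e : R, 0 < e <= 1 -> forall x, b < `|sigma x| -> w e x = 0.
Proof.
move=> sc ss Kc uK; have [M M0 KM] := compact_norm_bound Kc.
have [chi cs [c1 c0]] := @exists_bump n (M + 1) (addr_gt0 M0 ltr01).
have ru : gclass (repr u) = u by rewrite /gclass reprK.
have Vo : open [set x : 'rV[R]_d | `|sigma x| < M + 1].
  apply: (@open_comp _ _ (fun x : 'rV[R]_d => `|sigma x|) [set y | y < M + 1]) => [x _|].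
    by apply: (@continuous_comp _ _ _ sigma (fun x => `|x|)); [exact: sc|exact: norm_continuous].
  exact: open_lt.
exists (msmooth (ss _ cs) * repr u).
  rewrite -[RHS]ru; apply: (gclass_cutoff (ss _ cs) Vo) => [x|]; first exact: c1.
  by rewrite ru => x /uK /KM xM /=; rewrite (le_lt_trans xM)// ltrDl ltr01.
exists (M + 1 + 1) => e e01 x bx.
by rewrite -[LHS]/(chi (sigma x) * repr u e x) c0// mul0r.
Qed.

Lemma cvg_row n (c : R -> 'I_n -> R) (c0 : 'I_n -> R) :
  (forall j, c e j @[e --> 0^'+] --> c0 j) ->
  \row_j c e j @[e --> 0^'+] --> (\row_j c0 j : 'rV[R]_n).
Proof.
move=> cc B [P fP PB].
have : \forall e \near (0 : R)^'+, forall i, P ord0 i (c e i).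
  apply: filter_forall => i; apply: (cc i).
  by have := fP ord0 i; rewrite mxE.
apply: filterS => e Pe; apply: PB => i j.
by rewrite (ord1 i) mxE; exact: Pe.
Qed.

End Conclusion.
Theorem proposition4p12 (R : realType) (n : nat) (hn : (0 < n)%N)
  (a1 : 'I_n -> colombeau R 1) (a0 : colombeau R n.+1)
  (ha1_real : forall j, real_valued (a1 j))
  (ha1_reg : forall j, slow_scale_regular (a1 j))
  (ha0_reg : slow_scale_regular a0)
  (ha0_supp : compactly_supported_in_x a0)
  (ha0_log : slow_scale_log a0)
  (u0 : colombeau R n) (hu0 : compactly_supported u0)
  (u : colombeau R n.+1)
  (hu : cauchy_solution a1 a0 u0 u)
  (hu_unique : forall v : colombeau R n.+1, cauchy_solution a1 a0 u0 v -> v = u)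
  (Lambda : 'I_n -> R -> R)
  (hLambda : exists a1e : 'I_n -> mnet R 1,
    [/\ forall j, gclass (a1e j) = a1 j,
        forall j, real_net (a1e j),
        forall j t, {within [set e : R | 0 < e <= 1],
          continuous (fun e => Lambda_net (a1e j) e t)} &
        forall j t, (fun e => Lambda_net (a1e j) e t) @ 0^'+ --> Lambda j t]) :
  forall t : R, WF (grestr t u) = chi_inv Lambda t @` WF u0.
Proof.
move=> t; have [a1e [a1E a_real _ cL]] := hLambda.
have [K0 K0c a0K] := ha0_supp; have [K1 K1c u0K] := hu0.
have [|z|A AE [b A_cut]] := cutoff_repr _ (@smooth_space R n) K0c (u := a0).
- exact: space_continuous.
- by move=> /a0K [s [x [Kx ->]]]; rewrite /preimage /= space_spacetime.
have [||U UE [b' U_cut]] := @cutoff_repr R n n id K1 u0 _ _ K1c u0K => //.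
  by move=> x; exact: cvg_id.
have a_slow j : slow_scale_regular (gclass (a1e j)) by rewrite a1E.
have A_slow : slow_scale_regular (gclass A) by rewrite AE.
have A_log : slow_scale_log (gclass A) by rewrite AE.
pose v := solution_net a_real a_slow A_slow A_log A_cut U_cut.
pose E := mslice t (evolution_net a_real a_slow A_slow A_log A_cut).
pose Em := mslice t (evolution_inv_net a_real a_slow A_slow A_log A_cut).
have uv : u = gclass v.
  apply/esym/hu_unique; have -> : a1 = fun j => gclass (a1e j).
    by apply/funext => j; rewrite a1E.
  by rewrite -AE -UE; exact: solution_net_cauchy.
pose c (e : R) : 'rV[R]_n := \row_j Lambda_net (a1e j) e t.
pose c0 : 'rV[R]_n := \row_j Lambda j t.
have cc : c e @[e --> 0^'+] --> c0 by apply: cvg_row => j; exact: cL.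
have ccN : - c e @[e --> 0^'+] --> - c0 by exact: cvgN.
have vE (e : R) : mslice t v e = fun x => (E * U : mnet R n) e (x - c e).
  by apply/funext => x; exact: solution_net_slice.
(* Both operations are reversible: the shift by - c e undoes the translation, and the inverse
   evolution factor undoes the multiplication. *)
have key x xi : micro_regular (gclass (mslice t v)) (x + c0) xi <-> micro_regular (gclass U) x xi.
  split=> H.
    have H1 : micro_regular (gclass (E * U)) x xi.
      rewrite -(addrK c0 x); apply: (micro_regular_translation ccN _ H).
      near=> e; rewrite vE; apply/funext => y; by rewrite opprK addrK.
    have -> : gclass U = gclass (Em * (E * U)).
      apply: gclass_near; near=> e; apply/funext => y.
      rewrite -[RHS]/(Em e y * (E e y * U e y)) mulrA.
      have -> : Em e y * E e y = 1 by exact: evolution_netK.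
      by rewrite mul1r.
    (* P = 1 because slow scale nets are O(1/e) together with all derivatives. *)
    apply: (micro_regular_mul (P := 1%N) _ H1) => K _ s; apply: bigO_on_slice => k.
    exact: (regn_evolution_inv a_real a_slow A_slow A_log A_cut).
  apply: (micro_regular_translation cc _ (micro_regular_mul (P := 1%N) _ H)).
    by near=> e; exact: vE.
  by move=> K _ s; apply: bigO_on_slice => k; exact: (regn_evolution a_real a_slow A_slow A_log A_cut).
have chiE x xi : chi_inv Lambda t (x, xi) = (x + c0, xi).
  by rewrite /chi_inv; congr (_, _); apply/rowP => j; rewrite !mxE.
rewrite uv grestrE -UE; apply/seteqP; split=> [[y xi] [/= xi0 nH]|_ [[x xi] [/= xi0 nH] <-]].
  exists (y - c0, xi); last by rewrite chiE subrK.
  by split=> //= H; apply: nH; rewrite -(subrK c0 y); apply/key.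
by rewrite chiE; split=> //= /key.
Unshelve. all: by end_near. Qed.
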